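(* Let $k$ be a positive integer and let $G$ be a $2$-connected but not $3$-connected graph. If $\delta(G)\ge k+1$, then $G$ contains $k$ cycles satisfying the length condition.
   Context: All graphs are finite and simple; $\delta(G)$ is the minimum degree. A sequence of cycles $H_1,\dots,H_k$ satisfies the length condition if $|E(H_1)|\ge 2$ and $|E(H_{i+1})|-|E(H_i)|=2$ for $1\le i\le k-1$. *)

(* Defs.v *)
From mathcomp Require Import all_boot.

Set Implicit Arguments.
Unset Strict Implicit.
Unset Printing Implicit Defensive.

Record sgraph := SGraph {
  vertex :> finType;
  adj : rel vertex;
  adj_sym : symmetric adj;
  adj_irr : irreflexive adj
}.

Definition degree (G : sgraph) (x : G) : nat := #|[set y | adj x y]|.

(* Every degree is smaller than the order #|G|, so for a nonempty graph the
   default value #|G| never affects the minimum. *)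
Definition min_degree (G : sgraph) : nat :=
  \big[minn/#|G|]_(x : G) degree x.

Definition induced_adj (G : sgraph) (A : {set G}) : rel G :=
  [rel x y | [&& x \in A, y \in A & adj x y]].

Definition induced_connected (G : sgraph) (A : {set G}) : bool :=
  [forall x in A, forall y in A, connect (induced_adj A) x y].

(* The bound on the order makes K_(n+1) n-connected but not (n+1)-connected. *)
Definition nconnected (n : nat) (G : sgraph) : bool :=
  (n < #|G|) && [forall S : {set G}, (#|S| < n) ==> induced_connected (~: S)].

(* A cycle is given by its cyclic vertex sequence; [ucycle] alone also accepts
   the empty sequence and a single edge traversed back and forth. *)
Definition is_cycle (G : sgraph) (c : seq G) : bool :=
  (2 < size c) && ucycleb (@adj G) c.

Definition cycle_edges (G : sgraph) (c : seq G) : {set {set G}} :=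
  [set [set x; next c x] | x in c].

Definition length_condition (G : sgraph) (H : seq (seq G)) : Prop :=
  2 <= #|cycle_edges (nth [::] H 0)| /\
  forall i, i.+1 < size H ->
    #|cycle_edges (nth [::] H i.+1)| = #|cycle_edges (nth [::] H i)| + 2.

(* Main.v *)
Require Import Defs.
From Stdlib Require Import Classical.
From mathcomp Require Import all_boot zify.

Set Implicit Arguments.
Unset Strict Implicit.
Unset Printing Implicit Defensive.

(* Call a family of paths (of lengths at least 2) whose lengths form an
   arithmetic progression of difference 1 or 2 admissible.  If {x, y} is a
   2-cut, then each of two of its sides contains k admissible x-y paths;
   concatenating a path of one side with a path of the other one gives k cycles
   whose lengths increase by exactly 2.

   The k admissible x-y paths exist as soon as adding the edge xy makes the
   graph 2-connected and every vertex other than x and y has degree at least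
   k + 1 (Gao, Huo, Liu and Ma).  This goes by induction on the order.  A set D
   cut off by x (or y) and one more vertex allows induction inside D, so suppose
   that there is none.  Pick a core at x: a set H = {x} + T + T2 such that every
   vertex of T is reached from x inside H by paths of f common admissible
   lengths.  Contracting T and deleting the rest of H costs a vertex at most
   f - 1 of its degree, so induction gives k + 1 - f admissible paths from T to
   y, and admissible lengths add up.  If the contraction is not 2-connected, a
   part D dangles at a vertex v and sees H only in {x} + T2; then D is used in
   the same way, with T2 and v instead of T and y.  The cores are
   - a maximal clique containing x, if x is in a triangle;
   - otherwise {x, b1, b2} with a maximal clique T of common neighbours of two
     neighbours b1, b2 of x, if some of these common neighbours are adjacent;
   - otherwise a complete bipartite graph with parts A (containing x) and T, with
     |A| <= |T| and |A| maximal.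
   They fail only if all neighbours of y lie in the core.  Exchanging x and y,
   this leaves the case that x and y have the same neighbours B; then one takes a
   core in H = {x} + (B - w) + ... with target w for some w in B.
   The only core for which the dangling part needs another argument is
   |A| = 2, where the two admissible paths of the case k = 2, which is proved
   first and allows one vertex of small degree, provide the missing length. *)

(** * Arithmetic progressions of lengths *)

(** Families of f and j admissible lengths combine to f + j - 1 lengths, and this single lost length
    fixes all the constants: it is why a core with f lengths asks for k + 1 - f further ones. Each
    core is maximal of its kind because an outside vertex with too many neighbours in the core could
    be used to enlarge it; this bounds the loss of degree. Both differences have to be allowed,
    since cliques give consecutive lengths while bipartite cores give lengths of one parity only.
    The gap 2 between the cycles arises at the very end, when the progressions of the two sides are
    advanced together or one at a time. All graphs of the induction live on one finite type: a graph
    is a relation together with a vertex set. Deletion shrinks the set, contraction changes the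
    relation. Connectivity is expressed by the sizes of boundaries, which are easy to follow through
    both operations, and paths are extracted only where they are needed. *)

Definition progression (L : nat -> Prop) (k : nat) : Prop :=
  exists l d, (d = 1 \/ d = 2) /\ forall i, i < k -> L (l + d * i).

Lemma progression_sub (L L' : nat -> Prop) j k :
  (forall a, L a -> L' a) -> j <= k -> progression L k -> progression L' j.
Proof.
move=> LL' jk [l [d [hd H]]]; exists l, d; split=> // i ij.
by apply/LL'/H/(leq_trans ij).
Qed.

Lemma progression1 (L : nat -> Prop) a : L a -> progression L 1.
Proof.
by move=> La; exists a, 1; split; [left|case=> // _; rewrite muln0 addn0].
Qed.

(* Steps 1 and 2 combine to step 1: the step-2 progression covers the even
   offsets, and two terms of the other one supply the parity. *)
Lemma progression_add12 (L1 L2 L : nat -> Prop) j k l m :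
  1 < j -> 0 < k ->
  (forall i, i < j -> L1 (l + 1 * i)) -> (forall i, i < k -> L2 (m + 2 * i)) ->
  (forall a b, L1 a -> L2 b -> L (a + b)) -> progression L (j + k).-1.
Proof.
move=> j1 k0 H1 H2 H; exists (l + m), 1; split; first by left.
move=> i hi.
(* For large i the step-2 progression is exhausted, and the step-1 progression supplies what exceeds
   its last term. *)
have [h|h] := leqP k (i./2).
- have := H _ _ (H1 (i - 2 * k.-1) _) (H2 k.-1 _).
  have -> : l + 1 * (i - 2 * k.-1) + (m + 2 * k.-1) = l + m + 1 * i by lia.
  by apply; lia.
have := H _ _ (H1 (i - 2 * i./2) _) (H2 i./2 _).
have -> : l + 1 * (i - 2 * i./2) + (m + 2 * i./2) = l + m + 1 * i by lia.
by apply; lia.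
Qed.

Lemma progression_add_same (L1 L2 L : nat -> Prop) j k l m d :
  d = 1 \/ d = 2 -> 0 < j -> 0 < k ->
  (forall i, i < j -> L1 (l + d * i)) -> (forall i, i < k -> L2 (m + d * i)) ->
  (forall a b, L1 a -> L2 b -> L (a + b)) -> progression L (j + k).-1.
Proof.
move=> hd j0 k0 H1 H2 H; exists (l + m), d; split=> // i hi.
have [h|h] := leqP k i.
- have := H _ _ (H1 (i - k.-1) _) (H2 k.-1 _).
  have -> : l + d * (i - k.-1) + (m + d * k.-1) = l + m + d * i.
    by rewrite addnACA -mulnDr subnK; lia.
  by apply; lia.
have := H _ _ (H1 0 _) (H2 i _).
by rewrite muln0 addn0 addnA; apply.
Qed.

Lemma progression_add (L1 L2 L : nat -> Prop) j k :
  0 < j -> 0 < k -> progression L1 j -> progression L2 k ->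
  (forall a b, L1 a -> L2 b -> L (a + b)) -> progression L (j + k).-1.
Proof.
move=> j0 k0 [l [d [hd H1]]] [m [c [hc H2]]] H.
have H' a b : L2 a -> L1 b -> L (a + b) by rewrite addnC => ? ?; apply: H.
(* A single term is a progression of any difference, so a family of one length adopts the difference
   of the other family. *)
have one (L0 : nat -> Prop) a b d' : 
    (forall i, i < 1 -> L0 (a + d' * i)) -> forall i, i < 1 -> L0 (a + b * i).
  by move=> h i; rewrite ltnS leqn0 => /eqP ->; have := h 0; rewrite !muln0; apply.
have [j1|j1] := leqP j 1.
  have ? : j = 1 by lia. subst j.
  exact: (progression_add_same hc _ k0 (one _ _ c _ H1) H2 H).
have [k1|k1] := leqP k 1.
  have ? : k = 1 by lia. subst k.
  exact: (progression_add_same hd j0 _ H1 (one _ _ d _ H2) H).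
case: hd hc H1 H2 => -> [] -> H1 H2.
- by apply: progression_add_same H1 H2 H; auto.
- by apply: progression_add12 H1 H2 H.
- by rewrite addnC; apply: progression_add12 H2 H1 H'.
- by apply: progression_add_same H1 H2 H; auto.
Qed.

(** * Paths and boundaries *)

Section Graph.
Variables (V : finType) (e : rel V).
Implicit Types (A B C D E H S T X Y Z : {set V}) (u v w x y z : V) (p q : seq V).

Definition nbrs S u := [set w in S | e u w].
Definition adj_to T u := [exists t in T, e t u].
Definition boundary S D := [set w in S :\: D | adj_to D w].
Definition adj_sets D T := [exists u in D, adj_to T u].
(** The start x is kept out of p and need not lie in X. Paths that share only a junction can then be
    concatenated once their sets X are disjoint and the second set misses the first start. *)
Definition spath X x p y : Prop :=
  [/\ path e x p, uniq (x :: p), {subset p <= X} & last x p = y].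
Definition reach X u :=
  [set w | connect [rel a b | [&& a \in X, b \in X & e a b]] u w].
Definition linked_len X T z a : Prop :=
  exists t p, [/\ t \in T, spath X t p z & size p = a].
(** One length has to serve all of T: a path of the contracted graph reveals only afterwards at
    which vertex of T it starts. *)
Definition uniform_len X x T a : Prop :=
  forall t, t \in T -> exists2 p, spath X x p t & size p = a.
Definition path_progression k X x y :=
  progression (fun a => exists2 p, spath X x p y & size p = a) k.
(** Connectedness of C stated by cuts, the form in which [separation] uses it. *)
Definition connected_to C z :=
  forall D, D != set0 -> D \subset C :\ z -> boundary C D != set0.

Lemma adj_toP T u : reflect (exists2 t, t \in T & e t u) (adj_to T u).
Proof. exact: exists_inP. Qed.

Lemma adj_setsP D T :
  reflect (exists u t, [/\ u \in D, t \in T & e t u]) (adj_sets D T).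
Proof.
apply: (iffP exists_inP) => [[u uD /adj_toP[t tT etu]]|[u [t [uD tT etu]]]].
  by exists u, t.
by exists u => //; apply/adj_toP; exists t.
Qed.

Lemma in_boundary S D w : (w \in boundary S D) = [&& w \in S, w \notin D & adj_to D w].
Proof. by rewrite !inE; case: (w \in S); case: (w \in D). Qed.

Lemma in_nbrs S u w : (w \in nbrs S u) = (w \in S) && e u w.
Proof. by rewrite inE. Qed.

Lemma boundaryP S D w :
  reflect (exists u, [/\ u \in D, e u w, w \in S & w \notin D]) (w \in boundary S D).
Proof.
rewrite in_boundary; apply: (iffP and3P) => [[wS wD /adj_toP[u uD euw]]|].
  by exists u.
by case=> u [uD euw wS wD]; split=> //; apply/adj_toP; exists u.
Qed.

Lemma boundary_sub S D : boundary S D \subset S.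
Proof. by apply/subsetP => w; rewrite in_boundary => /andP[]. Qed.

Lemma spath1 X x y : irreflexive e -> e x y -> y \in X -> spath X x [:: y] y.
Proof.
move=> ir exy yX; split; rewrite /= ?exy ?andbT ?inE //.
  by apply: contraTneq exy => ->; rewrite ir.
by move=> w; rewrite inE => /eqP->.
Qed.

Lemma spath_sub X Y x p y : X \subset Y -> spath X x p y -> spath Y x p y.
Proof. by move=> /subsetP XY [? ? s ?]; split=> // w /s /XY. Qed.

Lemma spath_cat X Y x p y q z :
  x \notin Y -> [disjoint X & Y] -> spath X x p y -> spath Y y q z ->
  spath (X :|: Y) x (p ++ q) z.
Proof.
move=> xY XY [pp pu ps pl] [qp qu qs ql]; split.
- by rewrite cat_path pp pl.
- have uq : uniq q by case/andP: qu.
  rewrite -cat_cons cat_uniq pu uq andbT.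
  apply/hasPn => w wq; rewrite inE negb_or; have wY := qs w wq; apply/andP; split.
    by apply: contraNneq xY => <-.
  by apply: contraL wY => /ps wX; rewrite (disjointFr XY wX).
- by move=> w; rewrite mem_cat inE => /orP[/ps->|/qs->]; rewrite ?orbT.
- by rewrite last_cat pl.
Qed.

Lemma spath_rev X x p y :
  symmetric e -> x \in X -> spath X x p y -> exists2 q, spath X y q x & size q = size p.
Proof.
move=> es xX [pp pu ps pl]; exists (rev (belast x p)); last by rewrite size_rev size_belast.
have hr : rev (x :: p) = y :: rev (belast x p) by rewrite lastI pl rev_rcons.
split.
- by rewrite -pl rev_path; apply: sub_path pp => a b /=; rewrite es.
- by rewrite -hr rev_uniq.
- move=> w; rewrite mem_rev => /mem_belast; rewrite inE => /orP[/eqP->//|/ps//].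
- by have := congr1 (last y) hr; rewrite rev_cons last_rcons.
Qed.

Lemma path_progression_sub k j X Y x y :
  X \subset Y -> j <= k -> path_progression k X x y -> path_progression j Y x y.
Proof.
by move=> XY jk; apply: progression_sub jk => a [p pp sp]; exists p => //; apply: spath_sub pp.
Qed.

Lemma path_progression_rev k X x y : symmetric e -> x \in X -> path_progression k X x y ->
  path_progression k X y x.
Proof.
move=> es xX; apply: progression_sub (leqnn k) => a [p /(spath_rev es xX)[q ? <-] <-]; by exists
  q.
Qed.

Lemma uniform_linked H x T C z a b :
  x \notin C -> [disjoint H & C] -> uniform_len H x T a -> linked_len C T z b ->
  exists2 p, spath (H :|: C) x p z & size p = a + b.
Proof.
move=> xC HC fl [t [p [tT pp <-]]]; have [q qp <-] := fl t tT.
by exists (q ++ p); [apply: spath_cat pp|rewrite size_cat].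
Qed.

Lemma uniform_linked_join H x T C z f k :
  0 < f -> 0 < k -> x \notin C -> [disjoint H & C] ->
  progression (uniform_len H x T) f -> progression (linked_len C T z) k -> path_progression (f +
    k).-1 (H :|: C) x z.
Proof.
move=> f0 k0 xC HC Af Ak; apply: progression_add f0 k0 Af Ak _ => a b fa lb.
exact: uniform_linked fa lb.
Qed.

Lemma path_progression_join X Y x y z j k :
  0 < j -> 0 < k -> x \notin Y -> [disjoint X & Y] ->
  path_progression j X x y -> path_progression k Y y z -> path_progression (j + k).-1 (X :|: Y) x
    z.
Proof.
move=> j0 k0 xY XY Aj Ak; apply: progression_add j0 k0 Aj Ak _ => a b [p pp <-] [q qq <-].
by exists (p ++ q); [apply: spath_cat qq|rewrite size_cat].
Qed.

Lemma path_progression1 X x p y : spath X x p y -> path_progression 1 X x y.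
Proof. by move=> pp; apply: (@progression1 _ (size p)); exists p. Qed.

Lemma reach_refl X u : u \in reach X u.
Proof. by rewrite inE connect0. Qed.

Lemma reach_spath X u w : w \in reach X u -> exists p, spath X u p w.
Proof.
rewrite inE => /connectP[p pp ->]; case/shortenP: pp => q qq uq _.
exists q; split=> //.
  by apply: sub_path qq => a b /= /and3P[].
elim: q u qq {uq p} => //= a q IH u /andP[/and3P[_ aX _] qq] c.
by rewrite inE => /orP[/eqP->//|]; apply: IH qq c.
Qed.

Lemma reach_sub X u : u \in X -> reach X u \subset X.
Proof.
move=> uX; apply/subsetP => w /reach_spath[p [_ _ ps <-]].
by case/lastP: p ps => // p a ps; rewrite last_rcons; apply: ps; rewrite mem_rcons mem_head.
Qed.

Lemma reach_step X u a w : u \in X -> a \in reach X u -> w \in X -> e a w -> w \in reach X u.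
Proof.
move=> uX ar wX eaw; have aX := subsetP (reach_sub uX) a ar.
move: ar; rewrite !inE => /connect_trans; apply; apply: connect1.
by rewrite /= aX wX.
Qed.

(** A part of the component without boundary would be closed under adjacency inside X, and would
    then contain z as well. *)
Lemma reach_conn X z : symmetric e -> z \in X -> connected_to (reach X z) z.
Proof.
move=> es zX D Dn DC; apply/eqP => b0.
have cl : closed [rel a b | [&& a \in X, b \in X & e a b]] (mem D).
  have half a b : [&& a \in X, b \in X & e a b] -> a \in D -> b \in D.
    move=> /and3P[aX bX eab] aD; have aR : a \in reach X z.
      by have /subsetP/(_ a aD) := DC; rewrite !inE => /andP[].
    apply: contraT => bD; have : b \in boundary (reach X z) D.
      by apply/boundaryP; exists a; split=> //; apply: reach_step eab.
    by rewrite b0 inE.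
  move=> a b /= h; apply/idP/idP; first exact: half.
  by apply: half; rewrite es andbCA.
have [d dD] := set0Pn _ Dn.
have /subsetP/(_ d dD) := DC; rewrite !inE => /andP[_ /(closed_connect cl)].
rewrite /= [d \in _]dD => zD.
by have /subsetP/(_ z zD) := DC; rewrite !inE eqxx.
Qed.

(** If v could not reach z outside D, then D together with the component of v would have an empty
    boundary in C. *)
Lemma connected_tail C z D v :
  connected_to C z -> v \in C -> D \subset C :\ z -> v \notin D -> boundary C D \subset [set v] ->
  exists p, spath (C :\: D) v p z.
Proof.
move=> cC vC DC vD bD.
have vX : v \in C :\: D by rewrite inE vD.
have [zR|zR] := boolP (z \in reach (C :\: D) v); first exact: reach_spath.
have /negP[] : boundary C (D :|: reach (C :\: D) v) != set0.
  apply: cC; first by apply/set0Pn; exists v; rewrite inE reach_refl orbT.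
  rewrite subUset DC; apply/subsetP => w wR; rewrite !inE.
  have /subsetP/(_ w wR) := reach_sub vX; rewrite inE => /andP[_ ->].
  by rewrite andbT; apply: contraNneq zR => <-.
rewrite -subset0; apply/subsetP => w /boundaryP[u [uU euw wC]].
rewrite !in_setU negb_or => /andP[wD wR].
move: uU; rewrite in_setU => /orP[uD|uR].
  have /(subsetP bD) : w \in boundary C D by apply/boundaryP; exists u.
  by rewrite inE => /eqP wv; rewrite wv reach_refl in wR.
by rewrite (reach_step vX uR _ euw) // ?inE ?wD in wR.
Qed.

End Graph.

(** * Contraction *)

(* [r_bd] says that the graph induced on S becomes 2-connected once x and y are
   joined; Z collects the vertices whose degree is not controlled. *)
Record rooted (V : finType) k (Z : {set V}) (e : rel V) (S : {set V}) x y : Prop := Rooted {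
  r_sym : symmetric e;
  r_irr : irreflexive e;
  r_x : x \in S;
  r_y : y \in S;
  r_xy : x != y;
  r_nxy : ~~ e x y;
  r_ne : exists u, u \in S :\: [set x; y] :\: Z;
  r_bd : forall D, D != set0 -> D \subset S :\: [set x; y] -> 1 < #|boundary e S D|;
  r_deg : forall u, u \in S :\: [set x; y] :\: Z -> k < #|nbrs e S u| }.

(** The relation is quantified because contraction changes it; the order that decreases is the size
    of S. *)
Definition paths_upto (V : finType) n k (Z : {set V}) : Prop :=
  forall (e : rel V) (S : {set V}) x y, #|S| <= n -> rooted k Z e S x y -> path_progression e k S
    x y.

Lemma paths_upto_le (V : finType) m n k (Z : {set V}) : m <= n -> paths_upto n k Z -> paths_upto
  m k Z.
Proof. by move=> mn P e S x y Sm; apply: P; apply: leq_trans mn. Qed.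

(* 2-connectedness of C after contracting T and joining it to z. *)
Definition separation (V : finType) (e : rel V) (C T : {set V}) z : Prop :=
  forall D, D != set0 -> D \subset C :\ z ->
    boundary e C D != set0 /\ (1 < #|boundary e C D| \/ adj_sets e D T).

Section Contract.
Variables (V : finType) (e : rel V).
Hypotheses (e_sym : symmetric e) (e_irr : irreflexive e).
Variables (C T : {set V}) (z : V).

Section Rel.
Variable t0 : V.
(* T is contracted to its element t0.  Leaving out the edge from t0 to z forces
   all paths between them to have length at least 2. *)
Definition contract_rel : rel V := [rel a b |
  [|| [&& a \in C, b \in C & e a b],
      [&& a == t0, b \in C :\ z & adj_to e T b]
    | [&& b == t0, a \in C :\ z & adj_to e T a]]].

Lemma contract_relE a b : contract_rel a b =
  [|| [&& a \in C, b \in C & e a b],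
      [&& a == t0, b \in C :\ z & adj_to e T b]
    | [&& b == t0, a \in C :\ z & adj_to e T a]].
Proof. by []. Qed.

Lemma contract_rooted k Z :
  t0 \in T -> z \in C -> [disjoint C & T] -> (exists u, u \in C :\ z :\: Z) ->
  separation e C T z ->
  (forall u, u \in C :\ z :\: Z -> k < #|nbrs e C u| + adj_to e T u) ->
  rooted k Z contract_rel (t0 |: C) t0 z.
Proof.
move=> t0T zC CT ne sep deg.
have t0C : t0 \notin C by rewrite (disjointFl CT t0T).
have t0z : t0 != z by apply: contraNneq t0C => ->.
have eI : (t0 |: C) :\: [set t0; z] = C :\ z.
  apply/setP => w; rewrite !inE negb_or; have [->|] := eqVneq w t0; last by [].
  by rewrite (negbTE t0C) !andbF.
split; rewrite ?eI ?setU11 //.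
- move=> a b; rewrite !contract_relE e_sym; congr (_ || _); last exact: orbC.
  by rewrite andbCA.
- move=> a; rewrite contract_relE e_irr !andbF /=; have [->|] := eqVneq a t0; last by [].
  by rewrite !inE (negbTE t0C) !andbF.
- by rewrite inE zC orbT.
- by rewrite contract_relE (negbTE t0C) !inE eqxx /= [z == t0]eq_sym (negbTE t0z) eqxx.
- move=> D Dn DC; have [_ h] := sep D Dn DC.
  have sub : boundary e C D \subset boundary contract_rel (t0 |: C) D.
    apply/subsetP => w /boundaryP[u [uD euw wC wD]]; apply/boundaryP; exists u; split=> //.
      by have /subsetP/(_ u uD) := DC; rewrite !inE => /andP[_ uC]; rewrite contract_relE uC wC
        euw.
    by rewrite inE wC orbT.
  case: h => h; first exact: leq_trans h (subset_leq_card sub).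
  have [bn _] := sep D Dn DC; rewrite -card_gt0 in bn.
  have t0b : t0 \notin boundary e C D by rewrite in_boundary (negbTE t0C).
  apply: leq_trans (_ : #|t0 |: boundary e C D| <= _); first by rewrite cardsU1 t0b ltnS.
  apply: subset_leq_card; rewrite subUset sub andbT sub1set.
  have /adj_setsP[u [t [uD tT etu]]] := h.
  apply/boundaryP; exists u; split=> //; last 2 first.
  - exact: setU11.
  - by apply: contraNN t0C => /(subsetP DC); rewrite !inE => /andP[].
  have tu : adj_to e T u by apply/adj_toP; exists t.
  by rewrite contract_relE eqxx (subsetP DC u uD) tu !orbT.
- move=> u uI; apply: leq_trans (deg u uI) _.
  have uC : u \in C :\ z by move: uI; rewrite inE => /andP[].
  have uC' : u \in C by move: uC; rewrite inE => /andP[].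
  have sub : nbrs e C u \subset nbrs contract_rel (t0 |: C) u.
    by apply/subsetP => w; rewrite !in_nbrs => /andP[wC euw]; rewrite inE contract_relE wC orbT
      uC' euw.
  have [tu|_] := boolP (adj_to e T u); last by rewrite addn0 subset_leq_card.
  rewrite addn1; have <- : #|t0 |: nbrs e C u| = #|nbrs e C u|.+1.
    by rewrite cardsU1 in_nbrs (negbTE t0C).
  apply: subset_leq_card; rewrite subUset sub andbT sub1set in_nbrs setU11 contract_relE.
  by rewrite eqxx uC tu !orbT.
Qed.

(** Only the first edge can use t0, because the vertices are distinct. It lifts to an edge leaving
    some t in T, and it does not end at z, so the length exceeds 1. *)
Lemma contract_spath p :
  t0 \in T -> z \in C -> [disjoint C & T] -> spath contract_rel (t0 |: C) t0 p z ->
  1 < size p /\ linked_len e C T z (size p).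
Proof.
move=> t0T zC CT [pp pu ps pl].
have t0C : t0 \notin C by rewrite (disjointFl CT t0T).
have t0z : t0 != z by apply: contraNneq t0C => ->.
case: p pp pu ps pl => [|a p] pp pu ps pl; first by rewrite -pl eqxx in t0z.
have [t0p up] := andP pu; have sC : {subset a :: p <= C}.
  move=> w wp; have := ps w wp; rewrite !inE => /orP[/eqP wt|//].
  by rewrite -wt wp in t0p.
have aC : a \in C by apply: sC; rewrite mem_head.
move: pp; rewrite [path _ _ _]/= contract_relE (negbTE t0C) eqxx /=.
have -> : (a == t0) = false by apply: contraNF t0C => /eqP<-.
rewrite orbF /= => /andP[/andP[az ta] pp].
have /adj_toP[t tT eta] := ta.
have pe : path e a p.
  move: pp sC; clear -t0C; elim: p a => //= b p IH a /andP[h pp] sC.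
  have aC : a \in C by apply: sC; rewrite mem_head.
  have bC : b \in C by apply: sC; rewrite !inE eqxx orbT.
  rewrite (IH b pp); last by move=> w wp; apply: sC; rewrite !inE; move: wp; rewrite inE => ->;
    rewrite orbT.
  move: h; rewrite contract_relE aC bC /= andbT => /or3P[//|/and3P[/eqP h]|/and3P[/eqP h]].
    by rewrite -h aC in t0C.
  by rewrite -h bC in t0C.
split.
  by case: p pl {pu up ps t0p sC pp pe} => //= h; rewrite -h !inE eqxx in az.
exists t, (a :: p); split=> //; split; rewrite //= ?eta //.
apply/andP; split; last exact: up.
by apply: contraL tT => /sC tC; rewrite (disjointFr CT tC).
Qed.
End Rel.

Lemma contract k Z :
  paths_upto #|C|.+1 k Z -> z \in C -> [disjoint C & T] -> (exists u, u \in C :\ z :\: Z) ->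
  separation e C T z ->
  (forall u, u \in C :\ z :\: Z -> k < #|nbrs e C u| + adj_to e T u) ->
  progression (fun a => 1 < a /\ linked_len e C T z a) k.
Proof.
move=> P zC CT ne sep deg.
(* C without z has z as its only possible boundary vertex, so the separation forces an edge to T. *)
have [t0 t0T] : exists t, t \in T.
  have [u uC] := ne; have Dn : C :\ z != set0.
    by apply/set0Pn; exists u; move: uC; rewrite inE => /andP[].
  have [_ [h|/adj_setsP[_ [t [_ tT _]]]]] := sep _ Dn (subxx _); last by exists t.
  have : boundary e C (C :\ z) \subset [set z].
    by apply/subsetP => w; rewrite in_boundary !inE => /and3P[-> ]; rewrite andbT negbK.
  by move=> /subset_leq_card; rewrite cards1 leqNgt h.
have R := contract_rooted t0T zC CT ne sep deg.
have le : #|t0 |: C| <= #|C|.+1 by rewrite cardsU1; case: (t0 \notin C).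
by apply: progression_sub (leqnn k) (P _ _ _ _ le R) => a [p pp <-]; exact: contract_spath pp.
Qed.

(** This is the separation of the singleton {u}. The bound is what an induction for a single path
    requires, which happens when the core alone has k lengths. *)
Lemma separation_deg u :
  separation e C T z -> u \in C :\ z -> 1 < #|nbrs e C u| + adj_to e T u.
Proof.
move=> sep uC; have un : [set u] != set0 by apply/set0Pn; exists u; rewrite inE.
have us : [set u] \subset C :\ z by rewrite sub1set.
have [] := sep _ un us.
have sub : boundary e C [set u] \subset nbrs e C u.
  apply/subsetP => w /boundaryP[v [/set1P -> euw wC _]].
  by rewrite in_nbrs wC.
rewrite -card_gt0 => b0 [b1|/adj_setsP[v [t [/set1P -> tT etu]]]].
  by apply: leq_trans (leq_addr _ _); apply: leq_trans b1 (subset_leq_card sub).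
have -> : adj_to e T u by apply/adj_toP; exists t.
by rewrite addn1 ltnS; apply: leq_trans b0 (subset_leq_card sub).
Qed.
End Contract.

(** The target z is y in the main use, and a neighbour w of y when y sees only the core and w.
    Keeping just these properties lets both cases run through the same lemmas. *)
Record region (V : finType) k (Z : {set V}) (e : rel V) (S : {set V}) x (H C : {set V}) z : Prop
  := Region {
  g_x : x \in H;
  g_HC : [disjoint H & C];
  g_z : z \in C;
  g_conn : connected_to e C z;
  g_closed : forall u, u \in C :\ z -> nbrs e S u \subset H :|: C;
  g_cut : forall D, D != set0 -> D \subset C :\ z -> 1 < #|boundary e S D :\ x|;
  g_deg : forall u, u \in C :\ z :\: Z -> k < #|nbrs e S u| }.

(* If D dangles at v, contracting T makes v a cut vertex. *)
Definition dangling (V : finType) (e : rel V) (C T : {set V}) z (D : {set V}) v : Prop :=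
  [/\ D != set0, D \subset C :\ z, v \in C :\: D, ~~ adj_sets e D T & boundary e C D \subset [set
    v]].

(** * Path families through a core or a dangling part *)

Section Core.
Variables (V : finType) (e : rel V).
Hypotheses (e_sym : symmetric e) (e_irr : irreflexive e).
Implicit Types (A B C D E H S T X Y Z : {set V}) (u v w x y z : V) (p q : seq V).

Lemma spath_avoid X x p y : spath e X x p y -> spath e (X :\ x) x p y.
Proof.
move=> [pp pu ps pl]; split=> // w wp; rewrite !inE (ps w wp) andbT.
by have /andP[xp _] := pu; apply: contraNneq xp => <-.
Qed.

Lemma boundary_region k Z S x H C z D w : region k Z e S x H C z -> D \subset C :\ z ->
  w \in boundary e S D -> w \in C -> w \in boundary e C D.
Proof. by move=> rg DC /boundaryP[u [uD euw wS wD]] wC; apply/boundaryP; exists u. Qed.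

Lemma nbrs_region k Z S x H C z u : region k Z e S x H C z -> u \in C :\ z ->
  #|nbrs e S u| <= #|nbrs e H u| + #|nbrs e C u|.
Proof.
move=> rg uC; apply: leq_trans (leq_card_setU _ _).
apply: subset_leq_card; apply/subsetP => w wS.
have := subsetP (g_closed rg uC) w wS; move: wS; rewrite !inE => /andP[_ ->].
by rewrite !andbT.
Qed.

(** The core has to be left even when f >= k, hence the maximum with 1; the predecessor is the loss
    in [progression_add]. *)
Lemma leq_core k f : 0 < f -> k <= (f + maxn 1 (k.+1 - f)).-1.
Proof. by lia. Qed.

(** Degree count in the contraction: of more than k neighbours at most f - 1 + t lie in the core,
    and the contracted vertex gives t back. The hypothesis 1 < c + t, from [separation_deg], handles
    the maximum with 1. *)
Lemma core_loss k f a h c (t : bool) :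
  0 < f -> k < a -> a <= h + c -> h <= f.-1 + t -> 1 < c + t -> maxn 1 (k.+1 - f) < c + t.
Proof. by case: t => /=; lia. Qed.

Lemma core_paths k Z S x H C z T f :
  region k Z e S x H C z -> 0 < f -> T \subset H ->
  progression (uniform_len e H x T) f ->
  (forall u, u \in C :\ z :\: Z -> #|nbrs e H u| <= f.-1 + adj_to e T u) ->
  paths_upto #|C|.+1 (maxn 1 (k.+1 - f)) Z -> (exists u, u \in C :\ z :\: Z) ->
  (forall D v, ~ dangling e C T z D v) -> path_progression e k (H :|: C) x z.
Proof.
move=> rg f0 TH fl loss P ne nd.
have CT : [disjoint C & T].
  by rewrite disjoint_sym; apply: disjointWl TH (g_HC rg).
(* A set violating the separation has a single boundary vertex and no neighbour in T, so it
   dangles. *)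
have sep : separation e C T z.
  move=> D Dn DC; have bn := g_conn rg Dn DC; split=> //.
  have [|b1] := ltnP 1 #|boundary e C D|; first by left.
  have [|tD] := boolP (adj_sets e D T); first by right.
  have [v vb] := set0Pn _ bn; case: (nd D v); split=> //.
    by move: vb; rewrite in_boundary inE => /and3P[-> ->].
  by apply/subsetP => w wb; rewrite inE; apply: contraTT b1 => wv; rewrite -ltnNge;
    apply/card_gt1P; exists w, v.
have A := contract e_sym e_irr P (g_z rg) CT ne sep.
apply: path_progression_sub (subxx _) (leq_core k f0) _.
apply: (uniform_linked_join f0 _ _ (g_HC rg) fl); first by rewrite leq_max.
  by rewrite (disjointFr (g_HC rg) (g_x rg)).
apply: (progression_sub _ (leqnn _) (A _)) => [a []//|u uC].
have uC' : u \in C :\ z by move: uC; rewrite inE => /andP[].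
exact: core_loss f0 (g_deg rg uC) (nbrs_region rg uC') (loss u uC) (separation_deg sep uC').
Qed.

(** D leaves C only through v and does not see T, so [g_cut] directs its further connections to T2.
    Contracting T2 therefore gives a separated graph with target v, and one path outside D continues
    from v to z. *)
Lemma dangling_paths k Z S x H C z T T2 f D v :
  region k Z e S x H C z -> dangling e C T z D v -> 0 < f -> H \subset x |: (T :|: T2) ->
  T2 \subset H ->
  progression (uniform_len e H x T2) f ->
  (forall u, u \in D :\: Z -> #|nbrs e H u| <= f.-1 + adj_to e T2 u) ->
  paths_upto #|C|.+1 (maxn 1 (k.+1 - f)) Z -> (exists u, u \in D :\: Z) ->
  path_progression e k (H :|: C) x z.
Proof.
move=> rg [Dn DC]; rewrite inE => /andP[vD vC] tD bv f0 HT TH fl loss P ne.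
have DC' : D \subset C by apply: subset_trans DC (subD1set _ _).
have eD : (v |: D) :\ v = D by rewrite setU1K.
have vDC : v |: D \subset C by rewrite subUset sub1set vC.
have HvD : [disjoint H & v |: D] by apply: disjointWr vDC (g_HC rg).
have CT : [disjoint v |: D & T2] by rewrite disjoint_sym; apply: disjointWl TH HvD.
have inb D2 w : D2 \subset D -> w \in boundary e C D2 -> w \in boundary e (v |: D) D2.
  move=> D2D /boundaryP[u [uD euw wC wD2]]; apply/boundaryP; exists u; split=> //.
  rewrite !inE; have [//|wD] := boolP (w \in D); first by rewrite orbT.
  have /(subsetP bv) : w \in boundary e C D by apply/boundaryP; exists u; split=> //; apply:
    (subsetP D2D).
  by rewrite inE => ->.
have sep : separation e (v |: D) T2 v.
  move=> D2 D2n; rewrite eD => D2D.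
  have D2C : D2 \subset C :\ z by apply: subset_trans D2D DC.
  split.
    have [w wb] := set0Pn _ (g_conn rg D2n D2C).
    by apply/set0Pn; exists w; apply: inb.
  (* There are two boundary vertices other than x; with neither T nor T2 seen, both lie in C and
     hence in v |: D. *)
  have [|t2] := boolP (adj_sets e D2 T2); [by right|left].
  apply: leq_trans (g_cut rg D2n D2C) _; apply: subset_leq_card.
  apply/subsetP => w; rewrite in_setD1 => /andP[wx wb].
  have /boundaryP[u [uD euw wS wD2]] := wb; have uC := subsetP D2C u uD.
  have : w \in H :|: C by apply: (subsetP (g_closed rg uC)); rewrite in_nbrs wS.
  rewrite in_setU => /orP[/(subsetP HT)|wC].
    rewrite !inE (negbTE wx) /= => /orP[wT|wT].
      by case/negP: tD; apply/adj_setsP; exists u, w; rewrite wT (subsetP D2D) // e_sym.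
    by case/negP: t2; apply/adj_setsP; exists u, w; rewrite wT uD e_sym.
  by apply: inb => //; apply: boundary_region wb wC; eauto.
have sz : #|v |: D| <= #|C| by apply: subset_leq_card.
have ne' : exists u, u \in (v |: D) :\ v :\: Z by rewrite eD.
have A := contract e_sym e_irr (paths_upto_le (sz : _.+1 <= _.+1) P) (setU11 _ _) CT ne' sep.
have [p /spath_avoid tail] := connected_tail (g_conn rg) vC DC vD bv.
have xC : x \notin C by rewrite (disjointFr (g_HC rg) (g_x rg)).
have A' : path_progression e k (H :|: (v |: D)) x v.
  have kf := leq_core k f0.
  suff A' : path_progression e (f + maxn 1 (k.+1 - f)).-1 (H :|: (v |: D)) x v.
    exact: path_progression_sub (subxx _) kf A'.
  apply: (uniform_linked_join f0 _ _ HvD fl); first by rewrite leq_max.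
    by apply: contraNN xC; apply: (subsetP vDC).
  apply: (progression_sub _ (leqnn _) (A _)) => [a []//|u]; rewrite eD => uD.
  have uD' : u \in D by move: uD; rewrite inE => /andP[].
  have uC : u \in C :\ z by apply: (subsetP DC).
  have uC' : u \in C :\ z :\: Z by move: uD; rewrite in_setD => /andP[uZ _]; rewrite in_setD uZ
    uC.
  have uD2 : u \in (v |: D) :\ v by rewrite eD.
  have sub : #|nbrs e C u| <= #|nbrs e (v |: D) u|.
    apply: subset_leq_card; apply/subsetP => w; rewrite !in_nbrs => /andP[wC euw].
    rewrite euw andbT !inE; have [//|wD] := boolP (w \in D); first by rewrite orbT.
    have /(subsetP bv) : w \in boundary e C D by apply/boundaryP; exists u.
    by rewrite inE => ->.
  apply: core_loss f0 (g_deg rg uC') _ (loss u uD) (separation_deg sep uD2).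
  by apply: leq_trans (nbrs_region rg uC) _; rewrite leq_add2l.
have eu : (H :|: (v |: D)) :|: ((C :\: D) :\ v) = H :|: C.
  apply/setP => w; rewrite !inE; have := subsetP vDC w; rewrite !inE.
  by case: (w \in H); case: (w == v); case: (w \in D); case: (w \in C) => //= h; have := h isT.
(* Appending one tail path keeps the number of lengths, k + 1 - 1. *)
rewrite -eu; have -> : k = (k + 1).-1 by rewrite addn1.
have [->|k0] := posnP k.
  by exists 0, 1; split; [left|].
apply: (path_progression_join _ _ _ _ A') (path_progression1 tail) => //.
  by rewrite !inE (negbTE xC) !andbF.
rewrite disjoints_subset; apply/subsetP => w; rewrite !inE.
case/or3P=> [wH|->//|->]; last by rewrite andbF.
by rewrite (disjointFr (g_HC rg) wH) !andbF.
Qed.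
End Core.

(** The whole interior is excluded: its boundary lies in {x, y}, so omitting one root leaves at most
    one vertex. *)
Definition nocut (V : finType) (e : rel V) (S : {set V}) x y a : Prop :=
  forall D, D != set0 -> D \proper S :\: [set x; y] -> 1 < #|boundary e S D :\ a|.

Lemma rooted_sym (V : finType) k Z (e : rel V) S x y :
  rooted k Z e S x y -> rooted k Z e S y x.
Proof.
case=> es ei xS yS xy nxy ne b d; split; rewrite 1?[[set y; x]]setUC //.
  by rewrite eq_sym.
by rewrite es.
Qed.

Lemma nocut_sym (V : finType) (e : rel V) S x y a : nocut e S x y a -> nocut e S y x a.
Proof. by rewrite /nocut [[set y; x]]setUC. Qed.

(** * Cuts consisting of a root and one more vertex *)

Section Cuts.
Variables (V : finType) (e : rel V).
Implicit Types (A B C D E H S T X Y Z : {set V}) (u v w x y z : V) (p q : seq V).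

Lemma adj_to1 x u : adj_to e [set x] u = e x u.
Proof.
apply/adj_toP/idP => [[t /set1P->//]|exu]; by exists x; rewrite ?inE.
Qed.

Lemma linked_len1 C x z a : linked_len e C [set x] z a -> exists2 p, spath e C x p z & size p = a.
Proof. by case=> t [p [/set1P -> pp sp]]; exists p. Qed.

Lemma nbrs_le S C u t :
  symmetric e -> (forall w, w \in S -> e u w -> w != t -> w \in C) ->
  #|nbrs e S u| <= #|nbrs e C u| + adj_to e [set t] u.
Proof.
move=> es H; rewrite adj_to1 (cardsD1 t) addnC leq_add //.
  apply: subset_leq_card; apply/subsetP => w; rewrite in_setD1 !in_nbrs.
  by case/andP=> wt /andP[wS euw]; rewrite euw (H w).
by rewrite in_nbrs es; case: (t \in S); case: (e t u).
Qed.

(** If t is among the boundary vertices, D sees the contracted vertex and another one remains in C;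
    otherwise at least two remain in C. *)
Lemma sep_of_cut S C D A t :
  symmetric e -> 1 < #|A| -> A \subset boundary e S D ->
  (forall w, w \in A -> w != t -> w \in C) ->
  boundary e C D != set0 /\ (1 < #|boundary e C D| \/ adj_sets e D [set t]).
Proof.
move=> es A1 Ab H.
have inb w : w \in A -> w != t -> w \in boundary e C D.
  move=> wA wt; have /boundaryP[u [uD euw wS wD]] := subsetP Ab w wA.
  by apply/boundaryP; exists u; rewrite (H w).
split.
  have : 0 < #|A :\ t| by move: A1; rewrite (cardsD1 t A); clear; case: (t \in A); lia.
  by case/card_gt0P=> w; rewrite in_setD1 => /andP[wt wA]; apply/set0Pn; exists w; apply: inb.
have [tA|tA] := boolP (t \in A).
  right; have /boundaryP[u [uD eut _ _]] := subsetP Ab t tA.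
  by apply/adj_setsP; exists u, t; rewrite inE eqxx uD es.
left; apply: leq_trans A1 (subset_leq_card _); apply/subsetP => w wA.
by apply: (inb w wA); apply: contraNneq tA => <-.
Qed.

(** Contracting a single vertex identifies nothing; it only drops a possible edge from x to z. *)
Lemma contract1 n k Z C x z :
  symmetric e -> irreflexive e -> paths_upto n k Z -> #|C| < n -> z \in C -> x \notin C ->
  (exists u, u \in C :\ z :\: Z) -> separation e C [set x] z ->
  (forall u, u \in C :\ z :\: Z -> k < #|nbrs e C u| + adj_to e [set x] u) ->
  path_progression e k C x z.
Proof.
move=> es ei P Cn zC xC ne sep deg.
have d : [disjoint C & [set x]] by rewrite disjoint_sym disjoints1.
apply: progression_sub (leqnn k) (contract es ei (paths_upto_le Cn P) zC d ne sep deg) => a [_].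
exact: linked_len1.
Qed.

Variables (S : {set V}) (x y : V) (k : nat) (Z : {set V}).
Hypothesis R : rooted k Z e S x y.
Let I := S :\: [set x; y].
Let es := r_sym R.
Let ei := r_irr R.

Lemma cardI : #|S| = #|I|.+2.
Proof.
rewrite (cardsD1 x) (r_x R) (cardsD1 y) !inE (r_y R) andbT eq_sym (r_xy R).
by congr _.+2; apply: eq_card => w; rewrite /I !inE negb_or andbA [(w != y) && _]andbC.
Qed.

Lemma inI w : (w \in I) = [&& w != x, w != y & w \in S].
Proof. by rewrite /I !inE negb_or andbA. Qed.

(** Otherwise D and the component of v outside D and x would together have no boundary vertex but x,
    against [r_bd]. *)
Lemma rooted_tail D v : D \subset I -> v \in S :\: D -> v != x ->
  boundary e S D \subset [set x; v] -> exists p, spath e (S :\: D :\ x) v p y.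
Proof.
move=> DI; rewrite inE => /andP[vD vS] vx bD.
have vX : v \in S :\: D :\ x by rewrite !inE vx vD.
have [|yR] := boolP (y \in reach e (S :\: D :\ x) v); first exact: reach_spath.
have RX := reach_sub e vX; set Y := reach _ _ _ in yR RX *.
have : 1 < #|boundary e S (D :|: Y)|.
  apply: (r_bd R); first by apply/set0Pn; exists v; rewrite inE reach_refl orbT.
  rewrite subUset DI; apply/subsetP => w wY; have := subsetP RX w wY.
  by rewrite !inE negb_or => /and3P[-> _ ->]; rewrite andbT /=; apply: contraNneq yR => <-.
rewrite ltnNge => /negP[]; rewrite -(cards1 x); apply: subset_leq_card.
apply/subsetP => w /boundaryP[u [uU euw wS]]; rewrite in_setU negb_or => /andP[wD wY].
rewrite inE; have [//|wx] := eqVneq w x.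
have wX : w \in S :\: D :\ x by rewrite !inE wx wD.
move: uU; rewrite in_setU => /orP[uD|uY]; last by rewrite (reach_step vX uY wX euw) in wY.
have : w \in boundary e S D by apply/boundaryP; exists u.
move=> /(subsetP bD); rewrite !inE (negbTE wx) => /eqP wv.
by rewrite wv /Y reach_refl in wY.
Qed.

(** D together with its second attachment vertex v is a smaller graph with roots x and v and the
    same degrees inside D. Induction gives all k lengths there, and [rooted_tail] leads from v to
    y. *)
Lemma two_cut_paths n D : paths_upto n k Z -> #|S| <= n.+1 -> 0 < k ->
  D != set0 -> D \proper I -> (exists u, u \in D :\: Z) -> #|boundary e S D :\ x| <= 1 ->
  path_progression e k S x y.
Proof.
move=> P Sn k0 Dn Dp ne b1; have DI := proper_sub Dp.
have b2 := r_bd R Dn DI.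
have : 0 < #|boundary e S D :\ x| by move: b2; rewrite (cardsD1 x (boundary e S D)); clear; case:
  (x \in boundary e S D); lia.
case/card_gt0P=> v; rewrite in_setD1 => /andP[vx vb].
have bD : boundary e S D \subset [set x; v].
  apply/subsetP => w wb; rewrite !inE; apply: contraTT b1; rewrite negb_or -ltnNge => /andP[wx
    wv].
  by apply/card_gt1P; exists w, v; rewrite !in_setD1 ?wx ?vx.
have /boundaryP[_ [_ _ vS vD]] := vb.
have vX : v \in S :\: D by rewrite inE vD.
have [p /spath_avoid tail] := rooted_tail DI vX vx bD.
have xD : x \notin D by apply/negP => /(subsetP DI); rewrite inI eqxx.
have eD : (v |: D) :\ v = D by rewrite setU1K.
have A : path_progression e k (v |: D) x v.
  apply: (contract1 es ei P) => //.
  - have := proper_card Dp; have := cardI; rewrite cardsU1 vD; move: Sn; rewrite -/I; clear; lia.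
  - exact: setU11.
  - by rewrite !inE negb_or eq_sym vx.
  - by rewrite eD.
  - move=> D2 D2n; rewrite eD => D2D.
    apply: (@sep_of_cut S _ _ (boundary e S D2)) => //.
      exact: (r_bd R D2n (subset_trans D2D DI)).
    move=> w /boundaryP[u [uD euw wS _]] wx; rewrite !inE.
    have [//|wD] := boolP (w \in D); first by rewrite orbT.
    have : w \in boundary e S D by apply/boundaryP; exists u; rewrite (subsetP D2D).
    by move=> /(subsetP bD); rewrite !inE (negbTE wx) => /= ->.
  rewrite eD => u; rewrite inE => /andP[uZ uD].
  apply: leq_trans (nbrs_le (S := S) es _).
    by apply: (r_deg R); rewrite inE uZ (subsetP DI).
  move=> w wS euw wx; rewrite !inE.
  have [//|wD] := boolP (w \in D); first by rewrite orbT.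
  have : w \in boundary e S D by apply/boundaryP; exists u.
  by move=> /(subsetP bD); rewrite !inE (negbTE wx) => /= ->.
have -> : k = (k + 1).-1 by rewrite addn1.
apply: path_progression_sub (_ : (v |: D) :|: (S :\: D :\ x :\ v) \subset S) (leqnn _) _.
  rewrite !subUset sub1set vS (subset_trans DI (subsetDl _ _)) /=.
  by apply/subsetP => w; rewrite !inE => /and4P[].
apply: (path_progression_join _ _ _ _ A (path_progression1 tail)) => //.
  by rewrite !inE eqxx !andbF.
rewrite disjoints_subset; apply/subsetP => w; rewrite !inE.
by case/orP=> [->//|->]; rewrite !andbF.
Qed.

(** The inner vertex h outside X :\ w makes each D inside the component a proper subset of the
    interior, as [nocut] requires. *)
Lemma region_reach H X w :
  nocut e S x y x -> x \in H -> X \subset S -> [disjoint H & X] -> w \in X ->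
  X :\ w \subset I -> (exists2 h, h \in I & h \notin X :\ w) ->
  (forall u, u \in X :\ w -> nbrs e S u \subset H :|: X) ->
  region k Z e S x H (reach e X w) w.
Proof.
move=> nc xH XS HX wX XI [h hI hX] cl.
have RX := reach_sub e wX; have RX' : reach e X w :\ w \subset X :\ w by apply: setSD.
split=> //.
- exact: disjointWr RX HX.
- exact: reach_refl.
- exact: reach_conn.
- move=> u uC; have uX := subsetP RX' u uC; apply/subsetP => v vS.
  have := subsetP (cl u uX) v vS; rewrite !in_setU => /orP[->//|vX].
  move: uC vS; rewrite in_setD1 in_nbrs => /andP[_ uR] /andP[_ euv].
  by rewrite (reach_step wX uR vX euv) orbT.
- move=> D Dn DC; apply: nc => //; apply/properP; split.
    exact: subset_trans DC (subset_trans RX' XI).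
  by exists h => //; apply: contraNN hX => /(subsetP DC) /(subsetP RX').
- move=> u; rewrite in_setD => /andP[uZ uC]; apply: (r_deg R).
  by rewrite in_setD uZ; apply: (subsetP XI); apply: (subsetP RX').
Qed.

Lemma region_root H :
  nocut e S x y x -> x \in H -> H \subset S :\ y -> (exists2 h, h \in H & h != x) ->
  region k Z e S x H (reach e (S :\: H) y) y.
Proof.
move=> nc xH HS [h hH hx].
have hS := subsetP HS h hH; move: (hS); rewrite !inE => /andP[hy hS'].
have yH : y \notin H by apply/negP => /(subsetP HS); rewrite !inE eqxx.
apply: region_reach => //.
- exact: subsetDl.
- by rewrite disjoints_subset; apply/subsetP => w; rewrite !inE => ->.
- by rewrite inE yH (r_y R).
- apply/subsetP => w; rewrite inI !inE => /and3P[-> wH ->]; rewrite !andbT.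
  by apply: contraNneq wH => ->.
- by exists h; rewrite ?inI ?hx ?hy // !inE hH !andbF.
- by move=> u _; apply/subsetP => w; rewrite !inE => /andP[-> _]; rewrite andbT orbN.
Qed.

(** If y had only one neighbour p, then x and p would cut the remaining interior off from y. *)
Lemma card_nbrs_root : nocut e S x y x -> 1 < #|I| -> 1 < #|nbrs e S y|.
Proof.
move=> nc I1; rewrite ltnNge; apply/negP => h1.
have [p hp] : exists p : V, nbrs e S y \subset [set p].
  have [/eqP|/card_gt0P[p py]] := posnP #|nbrs e S y|.
    by rewrite cards_eq0 => /eqP ->; exists y; apply: sub0set.
  exists p; apply/subsetP => w wy; rewrite inE; apply: contraTT h1 => wp; rewrite -ltnNge.
  by apply/card_gt1P; exists w, p.
have sb : boundary e S (I :\ p) \subset [set x; p].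
  apply/subsetP => w /boundaryP[u [uI euw wS wI]]; rewrite !inE.
  move: wI; rewrite in_setD1 inI wS andbT; have [//|wp] := eqVneq w p; first by rewrite orbT.
  have [//|wx /=] := eqVneq w x; rewrite negbK => /eqP wy.
  have uS : u \in nbrs e S y.
    by move: uI; rewrite in_setD1 inI in_nbrs -wy es euw => /and4P[_ _ _ ->].
  by have := subsetP hp u uS; move: uI; rewrite !inE => /andP[/negbTE ->].
have Dn : I :\ p != set0.
  by rewrite -card_gt0; move: I1; rewrite (cardsD1 p); clear; case: (p \in I); lia.
(* For an inner p the set is proper and [nocut] applies; otherwise it is the whole interior and
   [r_bd] is used. *)
have [pI|pI] := boolP (p \in I).
  have : 1 < #|boundary e S (I :\ p) :\ x| by apply: nc => //; exact: properD1.
  rewrite ltnNge => /negP[]; rewrite -(cards1 p); apply: subset_leq_card.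
  by apply/subsetP => w; rewrite in_setD1 => /andP[wx /(subsetP sb)]; rewrite !inE (negbTE wx).
have DI : I :\ p \subset I by apply: subD1set.
have := r_bd R Dn DI; rewrite ltnNge => /negP[]; rewrite -(cards1 x); apply: subset_leq_card.
apply/subsetP => w wb; have := subsetP sb w wb; rewrite !inE => /orP[//|/eqP wp].
have /boundaryP[u [uI euw wS wI]] := wb.
move: pI; rewrite inI -wp wS andbT negb_and !negbK => /orP[//|/eqP wy].
have uS : u \in nbrs e S y.
  by move: uI; rewrite in_setD1 inI in_nbrs -wy es euw => /and4P[_ _ _ ->].
by have := subsetP hp u uS; move: uI; rewrite !inE => /andP[/negbTE ->].
Qed.

End Cuts.

(* Both a-y paths inside D (losing only x) and x-a paths outside D (losing only
   y) come in families of k - 1, and 2 (k - 1) - 1 >= k. *)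
Lemma three_cut_paths (V : finType) (e : rel V) n k (S : {set V}) x y (D : {set V}) a :
  rooted k set0 e S x y -> paths_upto n k.-1 (set0 : {set V}) -> #|S| <= n.+1 -> 2 < k ->
  nocut e S x y x -> nocut e S x y y -> D != set0 -> D \subset S :\: [set x; y] ->
  a \in S :\: [set x; y] :\: D -> boundary e S D \subset [set x; a; y] ->
  (exists2 b, b \in S :\: [set x; y] :\: D & b != a) -> path_progression e k S x y.
Proof.
move=> R P Sn k2 ncx ncy Dn DI aI bD [b bI ba].
have es := r_sym R; have ei := r_irr R.
have aD : a \notin D by move: aI; rewrite in_setD => /andP[].
move: (aI); rewrite in_setD => /andP[_]; rewrite (inI S x y) => /and3P[ax ay aS].
have xD : x \notin D by apply/negP => /(subsetP DI); rewrite (inI S x y) eqxx.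
have yD : y \notin D by apply/negP => /(subsetP DI); rewrite (inI S x y) eqxx andbF.
have prop (D2 : {set V}) w : D2 \subset S :\: [set x; y] -> w \in S :\: [set x; y] -> w \notin D2
  ->
    D2 \proper S :\: [set x; y].
  by move=> h1 h2 h3; apply/properP; split; [|exists w].
have aI' : a \in S :\: [set x; y] by rewrite (inI S x y) ax ay.
have out (u w : V) : u \in D -> e u w -> w \in S -> w != x -> w != a -> w \in y |: D.
  move=> uD euw wS wx wa; rewrite !inE; have [//|wD] := boolP (w \in D); first by rewrite orbT.
  have : w \in boundary e S D by apply/boundaryP; exists u.
  by move=> /(subsetP bD); rewrite !inE (negbTE wx) (negbTE wa) => /= ->.
have yS := r_y R; have xS := r_x R; have xy := r_xy R.
have cS := cardI R.
have eD : (y |: D) :\ y = D by rewrite setU1K.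
have A1 : path_progression e k.-1 (y |: D) a y.
  apply: (contract1 es ei P) => //.
  - by rewrite cardsU1 yD; have := proper_card (prop D a DI aI' aD); move: Sn cS; clear; lia.
  - exact: setU11.
  - by rewrite !inE negb_or ay.
  - by rewrite eD setD0; apply/set0Pn.
  - move=> D2 D2n; rewrite eD => D2D.
    have D2I := subset_trans D2D DI.
    apply: (@sep_of_cut _ e S _ _ (boundary e S D2 :\ x)) => //.
    - apply: ncx => //; apply: (prop _ a) => //; by apply: contraNN aD; apply: (subsetP D2D).
    - exact: subD1set.
    - move=> w; rewrite in_setD1 => /andP[wx /boundaryP[u [uD euw wS _]]] wa.
      by apply: (out u) => //; apply: (subsetP D2D).
  rewrite eD setD0 => u uD.
  have : k < #|nbrs e S u| by apply: (r_deg R); rewrite setD0; apply: (subsetP DI).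
  have := @nbrs_le _ e (S :\ x) (y |: D) u a es.
  have : #|nbrs e S u| <= #|nbrs e (S :\ x) u|.+1.
    rewrite (cardsD1 x) -add1n leq_add ?leq_b1 //; apply: subset_leq_card.
    by apply/subsetP => w; rewrite !inE => /and3P[-> -> ->].
  move=> h1 h2 h3; suff h : forall w, w \in S :\ x -> e u w -> w != a -> w \in y |: D.
    by have := h2 h; move: h1 h3 k2; clear; lia.
  by move=> w; rewrite in_setD1 => /andP[wx wS] euw wa; apply: (out u).
have A2 : path_progression e k.-1 (S :\: [set x; y] :\: D) x a.
  apply: (contract1 es ei P) => //.
  - by have := subset_leq_card (subsetDl (S :\: [set x; y]) D); move: Sn cS; clear; lia.
  - by rewrite !inE eqxx andbF.
  - by exists b; rewrite setD0 in_setD1 ba.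
  - move=> D2 D2n D2C.
    have D2I : D2 \subset S :\: [set x; y].
      by apply: subset_trans D2C (subset_trans (subD1set _ _) (subsetDl _ _)).
    have aD2 : a \notin D2 by apply/negP => /(subsetP D2C); rewrite !inE eqxx.
    apply: (@sep_of_cut _ e S _ _ (boundary e S D2 :\ y)) => //.
    - by apply: ncy => //; apply: (prop _ a).
    - exact: subD1set.
    - move=> w; rewrite in_setD1 => /andP[wy /boundaryP[u [uD euw wS _]]] wx.
      rewrite in_setD (inI S x y) wx wy wS /= andbT; apply/negP => wD.
      have := subsetP D2C u uD; rewrite in_setD1 in_setD (inI S x y) => /and5P[ua uD' ux uy uS].
      have : u \in boundary e S D by apply/boundaryP; exists w; rewrite es.
      by move=> /(subsetP bD); rewrite !inE (negbTE ua) (negbTE ux) (negbTE uy).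
  rewrite setD0 => u; rewrite in_setD1 => /andP[ua uC].
  move: (uC); rewrite in_setD => /andP[uD uI].
  have : k < #|nbrs e S u| by apply: (r_deg R); rewrite setD0.
  have : #|nbrs e S u| <= #|nbrs e (S :\ y) u|.+1.
    rewrite (cardsD1 y) -add1n leq_add ?leq_b1 //; apply: subset_leq_card.
    by apply/subsetP => w; rewrite !inE => /and3P[-> -> ->].
  have := @nbrs_le _ e (S :\ y) (S :\: [set x; y] :\: D) u x es.
  move=> h2 h1 h3; suff h : forall w, w \in S :\ y -> e u w -> w != x -> w \in S :\: [set x; y]
    :\: D.
    by have := h2 h; move: h1 h3 k2; clear; lia.
  move=> w; rewrite in_setD1 => /andP[wy wS] euw wx.
  rewrite in_setD (inI S x y) wx wy wS /= andbT; apply/negP => wD.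
  move: (uI); rewrite (inI S x y) => /and3P[ux uy uS].
  have : u \in boundary e S D by apply/boundaryP; exists w; rewrite es.
  by move=> /(subsetP bD); rewrite !inE (negbTE ua) (negbTE ux) (negbTE uy).
have A : path_progression e (k.-1 + k.-1).-1 ((S :\: [set x; y] :\: D) :|: (y |: D)) x y.
  apply: (path_progression_join _ _ _ _ A2 A1); try by move: k2; clear; lia.
    by rewrite !inE negb_or xy.
  rewrite disjoints_subset; apply/subsetP => w; rewrite !inE !negb_or.
  by case/andP=> -> /andP[/andP[_ ->]].
apply: path_progression_sub A; last by move: k2; clear; lia.
rewrite !subUset sub1set yS (subset_trans DI (subsetDl _ _)).
by rewrite andbT (subset_trans (subsetDl _ D) (subsetDl S _)).
Qed.

(** * Two admissible paths with one exceptional vertex *)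

Section RootLemmas.
Variables (V : finType) (e : rel V).
Implicit Types (A B C D E H S T X Y Z : {set V}) (u v w x y z : V) (p q : seq V).

(** The core consists of x and T, so a dangling D would have its whole boundary in {x, v}, against
    [g_cut]. *)
Lemma not_dangling k Z S x H C z T D v : symmetric e ->
  region k Z e S x H C z -> H \subset x |: T -> ~ dangling e C T z D v.
Proof.
move=> es rg HT [Dn DC vX tD bv].
have := g_cut rg Dn DC; rewrite ltnNge => /negP[]; rewrite -(cards1 v).
apply: subset_leq_card; apply/subsetP => w; rewrite in_setD1 => /andP[wx wb].
have /boundaryP[u [uD euw wS wD]] := wb.
have : w \in H :|: C.
  by apply: (subsetP (g_closed rg (subsetP DC u uD))); rewrite in_nbrs wS.
rewrite in_setU => /orP[/(subsetP HT)|wC].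
  rewrite !inE (negbTE wx) /= => wT; case/negP: tD.
  by apply/adj_setsP; exists u, w; rewrite es.
by apply: (subsetP bv); apply: boundary_region wb wC; eauto.
Qed.

(** If p meets w, its part after w avoids u; otherwise p itself avoids w. *)
Lemma tail_pair X u w p y : u != w -> spath e X u p y ->
  exists s t q, [/\ spath e (X :\ s) t q y, s != t & (s, t) \in [:: (u, w); (w, u)]].
Proof.
move=> uw pp; have [pe pu ps pl] := pp.
have [wp|wp] := boolP (w \in p); last first.
  exists w, u, p; rewrite !inE eqxx orbT eq_sym uw; split=> //; split=> // v vp.
  by rewrite !inE (ps v vp) andbT; apply: contraNneq wp => <-.
exists u, w; case/splitPr: wp pe pu ps pl {pp} => p1 p2 pe pu ps pl.
exists p2; split; rewrite // ?inE ?eqxx //.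
move: pe; rewrite cat_path /= => /and3P[_ _ pe].
move: pu => /= /andP[up]; rewrite cat_uniq => /and3P[_ _ pu].
split=> //; last by move: pl; rewrite last_cat.
move=> v vp; rewrite !inE ps ?mem_cat ?inE ?vp ?orbT // andbT.
by apply: contraNneq up => <-; rewrite mem_cat inE vp !orbT.
Qed.

Section Rooted.
Variables (S : {set V}) (x y : V) (k : nat) (Z : {set V}).
Hypothesis R : rooted k Z e S x y.

Lemma nbrs_root : nbrs e S x \subset S :\: [set x; y].
Proof.
apply/subsetP => w; rewrite in_nbrs (inI S x y) => /andP[wS exw]; rewrite wS andbT.
apply/andP; split; first by apply: contraTneq exw => ->; rewrite (r_irr R).
by apply: contraTneq exw => ->; rewrite (r_nxy R).
Qed.

(** Leaving out y is harmless: its neighbours are w or in H, so the other vertices of the component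
    do not see it. *)
Lemma endgame_region H w :
  nocut e S x y x -> x \in H -> H \subset S :\ y -> w \in S :\: [set x; y] -> w \notin H ->
  nbrs e S y \subset w |: H ->
  region k Z e S x H (reach e (S :\: (y |: H)) w) w.
Proof.
move=> nc xH HS wI wH Ny; have := wI; rewrite (inI S x y) => /and3P[wx wy wS].
have es := r_sym R; apply: (region_reach R) => //.
- exact: subsetDl.
- rewrite disjoints_subset; apply/subsetP => v; rewrite !inE => ->.
  by rewrite orbT.
- by rewrite !inE wS negb_or wy wH.
- apply/subsetP => v; rewrite (inI S x y) !inE !negb_or => /and3P[_ /andP[-> vH] ->].
  by rewrite !andbT; apply: contraNneq vH => ->.
- by exists w => //; rewrite !inE eqxx.
move=> u; rewrite !inE !negb_or => /and3P[uw /andP[uy uH] uS].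
apply/subsetP => v; rewrite in_nbrs => /andP[vS euv]; rewrite !inE vS negb_or.
case: (v \in H) => //=; rewrite !andbT; apply: contraTneq euv => ->.
apply/negP => euy; have : u \in nbrs e S y by rewrite in_nbrs uS es.
by move=> /(subsetP Ny); rewrite !inE (negbTE uw) (negbTE uH).
Qed.

Lemma endgame_join H w : 0 < k -> H \subset S :\ y -> w \in S :\: [set x; y] -> w \notin H ->
  e w y -> path_progression e k (H :|: reach e (S :\: (y |: H)) w) x w -> path_progression e k S
    x y.
Proof.
move=> k0 HS; rewrite (inI S x y) => /and3P[wx wy wS] wH ewy A.
have wX : w \in S :\: (y |: H) by rewrite !inE negb_or wy wH.
have CX := reach_sub e wX.
have -> : k = (k + 1).-1 by rewrite addn1.
have yHC : [disjoint H :|: reach e (S :\: (y |: H)) w & [set y]].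
  rewrite disjoint_sym disjoints1 in_setU negb_or; apply/andP; split.
    by apply/negP => /(subsetP HS); rewrite !inE eqxx.
  by apply/negP => /(subsetP CX); rewrite !inE eqxx.
apply: path_progression_sub (_ : (H :|: reach e (S :\: (y |: H)) w) :|: [set y] \subset S) (leqnn
  _) _.
  rewrite !subUset sub1set (r_y R) (subset_trans CX (subsetDl _ _)) !andbT.
  exact: subset_trans HS (subD1set _ _).
apply: (path_progression_join _ _ _ yHC A) => //.
  by rewrite inE (r_xy R).
by apply: path_progression1 (spath1 (r_irr R) ewy _); rewrite inE.
Qed.
End Rooted.
End RootLemmas.

Section TwoPaths.
Variables (V : finType) (e : rel V) (n : nat).
Hypothesis IH : forall Z : {set V}, #|Z| <= 1 -> paths_upto n 2 Z.
Implicit Types (A B C D E H S T X Y Z : {set V}) (u v w x y z : V) (p q : seq V).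

(* Here z has degree 2 and is adjacent to x: it is deleted, and its other
   neighbour becomes the vertex of uncontrolled degree. *)
Lemma two_paths_low S x y z :
  rooted 2 [set z] e S x y -> #|S| <= n.+1 -> z \in S :\: [set x; y] ->
  (forall D, D \proper S :\: [set x; y] -> (exists u, u \in D :\: [set z]) ->
     1 < #|boundary e S D :\ x| /\ 1 < #|boundary e S D :\ y|) ->
  #|boundary e S [set z] :\ x| <= 1 -> path_progression e 2 S x y.
Proof.
move=> R Sn zI cut b1; have es := r_sym R; have ei := r_irr R.
have zn : [set z] != set0 by apply/set0Pn; exists z; rewrite inE.
have zs : [set z] \subset S :\: [set x; y] by rewrite sub1set.
have b2 := r_bd R zn zs.
have xb : x \in boundary e S [set z].
  by apply: contraTT b2 => xb; move: b1; rewrite -leqNgt (cardsD1 x (boundary _ _ _)) (negbTE xb).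
have : 0 < #|boundary e S [set z] :\ x|.
  by move: b2; rewrite (cardsD1 x (boundary e S [set z])) xb; clear; lia.
case/card_gt0P=> v; rewrite in_setD1 => /andP[vx vb].
have bD u : u \in S -> e z u -> u != x -> u = v.
  move=> uS ezu ux; apply/eqP; apply: contraTT b1 => uv; rewrite -ltnNge.
  apply/card_gt1P; exists u, v; rewrite !in_setD1 ux vx vb uv; split=> //=.
  apply/boundaryP; exists z; rewrite inE eqxx; split=> //.
  by rewrite inE; apply: contraTneq ezu => ->; rewrite ei.
move/boundaryP: vb => [_ [/set1P -> ezv vS]]; rewrite inE => vz.
move/boundaryP: xb => [_ [/set1P -> ezx xS _]].
move: zI; rewrite (inI S x y) => /and3P[zx zy zS].
have S'n : #|S :\ z| <= n by move: Sn; rewrite (cardsD1 z S) zS; clear; lia.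
have eI : S :\ z :\: [set x; y] = S :\: [set x; y] :\ z by rewrite setDDl setUC -setDDl.
have nb u : u \in S -> u != x -> u != v -> nbrs e (S :\ z) u = nbrs e S u.
  move=> uS ux uv; apply/setP => w; rewrite !in_nbrs in_setD1.
  have [->|//] := eqVneq w z; rewrite es zS /=; apply/esym/negP => ezu.
  by rewrite (bD u uS ezu ux) eqxx in uv.
have bdS D : D \subset S :\: [set x; y] -> v \notin D -> boundary e S D \subset boundary e (S :\
  z) D.
  move=> DI vD; apply/subsetP => w /boundaryP[u [uD euw wS wD]]; apply/boundaryP; exists u;
    split=> //.
  rewrite in_setD1 wS andbT; apply: contraNneq vD => wz.
  move: (subsetP DI u uD); rewrite (inI S x y) => /and3P[ux uy uS].
  by rewrite -(bD u uS _ ux) // es -wz.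
suff [Z' Z1 R'] : exists2 Z' : {set V}, #|Z'| <= 1 & rooted 2 Z' e (S :\ z) x y \/
  path_progression e 2 S x y.
  case: R' => // R'; apply: path_progression_sub (subD1set _ _) (leqnn 2) (IH Z1 S'n R').
(* If the other neighbour of z is y, no inner vertex loses degree and the exceptional set becomes
   empty. *)
have [vy|vy] := eqVneq v y.
  exists set0; rewrite ?cards0 //; left; split; rewrite ?eI //.
  - by rewrite in_setD1 xS eq_sym zx.
  - by rewrite in_setD1 (r_y R) eq_sym zy.
  - exact: r_xy R.
  - exact: r_nxy R.
  - by have [u uI] := r_ne R; exists u; rewrite setD0.
  - move=> D Dn DI; have DI' := subset_trans DI (subD1set _ _).
    apply: leq_trans (r_bd R Dn DI') (subset_leq_card (bdS D DI' _)).
    by rewrite vy; apply/negP => /(subsetP DI'); rewrite !inE eqxx orbT.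
  - move=> u; rewrite setD0 in_setD1 (inI S x y) => /and4P[uz ux uy uS].
    by rewrite nb ?vy //; apply: (r_deg R); rewrite !inE uz negb_or ux uy.
have vI : v \in S :\: [set x; y] by rewrite (inI S x y) vx vy.
have vdeg : 2 < #|nbrs e S v| by apply: (r_deg R); move: vI; rewrite !inE vz.
exists [set v]; rewrite ?cards1 //.
(* As v has at least three neighbours, having them all in {x, y, z} means seeing each of these; then
   x v y and x z v y have lengths 2 and 3. *)
have [sub|/subsetPn[u]] := boolP (nbrs e S v \subset [set x; y; z]).
  right.
  have all3 w : w \in [set x; y; z] -> e v w.
    move=> w3; suff /eqP/setP/(_ w) : nbrs e S v == [set x; y; z].
      by rewrite w3 in_nbrs => /andP[].
    rewrite eqEcard sub; apply: leq_trans vdeg.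
    by rewrite -setUA !cardsU1 cards1; case: (_ \notin _); case: (_ \notin _).
  have evx : e v x by apply: all3; rewrite !inE eqxx.
  have evy : e v y by apply: all3; rewrite !inE eqxx orbT.
  exists 2, 1; split; first by left.
  have xy := r_xy R; have yS := r_y R.
  have zv : z != v by rewrite eq_sym.
  case=> [|[|//]] _; [exists [:: v; y]|exists [:: z; v; y]] => //; split=> //=.
  - by rewrite es evx evy.
  - by rewrite !inE negb_or ![x == _]eq_sym vx eq_sym xy vy.
  - by move=> w; rewrite !inE => /orP[/eqP->|/eqP->].
  - by rewrite es ezx ezv evy.
  - by rewrite !inE !negb_or ![x == _]eq_sym zx vx [y == x]eq_sym xy zv zy vy.
  - by move=> w; rewrite !inE => /or3P[/eqP->|/eqP->|/eqP->].
rewrite in_nbrs => /andP[uS evu]; rewrite !inE !negb_or => /andP[/andP[ux uy] uz].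
left; split; rewrite ?eI //.
- by rewrite in_setD1 xS eq_sym zx.
- by rewrite in_setD1 (r_y R) eq_sym zy.
- exact: r_xy R.
- exact: r_nxy R.
- exists u; rewrite !inE negb_or uz ux uy uS !andbT.
  by apply: contraTneq evu => ->; rewrite ei.
- move=> D Dn DI; have DI' := subset_trans DI (subD1set _ _).
  have zD : z \notin D by apply/negP => /(subsetP DI); rewrite !inE eqxx.
  have [vD|vD] := boolP (v \in D); last first.
    exact: leq_trans (r_bd R Dn DI') (subset_leq_card (bdS D DI' vD)).
  rewrite ltnNge; apply/negP => bs.
  have zI : z \in S :\: [set x; y] by rewrite (inI S x y) zx zy.
  have Dz : exists u, u \in D :\: [set z] by exists v; rewrite !inE vz vD.
  have Dp : D \proper S :\: [set x; y] by apply/properP; split=> //; exists z.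
  have bdD w : w \in boundary e S D -> w != z -> w \in boundary e (S :\ z) D.
    by move=> /boundaryP[u' [uD euw wS wD]] wz; apply/boundaryP; exists u'; rewrite in_setD1 wz
      wS.
  have [c1 c2] := cut D Dp Dz.
  (* The neighbours of z are x and v, and v is in D, so adding z to D creates no boundary vertex
     other than x. *)
  have [pr|npr] := boolP (z |: D \proper S :\: [set x; y]).
    have Dz' : exists u, u \in (z |: D) :\: [set z] by exists v; rewrite !inE vz vD orbT.
    have [c3 _] := cut _ pr Dz'.
    move: c3; rewrite ltnNge => /negP[]; apply: leq_trans (subset_leq_card _) bs.
    apply/subsetP => w; rewrite in_setD1 => /andP[wx /boundaryP[u' [uU euw wS]]].
    rewrite in_setU1 negb_or => /andP[wz wD]; move: uU; rewrite in_setU1 => /orP[/eqP uz'|uD].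
      by rewrite uz' in euw; rewrite (bD w wS euw wx) vD in wD.
    by apply: bdD wz; apply/boundaryP; exists u'.
  (* Now D is the interior without z. Its boundary lies in {x, y, z} and keeps two vertices after
     omitting x or y, so both roots belong to it. *)
  have eD : z |: D = S :\: [set x; y].
    apply/eqP; move: npr; rewrite properEneq negb_and negbK => /orP[//|].
    by rewrite subUset sub1set zI DI'.
  have inxy w : w \in boundary e S D -> w \in [set x; y; z].
    move=> /boundaryP[_ [_ _ wS wD]]; rewrite !inE.
    have : w \notin z |: D -> (w == x) || (w == y).
      by rewrite eD !inE wS andbT negbK.
    by rewrite in_setU1 negb_or wD andbT; case: (w == z) => /=; [rewrite orbT|rewrite orbF;
      apply].
  have xD : x \in boundary e S D.
    apply: contraTT c2 => xD; rewrite -leqNgt -(cards1 z); apply: subset_leq_card.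
    apply/subsetP => w; rewrite in_setD1 => /andP[wy wb]; have := inxy w wb; rewrite !inE (negbTE
      wy).
    by case: eqP => // wx; rewrite -wx wb in xD.
  have yD : y \in boundary e S D.
    apply: contraTT c1 => yD; rewrite -leqNgt -(cards1 z); apply: subset_leq_card.
    apply/subsetP => w; rewrite in_setD1 => /andP[wx wb]; have := inxy w wb; rewrite !inE (negbTE
      wx).
    by case: eqP => // wy; rewrite -wy wb in yD.
  move: bs; rewrite leqNgt => /negP[]; apply/card_gt1P; exists x, y.
  by split; [apply: bdD xD _|apply: bdD yD _|exact: r_xy R]; rewrite eq_sym.
- move=> w; rewrite !in_setD !inE negb_or => /and3P[wv wz /andP[/andP[wx wy] wS]].
  by rewrite nb //; apply: (r_deg R); rewrite !inE negb_or wz wx wy wS.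
Qed.
End TwoPaths.

Section Short.
Variables (V : finType) (e : rel V).
Implicit Types (A B C D E H S T X Y Z : {set V}) (u v w x y z : V) (p q : seq V).
Variables (S : {set V}) (x y : V) (k : nat) (Z : {set V}).
Hypothesis R : rooted k Z e S x y.

(** A path to y from one of u, w avoiding the other can be entered from x directly or through the
    other, which changes the length by 1. *)
Lemma two_paths_triangle u w :
  u \in S -> w \in S -> e x u -> e x w -> e u w -> path_progression e 2 S x y.
Proof.
move=> uS wS exu exw euw; have es := r_sym R; have ei := r_irr R.
have ux : u != x by apply: contraTneq exu => ->; rewrite ei.
have uw : u != w by apply: contraTneq euw => ->; rewrite ei.
have bd0 : boundary e S set0 = set0.
  by apply/setP => v; rewrite in_set0; apply/negP => /boundaryP[a []]; rewrite in_set0.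
have [p pp] : exists p, spath e (S :\ x) u p y.
  rewrite -[S]setD0; apply: (rooted_tail R) => //; rewrite ?sub0set ?bd0 ?setD0 //.
  exact: sub0set.
have [s [t [q [[qe qu qs ql] st stuw]]]] := tail_pair uw pp.
have [exs ext est sS tS] : [/\ e x s, e x t, e s t, s \in S & t \in S].
  by move: stuw; rewrite !inE => /orP[] /eqP[-> ->]; split; rewrite // es.
have xt : x != t by apply: contraTneq ext => <-; rewrite ei.
have xs : x != s by apply: contraTneq exs => <-; rewrite ei.
have xq : x \notin q by apply/negP => /qs; rewrite !inE eqxx /= andbF.
have sq : s \notin q by apply/negP => /qs; rewrite !inE eqxx.
have qS v : v \in q -> v \in S by move=> /qs; rewrite !inE => /and3P[].
exists (size q).+1, 1; split; first by left.
case=> [|[|//]] _; [exists (t :: q)|exists (s :: t :: q)]; rewrite /= ?addn0 ?addn1 //; split=>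
  //=.
- by rewrite ext qe.
- by move: qu; rewrite /= inE negb_or xt xq.
- by move=> v; rewrite inE => /orP[/eqP->//|/qS].
- by rewrite exs est qe.
- by move: qu; rewrite /= !inE !negb_or xt xq xs st sq.
- by move=> v; rewrite !inE => /or3P[/eqP->//|/eqP->//|/qS].
Qed.

(** The same around a 4-cycle: entering directly or through the opposite side changes the length by
    2. The path to y avoiding x and a exists because these two are no cut. *)
Lemma two_paths_C4 b1 b2 a : nocut e S x y x ->
  [/\ b1 \in S, b2 \in S, a \in S & [/\ e x b1, e x b2, e a b1 & e a b2]] ->
  b1 != b2 -> a != x -> a != y -> path_progression e 2 S x y.
Proof.
move=> nc [b1S b2S aS [xb1 xb2 ab1 ab2]] b12 ax ay; have es := r_sym R; have ei := r_irr R.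
have b1x : b1 != x by apply: contraTneq xb1 => ->; rewrite ei.
have b1a : b1 != a by apply: contraTneq ab1 => ->; rewrite ei.
have b1X : b1 \in S :\ x :\ a by rewrite !inE b1a b1x b1S.
have RX := reach_sub e b1X.
have [p pp] : exists p, spath e (S :\ x :\ a) b1 p y.
  have [|yR] := boolP (y \in reach e (S :\ x :\ a) b1); first exact: reach_spath.
  have sub : boundary e S (reach e (S :\ x :\ a) b1) \subset [set x; a].
    apply/subsetP => w /boundaryP[u [uR euw wS wR]]; rewrite !inE; apply: contraNT wR.
    by rewrite negb_or => /andP[wx wa]; apply: (reach_step b1X uR _ euw); rewrite !inE wx wa.
  have Rn : reach e (S :\ x :\ a) b1 != set0.
    by apply/set0Pn; exists b1; apply: reach_refl.
  have := nc _ Rn; rewrite ltnNge => nc'; suff Rp : reach e (S :\ x :\ a) b1 \proper S :\: [set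
    x; y].
    case/negP: (nc' Rp); rewrite -(cards1 a); apply: subset_leq_card.
    by apply/subsetP => w; rewrite in_setD1 => /andP[wx /(subsetP sub)]; rewrite !inE (negbTE wx).
  apply/properP; split.
    apply/subsetP => w wR; have := subsetP RX w wR; rewrite (inI S x y) !inE => /and3P[_ -> ->].
    by rewrite andbT; apply: contraNneq yR => <-.
  by exists a; [rewrite (inI S x y) ax ay|apply/negP => /(subsetP RX); rewrite !inE eqxx].
have [s [t [q [[qe qu qs ql] st stuw]]]] := tail_pair b12 pp.
have [exs ext eas eat [sS tS]] : [/\ e x s, e x t, e a s, e a t & s \in S /\ t \in S].
  by move: stuw; rewrite !inE => /orP[] /eqP[-> ->]; split.
have xt : x != t by apply: contraTneq ext => <-; rewrite ei.
have xs : x != s by apply: contraTneq exs => <-; rewrite ei.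
have at_ : a != t by apply: contraTneq eat => <-; rewrite ei.
have sa : s != a by apply: contraTneq eas => ->; rewrite ei.
have xq : x \notin q by apply/negP => /qs; rewrite !inE eqxx /= !andbF.
have sq : s \notin q by apply/negP => /qs; rewrite !inE eqxx.
have aq : a \notin q by apply/negP => /qs; rewrite !inE eqxx /= andbF.
have qS v : v \in q -> v \in S by move=> /qs; rewrite !inE => /and4P[].
exists (size q).+1, 2; split; first by right.
case=> [|[|//]] _; [exists (t :: q)|exists (s :: a :: t :: q)]; rewrite /= ?addn0 ?addn2 //;
  split=> //=.
- by rewrite ext qe.
- by move: qu; rewrite /= inE negb_or xt xq.
- by move=> v; rewrite inE => /orP[/eqP->//|/qS].
- by rewrite exs es eas eat qe.
- by move: qu; rewrite /= !inE !negb_or xt xq xs st sq sa at_ aq eq_sym ax.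
- by move=> v; rewrite !inE => /or4P[/eqP->//|/eqP->//|/eqP->//|/qS].
Qed.
End Short.

Lemma card1_eq (V : finType) (Z : {set V}) a b : #|Z| <= 1 -> a \in Z -> b \in Z -> a = b.
Proof. by move=> Z1 aZ bZ; apply: (card_le1_eqP Z1). Qed.

Section TwoPathsStep.
Variables (V : finType) (e : rel V) (n : nat).
Hypothesis IH : forall Z : {set V}, #|Z| <= 1 -> paths_upto n 2 Z.
Implicit Types (A B C D E H S T X Y Z : {set V}) (u v w x y z : V) (p q : seq V).
Variables (S Z : {set V}) (x y : V).
Hypothesis Z1 : #|Z| <= 1.
Hypothesis Sn : #|S| <= n.+1.

(** A set cut off at a root is settled by [two_cut_paths] if it has a controlled vertex. Otherwise
    it is the single exceptional vertex, which is handled by [two_paths_low]. *)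
Lemma two_paths_nocut : rooted 2 Z e S x y -> path_progression e 2 S x y \/ nocut e S x y x /\
  nocut e S x y y.
Proof.
move=> R; have [|nA] := classic (path_progression e 2 S x y); [by left|right].
have P := IH Z1; have Rs := rooted_sym R.
have cut D : D \proper S :\: [set x; y] -> (exists u, u \in D :\: Z) ->
    1 < #|boundary e S D :\ x| /\ 1 < #|boundary e S D :\ y|.
  move=> Dp ne; have Dn : D != set0.
    by have [u] := ne; rewrite inE => /andP[_ uD]; apply/set0Pn; exists u.
  rewrite !ltnNge; split; apply/negP => b1; apply: nA.
    exact: two_cut_paths R _ _ P Sn isT Dn Dp ne b1.
  apply: path_progression_rev (r_sym R) (r_y R) _.
  by apply: (two_cut_paths Rs P Sn isT Dn _ ne b1); rewrite setUC.
have sing D : D != set0 -> D \proper S :\: [set x; y] -> ~ (exists u, u \in D :\: Z) ->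
    exists2 z, D = [set z] & Z = [set z].
  move=> /set0Pn[z zD] _ nx.
  have zZ w : w \in D -> w = z.
    have inZ v : v \in D -> v \in Z by move=> vD; apply/negPn/negP => vZ; apply: nx; exists v;
      rewrite inE vZ.
    by move=> wD; apply: (card1_eq Z1); apply: inZ.
  have zZ' : z \in Z by apply/negPn/negP => vZ; apply: nx; exists z; rewrite inE vZ.
  exists z; apply/setP => w; rewrite inE; apply/idP/eqP => [|->//]; first exact: zZ.
  by move=> wZ; apply: (card1_eq Z1).
split=> D Dn Dp; (have [/(cut D Dp)[]//|ne] := classic (exists u, u \in D :\: Z));
  have [z eD eZ] := sing D Dn Dp ne; rewrite ltnNge; apply/negP => b1; apply: nA;
  rewrite {}eD in b1 Dp; have zI : z \in S :\: [set x; y] by rewrite -sub1set (proper_sub Dp).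
  by rewrite eZ in R cut; apply: (two_paths_low IH R Sn zI cut b1).
apply: path_progression_rev (r_sym R) (r_y R) _; rewrite eZ in Rs cut.
apply: (two_paths_low IH Rs Sn _ _ b1); rewrite setUC // => D' Dp' ne'.
by have [] := cut D' Dp' ne'.
Qed.

(** With triangles and 4-cycles at x excluded, an inner vertex outside the neighbourhood N of x sees
    at most one vertex of N. So the star formed by x and N is a core with one length that costs no
    degree. *)
Lemma two_paths_step : rooted 2 Z e S x y -> path_progression e 2 S x y.
Proof.
move=> R; have [//|[ncx ncy]] := two_paths_nocut R.
have [//|nA] := classic (path_progression e 2 S x y).
have P := IH Z1; have es := r_sym R; have ei := r_irr R.
have cS := cardI R.
have I1 : 1 < #|S :\: [set x; y]|.
  have [u uI] := r_ne R; have := r_deg R uI; move: uI; rewrite inE => /andP[_ uI].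
  have : nbrs e S u \subset x |: (y |: (S :\: [set x; y] :\ u)).
    apply/subsetP => w; rewrite in_nbrs !inE => /andP[wS euw]; rewrite wS andbT.
    have -> : w != u by apply: contraTneq euw => ->; rewrite ei.
    by case: (w == x); case: (w == y).
  move=> /subset_leq_card; rewrite (cardsD1 u (S :\: _)) uI !cardsU1.
  by case: (_ \notin _); case: (_ \notin _); clear; lia.
have noTri u w : u \in S -> w \in S -> e x u -> e x w -> ~~ e u w.
  by move=> uS wS xu xw; apply/negP => uw; apply: nA; apply: (two_paths_triangle R uS wS).
have noC4 b1 b2 a : b1 \in nbrs e S x -> b2 \in nbrs e S x -> a \in S -> a != x -> a != y ->
    e a b1 -> e a b2 -> b1 = b2.
  rewrite !in_nbrs => /andP[b1S xb1] /andP[b2S xb2] aS ax ay ab1 ab2.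
  apply/eqP/negPn/negP => b12; apply: nA; apply: (two_paths_C4 R ncx _ b12 ax ay).
  by split.
have [N NE] : exists N, nbrs e S x = N by exists (nbrs e S x).
rewrite NE in noC4.
have NI : N \subset S :\: [set x; y] by rewrite -NE; exact: nbrs_root R.
have NS : N \subset S by apply: subset_trans NI (subsetDl _ _).
have flexN T : T \subset N -> progression (uniform_len e (x |: T) x T) 1.
  move=> TN; apply: (@progression1 _ 1) => t tT; exists [:: t] => //.
  apply: spath1 => //; last by rewrite inE tT orbT.
  by have := subsetP TN t tT; rewrite -NE in_nbrs => /andP[].
(* Such a u does not see x, and two neighbours in T would close a 4-cycle through x. *)
have lossN T u : T \subset N -> u \in S :\: [set x; y] -> u \notin N ->
    #|nbrs e (x |: T) u| <= 0 + adj_to e T u.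
  rewrite (inI S x y) => TN /and3P[ux uy uS] uN.
  have sub w : w \in nbrs e (x |: T) u -> w \in T /\ e u w.
    rewrite in_nbrs in_setU1 => /andP[/orP[/eqP ->|//] euw].
    by case/negP: uN; rewrite -NE in_nbrs uS es.
  have [tu|tu] := boolP (adj_to e T u); rewrite add0n.
    rewrite leqNgt; apply/negP => /card_gt1P[b1 [b2 [/sub[b1T e1] /sub[b2T e2]]]] /eqP[].
    by apply: (noC4 b1 b2 u) => //; apply: (subsetP TN).
  rewrite leqn0 cards_eq0 -subset0; apply/subsetP => w /sub[wT euw].
  by case/negP: tu; apply/adj_toP; exists w; rewrite // es.
have [b bN] : exists b, b \in N.
  apply/set0Pn; rewrite -card_gt0 -NE.
  have := card_nbrs_root (rooted_sym R) (nocut_sym ncy); rewrite setUC => /(_ I1).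
  by apply: leq_trans.
have HS : x |: N \subset S :\ y.
  apply/subsetP => w; rewrite in_setU1 in_setD1 => /orP[/eqP ->|/(subsetP NI)].
    by rewrite (r_xy R) (r_x R).
  by rewrite (inI S x y) => /and3P[_ -> ->].
have yX : y \in S :\: (x |: N).
  rewrite inE (r_y R) andbT; apply/negP => /(subsetP HS).
  by rewrite !inE eqxx.
have xN : x \notin N by apply/negP => /(subsetP NI); rewrite !inE eqxx.
have rg : region 2 Z e S x (x |: N) (reach e (S :\: (x |: N)) y) y.
  apply: (region_root R) => //; first exact: setU11.
  by exists b; [rewrite in_setU1 bN orbT|apply: contraNneq xN => <-].
have CX := reach_sub e yX.
set C := reach _ _ _ in rg CX.
have CI u : u \in C :\ y -> u \in S :\: [set x; y] /\ u \notin N.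
  rewrite in_setD1 => /andP[uy /(subsetP CX)]; rewrite (inI S x y) !inE negb_or uy.
  by case/andP=> /andP[-> ->] ->.
have [ne|ne] := classic (exists u, u \in C :\ y :\: Z).
  have : path_progression e 2 ((x |: N) :|: C) x y.
    apply: (core_paths es ei rg (ltn0Sn 0) (subsetUr _ _) (flexN N (subxx _))) => //.
    - move=> u; rewrite in_setD => /andP[_ /CI[uI uN]]; exact: lossN.
    - apply: paths_upto_le P; move: Sn; rewrite (cardsD1 x S) (r_x R) add1n ltnS; apply:
      leq_trans.
      rewrite (cardsD1 b (S :\ x)).
      have bSx : b \in S :\ x by rewrite !inE (subsetP NS) // andbT; apply: contraNneq xN => <-.
      rewrite bSx add1n ltnS; apply: subset_leq_card; apply/subsetP => w /(subsetP CX).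
      rewrite !in_setD1 in_setD in_setU1 negb_or => /andP[/andP[-> wN] ->]; rewrite !andbT.
      by apply: contraNneq wN => ->.
    - by move=> D v; apply: not_dangling es rg _; apply: subxx.
  apply: path_progression_sub => //; rewrite subUset (subset_trans HS (subD1set _ _)).
  exact: subset_trans CX (subsetDl _ _).
(* Here all vertices of C but y are exceptional. A neighbour w of y outside N would be the only one,
   and its two boundary vertices other than y would lie in N and close a 4-cycle with x. *)
have Ny : nbrs e S y \subset N.
  apply/subsetP => w; rewrite in_nbrs => /andP[wS eyw]; apply/negPn/negP => wN.
  have wy : w != y by apply: contraTneq eyw => ->; rewrite ei.
  have wx : w != x by apply: contraTneq eyw => ->; rewrite es (r_nxy R).
  have wC : w \in C.
    apply: (reach_step yX (reach_refl e _ _) _ eyw).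
    by rewrite !inE negb_or wx wN wS.
  have wCy : w \in C :\ y by rewrite in_setD1 wy.
  have CZ v : v \in C :\ y -> v \in Z.
    by move=> vC; apply/negPn/negP => vZ; apply: ne; exists v; rewrite in_setD vZ.
  have wn : [set w] != set0 by apply/set0Pn; exists w; rewrite inE.
  have wp : [set w] \proper S :\: [set x; y].
    rewrite properEcard cards1 I1 andbT sub1set (inI S x y) wx wy wS //.
  have /card_gt1P[b1 [b2 [h1 h2 /eqP[]]]] := ncy _ wn wp.
  have inN v : v \in boundary e S [set w] :\ y -> v \in N /\ e w v.
    rewrite in_setD1 => /andP[vy /boundaryP[_ [/set1P -> ewv vS]]]; rewrite inE => vw; split=> //.
    apply/negPn/negP => vN.
    have vx : v != x.
      by apply: contraNneq wN => vx; rewrite -NE in_nbrs wS es -vx.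
    have vC : v \in C.
      by apply: (reach_step yX wC _ ewv); rewrite !inE negb_or vx vN vS.
    by case/eqP: vw; apply: (card1_eq Z1); apply: CZ; rewrite // in_setD1 vy.
  have [b1N wb1] := inN b1 h1; have [b2N wb2] := inN b2 h2.
  exact: (noC4 b1 b2 w).
(* The new target needs controlled degree; y has two neighbours and Z contains at most one of
   them. *)
have [w wy wZ] : exists2 w, w \in nbrs e S y & w \notin Z.
  have /card_gt1P[b1 [b2 [h1 h2 b12]]] := card_nbrs_root R ncx I1.
  have [b1Z|b1Z] := boolP (b1 \in Z); last by exists b1.
  by exists b2 => //; apply: contraNN b12 => b2Z; apply/eqP/(card1_eq Z1).
have wN := subsetP Ny w wy; have wI := subsetP NI w wN.
have := wI; rewrite (inI S x y) => /and3P[wx wny wS].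
have eyw : e y w by move: wy; rewrite in_nbrs => /andP[].
have exw : e x w by move: wN; rewrite -NE in_nbrs => /andP[].
have [u uw unx] : exists2 u, u \in nbrs e S w & u \notin [set x; y].
  apply/subsetPn/negP => /subset_leq_card; rewrite leqNgt => /negP[].
  apply: leq_ltn_trans (r_deg R (_ : w \in _)).
    by rewrite cards2; case: (_ != _).
  by rewrite in_setD wZ.
set H := x |: (N :\ w).
have HS' : H \subset S :\ y.
  by apply: subset_trans HS; apply: setUS; apply: subD1set.
have wH : w \notin H by rewrite !inE negb_or wx eqxx.
have NyH : nbrs e S y \subset w |: H.
  apply: subset_trans Ny _; apply/subsetP => v vN; rewrite !inE vN andbT.
  by case: (v == w); rewrite // orbT.
have rg' := endgame_region R ncx (setU11 _ _) HS' wI wH NyH.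
have wX : w \in S :\: (y |: H) by rewrite inE in_setU1 negb_or wny wH.
have CX' := reach_sub e wX.
set C' := reach _ _ _ in rg' CX'.
have C'I v : v \in C' :\ w -> v \in S :\: [set x; y] /\ v \notin N.
  rewrite in_setD1 => /andP[vw /(subsetP CX')]; rewrite (inI S x y) !inE !negb_or vw /=.
  by case/andP=> /and3P[-> -> ->] ->.
have inC' a v : a \in C' -> v \in S -> v \notin [set x; y] -> v \notin N -> e a v -> v \in C'.
  move=> aC vS; rewrite in_set2 negb_or => /andP[vx vy] vN eav; apply: (reach_step wX aC _ eav).
  by rewrite !inE !negb_or vx vy vS (negbTE vN) !andbF.
have uwa : (u \in S) && e w u by rewrite -in_nbrs.
have [uS ewu] := andP uwa.
have uN : u \notin N.
  by rewrite -NE in_nbrs uS; apply/negP => exu; have := noTri w u wS uS exw exu; rewrite ewu.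
have uC : u \in C' by apply: (inC' w) => //; apply: reach_refl.
have uw' : u != w by apply: contraTneq ewu => ->; rewrite ei.
(* If u is exceptional, its two boundary vertices cannot both lie in N, again by the exclusion of
   4-cycles; one outside N is controlled. *)
have ne' : exists v, v \in C' :\ w :\: Z.
  have [uZ|uZ] := boolP (u \in Z); last by exists u; rewrite in_setD in_setD1 uZ uw'.
  have uI : u \in S :\: [set x; y] by rewrite in_setD unx.
  have un : [set u] != set0 by apply/set0Pn; exists u; rewrite inE.
  have us : [set u] \subset S :\: [set x; y] by rewrite sub1set.
  have /card_gt1P[b1 [b2 [h1 h2 /eqP b12]]] := r_bd R un us.
  have [ux uy] : u != x /\ u != y by move: unx; rewrite !inE negb_or => /andP.
  have inb v : v \in boundary e S [set u] -> v \notin N -> v \in C' :\ w :\: Z.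
    move=> /boundaryP[_ [/set1P -> euv vS]]; rewrite inE => vu vN.
    have vx : v != x by apply: contraNneq uN => vx; rewrite -NE in_nbrs uS es -vx.
    have vy : v != y.
      apply: contraNneq uN => vy; apply: (subsetP Ny); rewrite in_nbrs uS es -vy //.
    have vw : v != w by apply: contraNneq vN => ->.
    have -> : v \in C' :\ w :\: Z = (v \notin Z) && ((v != w) && (v \in C')) by rewrite in_setD
      in_setD1.
    rewrite vw (inC' u) // ?andbT; last by rewrite !inE negb_or vx.
    by apply: contraNN vu => vZ; apply/eqP/(card1_eq Z1).
  have [b1N|b1N] := boolP (b1 \in N); last by exists b1; apply: inb.
  have [b2N|b2N] := boolP (b2 \in N); last by exists b2; apply: inb.
  case: b12; move: h1 h2 => /boundaryP[_ [/set1P -> e1 _ _]] /boundaryP[_ [/set1P -> e2 _ _]].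
  exact: (noC4 b1 b2 u).
have ewy : e w y by rewrite es.
apply: (endgame_join R isT HS' wI wH ewy).
apply: (core_paths es ei rg' (ltn0Sn 0) (subsetUr _ _) (flexN _ (subD1set _ _))) => //.
- move=> v; rewrite in_setD => /andP[_ /C'I[vI vN]]; apply: lossN => //; exact: subD1set.
- have le : #|C'| <= #|S :\: [set x; y]|.
    apply: subset_leq_card; apply/subsetP => v /(subsetP CX'); rewrite (inI S x y) !inE !negb_or.
    by case/andP=> /and3P[-> -> _] ->.
  by apply: paths_upto_le P; move: Sn le; rewrite cS; clear; lia.
- by move=> D v; apply: not_dangling es rg' _; apply: subxx.
Qed.
End TwoPathsStep.

Theorem two_paths (V : finType) n (Z : {set V}) : #|Z| <= 1 -> paths_upto n 2 Z.
Proof.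
elim: n Z => [|n IH] Z Z1 e S x y Sn R.
  by have := r_x R; move: Sn; rewrite leqn0 cards_eq0 => /eqP ->; rewrite inE.
exact: (two_paths_step IH Z1 Sn R).
Qed.

(** * Path lengths in the cores *)

Section Flex.
Variables (V : finType) (e : rel V).
Hypotheses (e_sym : symmetric e) (e_irr : irreflexive e).
Implicit Types (A B C D E H K S T X Y Z : {set V}) (a b t u v w x y z : V) (p q s : seq V).

Definition clique K : bool := [forall a in K, forall b in K, (a != b) ==> e a b].

Lemma cliqueP K : reflect {in K &, forall a b, a != b -> e a b} (clique K).
Proof.
apply: (iffP forall_inP) => [h a b aK bK ab|h a aK].
  by have /forall_inP/(_ b bK)/implyP := h a aK; apply.
by apply/forall_inP => b bK; apply/implyP; apply: h.
Qed.

Lemma cliqueU1 K x : clique K -> (forall a, a \in K -> e x a) -> clique (x |: K).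
Proof.
move=> /cliqueP cK xK; apply/cliqueP => a b; rewrite !in_setU1.
case/orP=> [/eqP->|aK] /orP[/eqP->|bK]; rewrite ?eqxx //.
- by move=> _; apply: xK.
- by move=> _; rewrite e_sym; apply: xK.
- exact: cK.
Qed.

Lemma clique_path K x s : clique K -> x \in K -> {subset s <= K} -> uniq (x :: s) -> path e x s.
Proof.
move=> /cliqueP cK; elim: s x => //= a s IH x xK sK /andP[xs us].
have aK : a \in K by apply: sK; rewrite mem_head.
rewrite IH // ?andbT; last by move=> w ws; apply: sK; rewrite inE ws orbT.
by apply: cK => //; apply: contraNneq xs => ->; rewrite mem_head.
Qed.

Lemma exists_seq K i : i <= #|K| -> exists s, [/\ uniq s, {subset s <= K} & size s = i].
Proof.
move=> iK; exists (take i (enum K)); split.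
- by rewrite take_uniq // enum_uniq.
- by move=> w /mem_take; rewrite mem_enum.
- by rewrite size_take_min -cardE; apply/minn_idPl.
Qed.

(** Vacuous; it lets a core without a second part be treated like the others. *)
Lemma uniform_len_set0 H x f : progression (uniform_len e H x set0) f.
Proof. by exists 0, 1; split; [left|move=> i _ t; rewrite inE]. Qed.

Lemma uniform_len_clique K x : clique K -> x \notin K -> (forall a, a \in K -> e x a) ->
  progression (uniform_len e (x |: K) x K) #|K|.
Proof.
move=> cK xK xaK; exists 1, 1; split; first by left.
move=> i iK t tK; have iKt : i <= #|K :\ t| by move: iK; rewrite (cardsD1 t) tK.
have [s [us sK ss]] := exists_seq iKt.
have sK' w : w \in rcons s t -> w \in K.
  by rewrite mem_rcons inE => /orP[/eqP->//|/sK]; rewrite in_setD1 => /andP[].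
have ux : uniq (x :: rcons s t).
  rewrite /= rcons_uniq us andbT; apply/andP; split; first by apply: contraNN xK => /sK'.
  by apply/negP => /sK; rewrite !inE eqxx.
have sxK w : w \in rcons s t -> w \in x |: K by move=> /sK' wK; rewrite in_setU1 wK orbT.
exists (rcons s t); last by rewrite size_rcons ss mul1n.
split=> //; last by rewrite last_rcons.
by apply: (clique_path (cliqueU1 cK xaK)) => //; exact: setU11.
Qed.

(* K together with b1 and b2 is a clique up to the possible non-edge b1 b2. *)
Section Kminus.
Variables (K : {set V}) (x b1 b2 : V).
Hypothesis cK : clique K.
Hypotheses (K2 : 1 < #|K|) (xK : x \notin K) (b12 : b1 != b2).
Hypotheses (xb1 : e x b1) (xb2 : e x b2).
Hypotheses (b1K : forall a, a \in K -> e b1 a) (b2K : forall a, a \in K -> e b2 a).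

Let b1nK : b1 \notin K. Proof. by apply/negP => /b1K; rewrite e_irr. Qed.
Let b2nK : b2 \notin K. Proof. by apply/negP => /b2K; rewrite e_irr. Qed.
Let xb1' : x != b1. Proof. by apply: contraTneq xb1 => ->; rewrite e_irr. Qed.
Let xb2' : x != b2. Proof. by apply: contraTneq xb2 => ->; rewrite e_irr. Qed.

(** Paths enter through b1 and visit i vertices of K before t. The longest one visits all the others
    and inserts b2 just before t. *)
Lemma uniform_len_Kminus : progression (uniform_len e (x |: (K :|: [set b1; b2])) x K) #|K|.+1.
Proof.
exists 2, 1; split; first by left.
move=> i; rewrite ltnS => iK t tK; rewrite mul1n.
have cardt : #|K :\ t| = #|K|.-1 by rewrite (cardsD1 t K) tK.
have base s : uniq s -> {subset s <= K :\ t} -> path e b1 s /\ uniq [:: x, b1 & s].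
  move=> us sK; have sK' w : w \in s -> w \in K by move=> /sK; rewrite in_setD1 => /andP[].
  have ub : uniq (b1 :: s) by rewrite /= us andbT; apply: contraNN b1nK => /sK'.
  split; first apply: (clique_path (cliqueU1 cK b1K) (setU11 _ _) _ ub).
    by move=> w /sK' wK; rewrite in_setU1 wK orbT.
  rewrite cons_uniq ub andbT inE negb_or xb1'; apply: contraNN xK => /sK'; exact.
have tns s : {subset s <= K :\ t} -> t \notin s by move=> sK; apply/negP => /sK; rewrite !inE
  eqxx.
have xt : x != t by apply: contraNneq xK => ->.
have b1t : b1 != t by apply: contraNneq b1nK => ->.
have b2t : b2 != t by apply: contraNneq b2nK => ->.
have [iK'|iK'] := ltnP i #|K|.
  have [s [us sK ss]] : exists s, [/\ uniq s, {subset s <= K :\ t} & size s = i].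
    by apply: exists_seq; move: iK' tK; rewrite cardt; clear; lia.
  have sK' w : w \in s -> w \in K by move=> /sK; rewrite in_setD1 => /andP[].
  have [ps ub] := base s us sK.
  exists (b1 :: rcons s t); last by rewrite /= size_rcons ss.
  split; last by rewrite /= last_rcons.
  - rewrite /= xb1 rcons_path ps /=.
    case/lastP: s us sK ss sK' ps ub => [|s c] _ sK _ sK' _ _ /=; first exact: b1K.
    rewrite last_rcons; have cs : c \in rcons s c by rewrite mem_rcons mem_head.
    by apply: (cliqueP _ cK) => //; [exact: sK'|have := sK c cs; rewrite in_setD1 => /andP[]].
  - have -> : [:: x, b1 & rcons s t] = rcons [:: x, b1 & s] t by [].
    by rewrite rcons_uniq ub andbT !inE !negb_or ![t == _]eq_sym xt b1t tns.
  - move=> w; rewrite inE mem_rcons inE !inE => /or3P[/eqP->|/eqP->|/sK' ->].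
    + by rewrite eqxx !orbT.
    + by rewrite tK orbT.
    + by rewrite orbT.
have ei : i = #|K| by apply/eqP; rewrite eqn_leq iK.
have [s [us sK ss]] : exists s, [/\ uniq s, {subset s <= K :\ t} & size s = #|K|.-1].
  by apply: exists_seq; rewrite cardt.
have sK' w : w \in s -> w \in K by move=> /sK; rewrite in_setD1 => /andP[].
have [ps ub] := base s us sK.
exists (b1 :: s ++ [:: b2; t]); last first.
  by rewrite /= size_cat ss /= ei; move: K2; clear; lia.
split.
- rewrite /= xb1 cat_path ps /= b2K // andbT.
  (* As |K| > 1, a vertex of K stands between b1 and b2, which need not be adjacent. *)
  case/lastP: s us sK ss sK' ps ub => [|s c] _ sK ss sK' _ _ /=.
    by move: K2 ss => /=; clear; lia.
  by rewrite last_rcons andbT e_sym; apply: b2K; apply: sK'; rewrite mem_rcons mem_head.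
- have -> : [:: x, b1 & s ++ [:: b2; t]] = [:: x, b1 & s] ++ [:: b2; t] by [].
  rewrite cat_uniq ub /= !inE !negb_or ![b2 == _]eq_sym xb2' b12 ![t == _]eq_sym xt b1t.
  rewrite b2t tns // !andbT /=; by apply: contraNN b2nK => /sK'.
- move=> w; rewrite inE mem_cat !inE => /or4P[/eqP->|/sK' ->|/eqP->|/eqP->].
  + by rewrite eqxx !orbT.
  + by rewrite orbT.
  + by rewrite eqxx !orbT.
  + by rewrite tK orbT.
- by rewrite /= last_cat.
Qed.

Lemma Kminus_to_b2 i : i < 2 -> exists2 p, spath e (x |: (K :|: [set b1; b2])) x p b2 & size p =
  3 + 1 * i.
Proof.
have /card_gt1P[c [d [cIK dK cd]]] := K2.
have xc : x != c by apply: contraNneq xK => ->.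
have xd : x != d by apply: contraNneq xK => ->.
have b1c : b1 != c by apply: contraNneq b1nK => ->.
have b1d : b1 != d by apply: contraNneq b1nK => ->.
have cb2 : c != b2 by apply: contraNneq b2nK => <-.
have db2 : d != b2 by apply: contraNneq b2nK => <-.
case: i => [|[|//]] _; [exists [:: b1; c; b2]|exists [:: b1; c; d; b2]] => //; split=> //.
- by rewrite /= xb1 b1K // e_sym b2K.
- by rewrite /= !inE !negb_or xb1' xc xb2' b1c b12 cb2.
- move=> w; rewrite !inE => /or3P[/eqP->|/eqP->|/eqP->]; by rewrite ?cIK ?eqxx ?orbT.
- by rewrite /= xb1 b1K //= (cliqueP _ cK) // e_sym b2K.
- by rewrite /= !inE !negb_or xb1' xc xd xb2' b1c b1d b12 cd cb2 db2.
- move=> w; rewrite !inE => /or4P[/eqP->|/eqP->|/eqP->|/eqP->]; by rewrite ?cIK ?dK ?eqxx ?orbT.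
Qed.
End Kminus.

Lemma uniform_len_Kminus_pair K x b1 b2 : clique K -> 1 < #|K| -> x \notin K -> b1 != b2 ->
  e x b1 -> e x b2 -> (forall a, a \in K -> e b1 a) -> (forall a, a \in K -> e b2 a) ->
  progression (uniform_len e (x |: (K :|: [set b1; b2])) x [set b1; b2]) 2.
Proof.
move=> cK K2 xK b12 xb1 xb2 b1K b2K; exists 3, 1; split; first by left.
move=> i i2 t /set2P[->|->]; last exact: Kminus_to_b2.
by rewrite setUCA [[set b1; b2]]setUC -setUCA; apply: Kminus_to_b2 => //; rewrite eq_sym.
Qed.

Fixpoint zigzag s s' : seq V :=
  match s, s' with t :: s1, a :: s1' => [:: t, a & zigzag s1 s1'] | _, _ => [::] end.

Lemma zigzag_path A T v s s' : (forall a t, a \in A -> t \in T -> e a t) ->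
  (forall t, t \in T -> e v t) -> [disjoint A & T] ->
  uniq s -> uniq s' -> {subset s <= T} -> {subset s' <= A} -> size s = size s' ->
  [/\ path e v (zigzag s s'), uniq (zigzag s s'),
      (forall w, w \in zigzag s s' -> w \in s \/ w \in s'),
      size (zigzag s s') = 2 * size s & forall t, t \in T -> e (last v (zigzag s s')) t].
Proof.
move=> AT vT dAT; elim: s s' v vT => [|t s IH] [|a s'] v vT //= /andP[ts us] /andP[as' us'] sT sA
  [ss].
have tT : t \in T by apply: sT; rewrite mem_head.
have aA : a \in A by apply: sA; rewrite mem_head.
have sT' : {subset s <= T} by move=> w ws; apply: sT; rewrite inE ws orbT.
have sA' : {subset s' <= A} by move=> w ws; apply: sA; rewrite inE ws orbT.
have [p1 p2 p3 p4 p5] := IH s' a (fun t' => AT a t' aA) us us' sT' sA' ss.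
have at_ : a != t by apply: contraTneq tT => <-; rewrite (disjointFr dAT aA).
split=> //.
- by rewrite vT // e_sym AT.
- rewrite p2 andbT inE negb_or eq_sym at_ /=; apply/andP; split; apply/negP => /p3[].
  + exact: (negP ts).
  + by move=> /sA' tA; rewrite (disjointFr dAT tA) in tT.
  + by move=> /sT' aT; rewrite (disjointFr dAT aA) in aT.
  + exact: (negP as').
- move=> w; rewrite !inE => /or3P[->|->|/p3[]->]; rewrite ?orbT; by [left|right].
- by rewrite p4; clear; lia.
Qed.

Section Bipartite.
Variables (A T : {set V}) (x : V).
Hypotheses (xA : x \notin A) (xT : forall t, t \in T -> e x t).
Hypothesis AT : forall a t, a \in A -> t \in T -> e a t.

Let xnT : x \notin T. Proof. by apply/negP => /xT; rewrite e_irr. Qed.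
Let dAT : [disjoint A & T].
Proof.
rewrite disjoints_subset; apply/subsetP => w wA; rewrite inE; apply/negP => wT.
by have := AT wA wT; rewrite e_irr.
Qed.

(** Here A is the side of x without x, hence the bound |A| + 1; the lengths are the odd numbers up
    to 2f - 1. *)
Lemma uniform_len_bip f : f <= #|T| -> f <= #|A|.+1 -> progression (uniform_len e (x |: (T :|:
  A)) x T) f.
Proof.
move=> fT fA; exists 1, 2; split; first by right.
move=> i fi t tT.
have [s [us sT ss]] : exists s, [/\ uniq s, {subset s <= T :\ t} & size s = i].
  by apply: exists_seq; move: fT; rewrite (cardsD1 t) tT; move: fi; clear; lia.
have [s' [us' sA ss']] : exists s, [/\ uniq s, {subset s <= A} & size s = i].
  by apply: exists_seq; move: fA fi; clear; lia.
have sT' w : w \in s -> w \in T by move=> /sT; rewrite in_setD1 => /andP[].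
have [//|p1 p2 p3 p4 p5] := zigzag_path AT xT dAT us us' sT' sA _; first by rewrite ss.
exists (rcons (zigzag s s') t); last by rewrite size_rcons p4 ss; clear; lia.
split; rewrite ?last_rcons //.
- by rewrite rcons_path p1 p5.
- rewrite -rcons_cons rcons_uniq cons_uniq p2 inE negb_or; apply/and3P; split=> //.
    apply/andP; split; first by apply: contraNneq xnT => <-.
    apply/negP => /p3[/sT|/sA tA]; first by rewrite !inE eqxx.
    by rewrite (disjointFr dAT tA) in tT.
  by apply/negP => /p3[/sT' xT'|/sA xA']; [case/negP: xnT|case/negP: xA].
- move=> w; rewrite mem_rcons !inE => /orP[/eqP->|/p3[/sT' ->|/sA ->]]; by rewrite ?tT ?orbT.
Qed.

Lemma uniform_len_bip2 g : g <= #|T| -> g <= #|A| -> progression (uniform_len e (x |: (T :|: A))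
  x A) g.
Proof.
move=> gT gA; exists 2, 2; split; first by right.
move=> i gi a aA.
have [s [us sT ss]] : exists s, [/\ uniq s, {subset s <= T} & size s = i.+1].
  by apply: exists_seq; move: gT gi; clear; lia.
have [s' [us' sA ss']] : exists s, [/\ uniq s, {subset s <= A :\ a} & size s = i].
  by apply: exists_seq; move: gA; rewrite (cardsD1 a) aA; move: gi; clear; lia.
have us2 : uniq (rcons s' a).
  by rewrite rcons_uniq us' andbT; apply/negP => /sA; rewrite !inE eqxx.
have sA' w : w \in rcons s' a -> w \in A.
  by rewrite mem_rcons inE => /orP[/eqP->//|/sA]; rewrite in_setD1 => /andP[].
have [//|p1 p2 p3 p4 p5] := zigzag_path AT xT dAT us us2 sT sA' _; first by rewrite size_rcons ss
  ss'.
exists (zigzag s (rcons s' a)); last by rewrite p4 ss; clear; lia.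
split=> //.
- rewrite cons_uniq p2 andbT.
  by apply/negP => /p3[/sT xT'|/sA' xA']; [case/negP: xnT|case/negP: xA].
- by move=> w /p3[/sT h|/sA' h]; rewrite !inE h !orbT.
- have : size s = (size s').+1 by rewrite ss ss'.
  clear; elim: s s' x => // t s IH [|c s'] v //=; first by case: s {IH}.
  by move=> [h]; apply: IH.
Qed.
End Bipartite.
End Flex.

(** * Minimal counterexamples *)

(** Minimality is not a field: the hypothesis [IH] of the following sections supplies it. The
    [nocut] fields say that the reduction by [two_cut_paths] is exhausted. *)
Record counterexample (V : finType) k (e : rel V) S x y : Prop := Counterexample {
  ce_rooted : rooted k set0 e S x y;
  ce_cutx : nocut e S x y x;
  ce_cuty : nocut e S x y y;
  ce_noAP : ~ path_progression e k S x y }.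

Lemma counterexample_sym (V : finType) k (e : rel V) S x y :
  counterexample k e S x y -> counterexample k e S y x.
Proof.
case=> R nx ny nA; split; first exact: rooted_sym.
- exact: nocut_sym.
- exact: nocut_sym.
- by move=> A; apply: nA; apply: path_progression_rev (r_sym R) (r_y R) A.
Qed.

(** * General core arguments and clique cores *)

Section Cores.
Variables (V : finType) (e : rel V) (n k : nat).
Hypothesis IH : forall j, paths_upto n j (set0 : {set V}).
Hypothesis k2 : 2 < k.
Implicit Types (A B C D E H K S T X Y Z : {set V}) (a b t u v w x y z : V) (p q s : seq V).

(** A dangling part does not see T, so the loss bound for T2 is required only at vertices without a
    neighbour in T. *)
Lemma core_paths_all S x C z T T2 f g :
  symmetric e -> irreflexive e ->
  region k set0 e S x (x |: (T :|: T2)) C z -> 0 < f -> 0 < g ->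
  progression (uniform_len e (x |: (T :|: T2)) x T) f -> progression (uniform_len e (x |: (T :|:
    T2)) x T2) g ->
  (forall u, u \in C :\ z -> #|nbrs e (x |: (T :|: T2)) u| <= f.-1 + adj_to e T u) ->
  (forall u, u \in C :\ z -> ~~ adj_to e T u ->
     #|nbrs e (x |: (T :|: T2)) u| <= g.-1 + adj_to e T2 u) ->
  #|C| < n -> C :\ z != set0 -> path_progression e k (x |: (T :|: T2) :|: C) x z.
Proof.
move=> es ei rg f0 g0 fl fl2 l1 l2 Cn /set0Pn ne.
have TH : T \subset x |: (T :|: T2) by apply: subset_trans (subsetUl _ _) (subsetUr _ _).
have T2H : T2 \subset x |: (T :|: T2) by apply: subset_trans (subsetUr _ _) (subsetUr _ _).
have P j : paths_upto #|C|.+1 j (set0 : {set V}) by exact: (paths_upto_le Cn (@IH j)).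
have [[D [v dD]]|nd] := classic (exists D v, dangling e C T z D v).
  apply: (dangling_paths es ei rg dD g0 (subxx _) T2H fl2 _ (P _)).
    move=> u; rewrite setD0 => uD; have [_ DC _ tD _] := dD; apply: l2; first exact: (subsetP DC).
    by apply: contraNN tD => tu; apply/exists_inP; exists u.
  by rewrite setD0; have [/set0Pn] := dD.
apply: (core_paths es ei rg f0 TH fl _ (P _)); rewrite ?setD0 //.
by move=> D v dD; apply: nd; exists D, v.
Qed.

(** Two core vertices are enough for the contraction, of order |C| + 1, to be within reach of the
    induction hypothesis. *)
Lemma reach_size S x y H :
  counterexample k e S x y -> #|S| <= n.+1 -> x \in H -> (exists2 h, h \in H & h != x) ->
  H \subset S :\ y -> #|reach e (S :\: H) y| < n.
Proof.
move=> ce Sn xH [h hH hx] HS; have R := ce_rooted ce.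
have yX : y \in S :\: H.
  by rewrite inE (r_y R) andbT; apply/negP => /(subsetP HS); rewrite !inE eqxx.
have HS' : H \subset S by apply: subset_trans HS (subD1set _ _).
have := subset_leq_card (reach_sub e yX); have := cardsDS HS'.
have : 1 < #|H| by apply/card_gt1P; exists h, x.
by have := subset_leq_card HS'; move: Sn; clear; lia.
Qed.

Lemma nbrs_trivial_reach S x y H :
  counterexample k e S x y -> H \subset S :\ y ->
  reach e (S :\: H) y :\ y = set0 -> nbrs e S y \subset H.
Proof.
move=> ce HS C0; have R := ce_rooted ce.
have yX : y \in S :\: H.
  by rewrite inE (r_y R) andbT; apply/negP => /(subsetP HS); rewrite !inE eqxx.
apply/subsetP => w; rewrite in_nbrs => /andP[wS eyw]; apply/negPn/negP => wH.
have : w \in reach e (S :\: H) y :\ y.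
  rewrite in_setD1 (reach_step yX (reach_refl e _ _) _ eyw) ?inE ?wH ?wS //= andbT.
  by apply: contraTneq eyw => ->; rewrite (r_irr R).
by rewrite C0 inE.
Qed.

Lemma region_ce S x y H :
  counterexample k e S x y -> x \in H -> (exists2 h, h \in H & h != x) ->
  H \subset S :\ y -> region k set0 e S x H (reach e (S :\: H) y) y.
Proof. by move=> ce xH hH HS; apply: (region_root (ce_rooted ce) (ce_cutx ce)). Qed.

Lemma sub_reach S y H : H \subset S :\ y -> y \in S ->
  H :|: reach e (S :\: H) y \subset S.
Proof.
move=> HS yS; rewrite subUset (subset_trans HS (subD1set _ _)).
apply: subset_trans (reach_sub e _) (subsetDl _ H).
by rewrite inE yS andbT; apply/negP => /(subsetP HS); rewrite !inE eqxx.
Qed.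

(** The core yields k lengths as soon as the component of y outside it has another vertex; in a
    counterexample y is therefore left alone. *)
Lemma core_nbrs S x y T T2 f g :
  counterexample k e S x y -> #|S| <= n.+1 -> x |: (T :|: T2) \subset S :\ y ->
  x \notin T -> T != set0 -> 0 < f -> 0 < g ->
  progression (uniform_len e (x |: (T :|: T2)) x T) f -> progression (uniform_len e (x |: (T :|:
    T2)) x T2) g ->
  (forall u, u \in S -> u != y -> u \notin x |: (T :|: T2) ->
     #|nbrs e (x |: (T :|: T2)) u| <= f.-1 + adj_to e T u) ->
  (forall u, u \in S -> u != y -> u \notin x |: (T :|: T2) -> ~~ adj_to e T u ->
     #|nbrs e (x |: (T :|: T2)) u| <= g.-1 + adj_to e T2 u) ->
  nbrs e S y \subset x |: (T :|: T2).
Proof.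
move=> ce Sn HS xT /set0Pn[t tT] f0 g0 fl fl2 l1 l2; have R := ce_rooted ce.
have hH : exists2 h, h \in x |: (T :|: T2) & h != x.
  by exists t; [rewrite !inE tT orbT|apply: contraNneq xT => <-].
have rg := region_ce ce (setU11 _ _) hH HS.
have [/eqP C0|Cn] := boolP (reach e (S :\: (x |: (T :|: T2))) y :\ y == set0).
  exact: (nbrs_trivial_reach ce HS C0).
have yX : y \in S :\: (x |: (T :|: T2)).
  by rewrite in_setD (r_y R) andbT; apply/negP => /(subsetP HS); rewrite !inE eqxx.
have inX u : u \in reach e (S :\: (x |: (T :|: T2))) y :\ y ->
    [/\ u \in S, u != y & u \notin x |: (T :|: T2)].
  by rewrite in_setD1 => /andP[uy /(subsetP (reach_sub e yX))]; rewrite in_setD => /andP[].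
case: (ce_noAP ce); apply: path_progression_sub (sub_reach HS (r_y R)) (leqnn k) _.
apply: (core_paths_all (r_sym R) (r_irr R) rg f0 g0 fl fl2) => //.
- by move=> u /inX[]; apply: l1.
- by move=> u /inX[]; apply: l2.
- exact: reach_size ce Sn (setU11 _ _) hH HS.
Qed.

(** The neighbour w takes over as target, and the edge from w to y is appended. The vertex u0
    ensures that the component of w has something besides w. *)
Lemma core_endgame S x y w u0 T T2 f g :
  counterexample k e S x y -> #|S| <= n.+1 -> x |: (T :|: T2) \subset S :\ y ->
  w \in S :\: [set x; y] -> w \notin x |: (T :|: T2) -> e w y ->
  nbrs e S y \subset w |: (x |: (T :|: T2)) ->
  u0 \in S -> e w u0 -> u0 != y -> u0 \notin x |: (T :|: T2) ->
  0 < f -> 0 < g ->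
  progression (uniform_len e (x |: (T :|: T2)) x T) f -> progression (uniform_len e (x |: (T :|:
    T2)) x T2) g ->
  (forall u, u \in S -> u != y -> u != w -> u \notin x |: (T :|: T2) ->
     #|nbrs e (x |: (T :|: T2)) u| <= f.-1 + adj_to e T u) ->
  (forall u, u \in S -> u != y -> u != w -> u \notin x |: (T :|: T2) -> ~~ adj_to e T u ->
     #|nbrs e (x |: (T :|: T2)) u| <= g.-1 + adj_to e T2 u) ->
  False.
Proof.
move=> ce Sn HS wI wH ewy Ny u0S ewu u0y u0H f0 g0 fl fl2 l1 l2; have R := ce_rooted ce.
have rg := endgame_region R (ce_cutx ce) (setU11 _ _) HS wI wH Ny.
move: (wI); rewrite (inI S x y) => /and3P[wx wy wS].
have wX : w \in S :\: (y |: (x |: (T :|: T2))) by rewrite in_setD in_setU1 negb_or wy wH.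
have inX u : u \in reach e (S :\: (y |: (x |: (T :|: T2)))) w :\ w ->
    [/\ u \in S, u != y, u != w & u \notin x |: (T :|: T2)].
  rewrite in_setD1 => /andP[uw /(subsetP (reach_sub e wX))].
  by rewrite in_setD in_setU1 negb_or => /andP[/andP[]].
apply: (ce_noAP ce); apply: (endgame_join R _ HS wI wH ewy); first by move: k2; clear; lia.
apply: (core_paths_all (r_sym R) (r_irr R) rg f0 g0 fl fl2) => //.
- by move=> u /inX[]; apply: l1.
- by move=> u /inX[]; apply: l2.
- have := subset_leq_card (reach_sub e wX); have := cardI R; move: Sn.
  have : #|S :\: (y |: (x |: (T :|: T2)))| <= #|S :\: [set x; y]|.
    apply: subset_leq_card; apply: setDS; apply/subsetP => v /set2P[] ->.
      by rewrite !inE eqxx orbT.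
    exact: setU11.
  by clear; lia.
- apply/set0Pn; exists u0; rewrite in_setD1 (reach_step wX (reach_refl e _ _) _ ewu).
    by rewrite andbT; apply: contraTneq ewu => ->; rewrite (r_irr R).
  by rewrite in_setD in_setU1 negb_or u0y u0H.
Qed.

(** One edge from t to y completes all f paths. The bound f < k later shows that a target has a
    neighbour outside the core. *)
Lemma direct_paths S x y T H f t :
  counterexample k e S x y -> H \subset S :\ y -> x \in H ->
  0 < f -> progression (uniform_len e H x T) f -> t \in T -> e t y -> f < k.
Proof.
move=> ce HS xH f0 fl tT ety; have R := ce_rooted ce.
rewrite ltnNge; apply/negP => kf; apply: (ce_noAP ce).
have dH : [disjoint H & [set y]].
  by rewrite disjoint_sym disjoints1; apply/negP => /(subsetP HS); rewrite !inE eqxx.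
have L : linked_len e [set y] T y 1.
  exists t, [:: y]; split=> //; apply: spath1 (r_irr R) ety _; exact: set11.
have A : path_progression e (f + 1).-1 (H :|: [set y]) x y.
  apply: uniform_linked_join f0 _ _ dH fl (progression1 L) => //.
  by rewrite inE (r_xy R).
apply: path_progression_sub A; last by rewrite addn1.
by rewrite subUset (subset_trans HS (subD1set _ _)) sub1set (r_y R).
Qed.

Lemma ce_root_card S x y : counterexample k e S x y -> 1 < #|nbrs e S y|.
Proof.
move=> ce; have R := ce_rooted ce; apply: (card_nbrs_root R (ce_cutx ce)).
have [u uI] := r_ne R; have := r_deg R uI; move: uI; rewrite setD0 => uI.
have : nbrs e S u \subset x |: (y |: (S :\: [set x; y] :\ u)).
  apply/subsetP => w; rewrite in_nbrs !inE => /andP[wS euw]; rewrite wS andbT.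
  have -> : w != u by apply: contraTneq euw => ->; rewrite (r_irr R).
  by case: (w == x); case: (w == y).
move=> /subset_leq_card; rewrite (cardsD1 u (S :\: _)) uI !cardsU1.
by move: k2; case: (_ \notin _); case: (_ \notin _); clear; lia.
Qed.

Lemma nbrs_notin u T : (forall t, t \in T -> ~~ e u t) -> nbrs e T u = set0.
Proof.
by move=> h; apply/setP => w; rewrite in_nbrs in_set0; apply/negP => /andP[/h/negP].
Qed.

Lemma adj_toE T u : symmetric e -> adj_to e T u = (nbrs e T u != set0).
Proof.
move=> es; apply/adj_toP/set0Pn => [[t tT etu]|[t]].
  by exists t; rewrite in_nbrs tT es.
by rewrite in_nbrs => /andP[tT eut]; exists t; rewrite // es.
Qed.

Lemma card_nbrsU A B u : #|nbrs e (A :|: B) u| <= #|nbrs e A u| + #|nbrs e B u|.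
Proof.
apply: leq_trans (leq_card_setU _ _); apply: subset_leq_card; apply/subsetP => w.
by rewrite !inE => /andP[/orP[->|->] ->]; rewrite ?orbT.
Qed.

Lemma card_nbrs1 x u : #|nbrs e [set x] u| = e u x.
Proof.
have [h|h] := boolP (e u x).
  by apply/eqP/cards1P; exists x; apply/setP => w; rewrite !inE; case: eqP => // ->.
by rewrite nbrs_notin ?cards0 // => t /set1P->.
Qed.

(** The core is x with a maximal clique K of its neighbours, and it has |K| lengths. *)
Lemma triangle_nbrs S x y u w :
  counterexample k e S x y -> #|S| <= n.+1 ->
  u \in S -> w \in S -> e x u -> e x w -> e u w ->
  exists K, [/\ clique e K, 1 < #|K|, K \subset nbrs e S x & nbrs e S y \subset K].
Proof.
move=> ce Sn uS wS xu xw uw; have R := ce_rooted ce.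
have es := r_sym R; have ei := r_irr R.
pose P K := (K \subset nbrs e S x) && clique e K.
have P0 : P [set u; w].
  apply/andP; split; first by apply/subsetP => v /set2P[] ->; rewrite in_nbrs ?uS ?wS.
  apply/(cliqueP e) => a b /set2P[] -> /set2P[] ->; rewrite ?eqxx // => _.
  by rewrite es.
have [K /maxsetP[/andP[KN cK] Kmax] Kuw] := maxset_exists P0.
have K2 : 1 < #|K|.
  apply: leq_trans (subset_leq_card Kuw); rewrite cards2.
  by rewrite (_ : u != w) //; apply: contraTneq uw => ->; rewrite ei.
have KI := subset_trans KN (nbrs_root R).
have xK : x \notin K by apply/negP => /(subsetP KI); rewrite !inE eqxx.
have xKe a : a \in K -> e x a by move=> /(subsetP KN); rewrite in_nbrs => /andP[].
have HS : x |: (K :|: set0) \subset S :\ y.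
  rewrite setU0; apply/subsetP => a /setU1P[->|/(subsetP KI)].
    by rewrite in_setD1 (r_xy R) (r_x R).
  by rewrite (inI S x y) in_setD1 => /and3P[_ -> ->].
have fl : progression (uniform_len e (x |: (K :|: set0)) x K) #|K| by rewrite setU0; apply:
  uniform_len_clique.
exists K; split=> //.
suff Ny : nbrs e S y \subset x |: (K :|: set0).
  apply/subsetP => a aN; have := subsetP Ny a aN; rewrite setU0 => /setU1P[ax|//].
  by move: aN; rewrite in_nbrs ax es (negbTE (r_nxy R)) andbF.
(* With an empty second part any number of lengths is free; 2 leaves room for vertices that see only
   x in the core. *)
apply: (core_nbrs ce Sn HS xK _ _ _ fl (uniform_len_set0 _ _ _ 2)) => //.
- by rewrite -card_gt0; apply: leq_trans K2.
- by apply: leq_trans K2.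
- move=> v vS vy; rewrite setU0 => vH.
  have [tv|tv] := boolP (adj_to e K v); last first.
    rewrite addn0; apply: leq_trans (card_nbrsU _ _ _) _.
    rewrite card_nbrs1; move: tv; rewrite adj_toE // negbK => /eqP ->; rewrite cards0 addn0.
    by apply: leq_trans (leq_b1 _) _; move: K2; clear; lia.
  have -> : #|K|.-1 + true = #|K| by move: K2; clear => /=; lia.
  rewrite -ltnS -[#|K|.+1]add1n; have <- : #|x |: K| = 1 + #|K| by rewrite cardsU1 xK.
  apply: proper_card; rewrite properEneq; apply/andP; split; last first.
    by apply/subsetP => a; rewrite in_nbrs => /andP[].
  (* A vertex adjacent to x and all of K would enlarge the maximal clique. *)
  apply/eqP => eN; have all a : a \in x |: K -> e v a by rewrite -eN in_nbrs => /andP[].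
  have : v |: K = K.
    apply: Kmax; last exact: subsetUr.
    rewrite /P subUset KN sub1set in_nbrs vS es all ?setU11 //=.
    by apply: cliqueU1 => // a aK; apply: all; rewrite in_setU1 aK orbT.
  by move=> /setP/(_ v); rewrite setU11 => vK; rewrite in_setU1 -vK orbT in vH.
- move=> v vS vy; rewrite setU0 => vH tv; apply: leq_trans (card_nbrsU _ _ _) _.
  rewrite card_nbrs1; move: tv; rewrite adj_toE // negbK => /eqP ->; rewrite cards0 addn0.
  by apply: leq_trans (leq_b1 _) _; apply: leq_addr.
Qed.

Definition triangle_free_at S x := forall u w, u \in S -> w \in S -> e x u -> e x w -> ~~ e u w.

(** Entering through b1 or b2 gives |K| + 1 lengths. Neighbours of x see neither b1 nor b2, as x
    lies in no triangle; for other vertices the maximality of K bounds the loss. *)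
Lemma pair_nbrs S x y b1 b2 a1 a2 :
  counterexample k e S x y -> #|S| <= n.+1 ->
  triangle_free_at S x -> triangle_free_at S y ->
  b1 != b2 -> b1 \in nbrs e S x -> b2 \in nbrs e S x ->
  (forall a, a \in [set a1; a2] -> [/\ a \in S :\: [set x; y], e b1 a & e b2 a]) ->
  e a1 a2 -> nbrs e S y = [set b1; b2].
Proof.
move=> ce Sn tfx tfy b12 b1N b2N a12 ea12; have R := ce_rooted ce.
have es := r_sym R; have ei := r_irr R.
pose W := [set a in S :\: [set x; y] | e b1 a && e b2 a].
pose P K := (K \subset W) && clique e K.
have P0 : P [set a1; a2].
  apply/andP; split; first by apply/subsetP => v /a12[vI e1 e2]; rewrite inE vI e1 e2.
  apply/(cliqueP e) => a b /set2P[] -> /set2P[] ->; rewrite ?eqxx // => _.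
  by rewrite es.
have [K /maxsetP[/andP[KW cK] Kmax] Ka] := maxset_exists P0.
have K2 : 1 < #|K|.
  apply: leq_trans (subset_leq_card Ka); rewrite cards2.
  by rewrite (_ : a1 != a2) //; apply: contraTneq ea12 => ->; rewrite ei.
have inK a : a \in K -> [/\ a \in S :\: [set x; y], e b1 a & e b2 a].
  by move=> /(subsetP KW); rewrite inE => /and3P[].
have b1K a : a \in K -> e b1 a by case/inK.
have b2K a : a \in K -> e b2 a by case/inK.
have xK : x \notin K by apply/negP => /inK[]; rewrite !inE eqxx.
move: (b1N) (b2N); rewrite !in_nbrs => /andP[b1S xb1] /andP[b2S xb2].
have NI := nbrs_root R.
have HS : x |: (K :|: [set b1; b2]) \subset S :\ y.
  rewrite !subUset !sub1set in_setD1 (r_xy R) (r_x R) /=.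
  have := subsetP NI b1 b1N; have := subsetP NI b2 b2N; rewrite !(inI S x y) !in_setD1.
  move=> /and3P[_ -> ->] /and3P[_ -> ->]; rewrite !andbT; apply/subsetP => a /inK[].
  by rewrite (inI S x y) in_setD1 => /and3P[_ -> ->].
have fl := uniform_len_Kminus es ei cK K2 xK b12 xb1 xb2 b1K b2K.
have fl2 := uniform_len_Kminus_pair es ei cK K2 xK b12 xb1 xb2 b1K b2K.
have xN u : u \in S -> e u x -> nbrs e [set b1; b2] u = set0.
  by move=> uS ux; apply: nbrs_notin => t /set2P[] ->; apply: tfx; rewrite // es.
have card2 u : #|nbrs e [set b1; b2] u| <= 2.
  apply: leq_trans (_ : #|[set b1; b2]| <= _); last by rewrite cards2 b12.
  by apply: subset_leq_card; apply/subsetP => w; rewrite in_nbrs => /andP[].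
have Ny : nbrs e S y \subset x |: (K :|: [set b1; b2]).
  apply: (core_nbrs ce Sn HS xK _ _ _ fl fl2) => //.
  - by rewrite -card_gt0; apply: leq_trans K2.
  - move=> u uS uy; rewrite !in_setU1 !in_setU !negb_or => /and3P[ux uK ub].
    rewrite /=; apply: leq_trans (card_nbrsU _ _ _) _; rewrite card_nbrs1.
    apply: leq_trans (leq_add (leqnn _) (card_nbrsU _ _ _)) _.
    have KK : #|nbrs e K u| <= #|K|.
      by apply: subset_leq_card; apply/subsetP => w; rewrite in_nbrs => /andP[].
    have [eux|eux] := boolP (e u x).
      rewrite (xN u uS eux) cards0 addn0 adj_toE // -card_gt0.
      by move: K2 KK; case: #|nbrs e K u| => [|m] /=; clear; lia.
    rewrite add0n; have [tu|tu] := boolP (adj_to e K u); last first.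
      by move: tu; rewrite adj_toE // negbK => /eqP ->; rewrite cards0; move: (card2 u) K2;
        clear; lia.
    (* The allowed number is |K| + 1, so only a vertex adjacent to b1, b2 and all of K is too much;
       it would extend K. *)
    have [lt|] := ltnP #|nbrs e K u| #|K|; first by move: lt (card2 u); clear => /=; lia.
    move=> ge; have [le1|] := leqP #|nbrs e [set b1; b2] u| 1; first by move: KK le1; clear =>
      /=; lia.
    move=> ge2; have allK a : a \in K -> e u a.
      have /eqP/setP/(_ a) : nbrs e K u == K.
        by rewrite eqEcard ge andbT; apply/subsetP => w; rewrite in_nbrs => /andP[].
      by rewrite in_nbrs => h aK; move: h; rewrite aK.
    have allb b : b \in [set b1; b2] -> e b u.
      have /eqP/setP/(_ b) : nbrs e [set b1; b2] u == [set b1; b2].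
        rewrite eqEcard cards2 b12 ge2 andbT; apply/subsetP => w; rewrite in_nbrs => /andP[] //.
      by rewrite in_nbrs es => h bb; move: h; rewrite bb.
    have : u |: K = K.
      apply: Kmax; last exact: subsetUr.
      rewrite /P subUset KW sub1set inE (inI S x y) ux uy uS !allb ?inE ?eqxx ?orbT //=.
      exact: cliqueU1.
    by move=> /setP/(_ u); rewrite setU11 (negbTE uK).
  - move=> u uS uy uH tu; apply: leq_trans (card_nbrsU _ _ _) _; rewrite card_nbrs1.
    apply: leq_trans (leq_add (leqnn _) (card_nbrsU _ _ _)) _.
    move: tu; rewrite adj_toE // negbK => /eqP ->; rewrite cards0 add0n.
    have [eux|eux] := boolP (e u x); first by rewrite (xN u uS eux) cards0 addn0 leq_addr.
    have := card2 u; rewrite adj_toE // -card_gt0 /=.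
    by case: #|nbrs e [set b1; b2] u| => [|m] /=; clear; lia.
have yx a : a \in nbrs e S y -> a != x.
  by rewrite in_nbrs es => /andP[_]; apply: contraTneq => ->; rewrite (r_nxy R).
have adj a b : a \in x |: (K :|: [set b1; b2]) -> b \in x |: (K :|: [set b1; b2]) ->
    a \in K -> b != x -> a != b -> e a b.
  move=> _ + aK bx ab; rewrite !inE (negbTE bx) /= => /or3P[bK|/eqP->|/eqP->].
  - exact: (cliqueP _ _ cK).
  - by rewrite es b1K.
  - by rewrite es b2K.
have c2 := ce_root_card ce.
(* A neighbour of y in K is adjacent to every other neighbour of y, since K is joined to the rest of
   the core; this makes a triangle at y. *)
have Nyb : nbrs e S y \subset [set b1; b2].
  apply/subsetP => a aN; have aH := subsetP Ny a aN; have ax := yx a aN.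
  have : a \notin K.
    apply/negP => aK; have : 0 < #|nbrs e S y :\ a|.
      by move: c2; rewrite (cardsD1 a) aN; clear; lia.
    case/card_gt0P=> b; rewrite in_setD1 => /andP[ba bN].
    have bH := subsetP Ny b bN; have bx := yx b bN.
    have eab : e a b by apply: adj; rewrite // eq_sym.
    move: aN bN; rewrite !in_nbrs => /andP[aS ya] /andP[bS yb].
    by have := tfy a b aS bS ya yb; rewrite eab.
  by move: aH; rewrite in_setU1 in_setU (negbTE ax) => /= /orP[->|//].
by apply/eqP; rewrite eqEcard Nyb cards2 b12.
Qed.
End Cores.

(** * Dangling parts of the bipartite core with |A| = 2 *)

Section Special.
Variables (V : finType) (e : rel V) (n k : nat).
Hypothesis IH : forall j, paths_upto n j (set0 : {set V}).
Hypothesis k2 : 2 < k.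
Implicit Types (A B C D E H K S T W X Y Z : {set V}) (a b c t u v w x y z : V) (p q s : seq V).

(* Without D and x, only a may have lost a large part of its degree and only
   sets containing a can have a single neighbour.  A maximal such set E is
   removed, and its attachment vertex replaces a as the exceptional vertex. *)
Lemma dangling_tail_paths S x y D a v b :
  counterexample k e S x y -> #|S| <= n.+1 ->
  D != set0 -> D \subset S :\: [set x; y] -> boundary e S D \subset [set x; a; v] ->
  a \in S :\: [set x; y] :\: D -> v \in S :\: [set x; y] :\: D -> a != v ->
  b \in S :\: [set x; y] :\: D -> b != a -> b != v -> 
  path_progression e 2 (S :\: D :\ x) v y.
Proof.
move=> ce Sn Dn DI bD aI vI av bI ba bv.
have R := ce_rooted ce; have es := r_sym R; have ei := r_irr R.
have cutx := ce_cutx ce.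
have unI u : u \in S :\: [set x; y] :\: D -> [/\ u \notin D, u != x, u != y & u \in S].
  by rewrite in_setD (inI S x y) => /and4P[].
have [aD ax ay aS] := unI a aI; have [vD vx vy vS] := unI v vI; have [bD' bx by_ bS] := unI b bI.
have yS := r_y R; have xy := r_xy R.
have yD : y \notin D by apply/negP => /(subsetP DI); rewrite !inE eqxx orbT.
have xD : x \notin D by apply/negP => /(subsetP DI); rewrite !inE eqxx.
have nD u w : u \in D -> e u w -> w \in S -> w \notin D -> w \in [set x; a; v].
  by move=> uD euw wS wD; apply: (subsetP bD); apply/boundaryP; exists u.
have [W WE] : exists W, S :\: D :\ x = W by exists (S :\: D :\ x).
have inW u : (u \in W) = [&& u != x, u \notin D & u \in S] by rewrite -WE !inE.
rewrite WE; have vW : v \in W by rewrite inW vx vD.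
have yW : y \in W by rewrite inW eq_sym xy yD.
have aW : a \in W by rewrite inW ax aD.
have bW : b \in W by rewrite inW bx bD'.
have WS : W \subset S by apply/subsetP => u; rewrite inW => /and3P[].
(* D is attached only at x, a and v, so the remaining vertices of W lose at most the neighbour x. *)
have out u w : u \in W -> u != v -> u != a -> w \in S -> e u w -> w != x -> w \in W.
  rewrite !inW => /and3P[ux uD uS] uv ua wS euw wx; rewrite wx wS andbT /=.
  apply/negP => wD; have := nD w u wD; rewrite es => /(_ euw uS uD).
  by rewrite !inE (negbTE ux) (negbTE ua) (negbTE uv).
have bdW E : E != set0 -> E \subset W :\: [set v; y] -> a \notin E -> 1 < #|boundary e W E|.
  move=> En EW aE.
  have inE' u : u \in E -> [/\ u \in W, u != v, u != y & u != a].
    move=> uE; have := subsetP EW u uE; rewrite (inI W v y) => /and3P[-> -> ->]; split=> //.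
    by apply: contraNneq aE => <-.
  have Ep : E \proper S :\: [set x; y].
    apply/properP; split; last by exists a; rewrite // (inI S x y) ax ay.
    apply/subsetP => u /inE'[uW _ uy _]; rewrite (inI S x y) uy.
    by move: uW; rewrite inW => /and3P[-> _ ->].
  apply: leq_trans (cutx E En Ep) (subset_leq_card _); apply/subsetP => w.
  rewrite in_setD1 => /andP[wx /boundaryP[u [uE euw wS wE]]]; apply/boundaryP; exists u; split=>
    //.
  by have [uW uv _ ua] := inE' u uE; apply: out euw wx.
have degW u : u \in W -> u != v -> u != y -> u != a -> 2 < #|nbrs e W u|.
  move=> uW uv uy ua; have : k < #|nbrs e S u|.
    apply: (r_deg R); rewrite setD0 (inI S x y) uy.
    by move: uW; rewrite inW => /and3P[-> _ ->].
  have : #|nbrs e S u| <= #|nbrs e W u| + adj_to e [set x] u.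
    by apply: nbrs_le => // w wS euw wx; apply: out euw wx.
  by move: k2; case: (adj_to _ _ _); clear; lia.
pose P E := (E \subset W :\: [set v; y]) && (#|boundary e W E| <= 1).
have P0 : P set0.
  rewrite /P sub0set; apply: leq_trans (_ : 0 <= _) => //; rewrite leqn0 cards_eq0 -subset0.
  by apply/subsetP => w /boundaryP[u []]; rewrite in_set0.
case: (@arg_maxnP _ set0 P (fun E => #|E|) P0) => E /andP[EW Eb] Emax.
have aE : E != set0 -> a \in E.
  by move=> En; apply: contraTT Eb => aE; rewrite -ltnNge; apply: bdW.
have [W' W'E] : exists W', W :\: E = W' by exists (W :\: E).
have inW' u : (u \in W') = (u \notin E) && (u \in W) by rewrite -W'E in_setD.
have vE : v \notin E by apply/negP => /(subsetP EW); rewrite !inE eqxx.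
have yE : y \notin E by apply/negP => /(subsetP EW); rewrite !inE eqxx orbT.
have vW' : v \in W' by rewrite inW' vE.
have yW' : y \in W' by rewrite inW' yE.
have W'W : W' \subset W by apply/subsetP => u; rewrite inW' => /andP[].
have bdW' D3 : D3 != set0 -> D3 \subset W' :\: [set v; y] -> 1 < #|boundary e W' D3|.
  move=> D3n D3W; rewrite ltnNge; apply/negP => b1.
  have D3W' : D3 \subset W :\: [set v; y] by apply: subset_trans D3W _; apply: setSD.
  have D3E u : u \in D3 -> u \notin E.
    by move=> /(subsetP D3W); rewrite in_setD inW' => /and3P[].
  have bigger : #|boundary e W (E :|: D3)| <= 1 -> False.
    move=> b2; have PE : P (E :|: D3) by rewrite /P b2 subUset EW D3W'.
    have := Emax _ PE; rewrite /= => le; have [d dD] := set0Pn _ D3n.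
    have /eqP/setP/(_ d) : E == E :|: D3 by rewrite eqEcard subsetUl.
    by rewrite in_setU dD orbT (negbTE (D3E d dD)).
  (* If D3 contains the attachment vertex of E, or if E is empty, then D3 enlarges E. Otherwise D3
     keeps its small boundary in W, and as it avoids a this contradicts [bdW]. *)
  have [/existsP[c /andP[cD tc]]|tE] := boolP [exists c, (c \in D3) && adj_to e E c].
    apply: bigger; apply: leq_trans (subset_leq_card _) b1.
    apply/subsetP => w /boundaryP[u [uU euw wW]]; rewrite in_setU negb_or => /andP[wE wD3].
    move: uU; rewrite in_setU => /orP[uE|uD3]; last by apply/boundaryP; exists u; rewrite inW' wE.
    have wb : w \in boundary e W E by apply/boundaryP; exists u.
    have cb : c \in boundary e W E.
      have := subsetP D3W' c cD; rewrite (inI W v y) => /and3P[_ _ cW].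
      by rewrite in_boundary tc (D3E c cD) cW.
    by rewrite (card1_eq Eb wb cb) cD in wD3.
  have b3 : #|boundary e W D3| <= 1.
    apply: leq_trans (subset_leq_card _) b1; apply/subsetP => w /boundaryP[u [uD euw wW wD]].
    apply/boundaryP; exists u; split=> //; rewrite inW' wW andbT; apply: contraNN tE => wE.
    by apply/existsP; exists u; rewrite uD; apply/adj_toP; exists w; rewrite // es.
  have [E0|En] := eqVneq E set0; first by apply: bigger; rewrite E0 set0U.
  move: b3; rewrite leqNgt => /negP[]; apply: bdW => //.
  by apply/negP => /D3E; rewrite aE.
pose Z := if E == set0 then [set a] else boundary e W E.
have Z1 : #|Z| <= 1 by rewrite /Z; case: ifP => _; rewrite ?cards1.
have ZP u : u \in W' -> u \notin Z -> u != a /\ forall w, w \in E -> ~~ e u w.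
  rewrite /Z inW' => /andP[uE uW]; case: eqP => [-> | /eqP En].
    by rewrite inE => ua; split=> // w; rewrite inE.
  move=> ub; split; first by apply: contraNneq uE => ->; apply: aE.
  move=> w wE; apply: contraNN ub => euw; apply/boundaryP; exists w; split=> //; by rewrite es.
have [[u uZ]|ne] := classic (exists u, u \in W' :\ v :\ y :\: Z).
  apply: path_progression_sub (subset_trans (subD1set W' v) W'W) (leqnn 2) _.
  have W'n : #|W' :\ v| < #|W'|.+1 by rewrite ltnS; apply: subset_leq_card; apply: subD1set.
  apply: (contract1 es ei (two_paths Z1) W'n).
  - by rewrite in_setD1 eq_sym vy yW'.
  - by rewrite !inE eqxx.
  - by exists u.
  - move=> D3 D3n D3W; apply: (@sep_of_cut _ e W' _ _ (boundary e W' D3)) => //.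
      by apply: bdW' => //; rewrite setDDl in D3W.
    by move=> w wb wv; rewrite in_setD1 wv (subsetP (boundary_sub _ _ _) w wb).
  move=> w; rewrite in_setD in_setD1 in_setD1 => /and4P[wZ wy wv wW].
  have [wa nE] := ZP w wW wZ; apply: leq_trans (degW w (subsetP W'W w wW) wv wy wa) _.
  apply: leq_trans (nbrs_le (S := W) (C := W' :\ v) (t := v) es _) _ => //.
  move=> t tW ewt tv; rewrite in_setD1 tv inW' tW andbT.
  by apply/negP => /nE; rewrite ewt.
have W'3 u : u \in W' -> u != v -> u != y -> u \in Z.
  move=> uW uv uy; apply/negPn/negP => uZ; apply: ne; exists u.
  by rewrite in_setD uZ !in_setD1 uv uy.
have En : E != set0.
  apply/negP => /eqP E0; have := W'3 b; rewrite inW' bW bv by_ E0 inE /Z E0 eqxx inE (negbTE ba).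
  by move=> /(_ isT isT isT).
have ZE : Z = boundary e W E by rewrite /Z (negbTE En).
have NyW w : w \in nbrs e S y -> w \in W /\ e y w.
  rewrite in_nbrs => /andP[wS eyw]; split=> //; apply: (out _ _ yW _ _ wS eyw).
  - by rewrite eq_sym.
  - by rewrite eq_sym.
  - by apply: contraTneq eyw => ->; rewrite es (r_nxy R).
(* If E is attached at y, then v has no neighbours outside D except possibly x, a and y, so v |: D
   is cut off by these three. *)
have [yZ|yZ] := boolP (y \in Z).
  case: (ce_noAP ce); apply: (@three_cut_paths _ e n k S x y (v |: D) a) => //.
  - exact: ce_cuty ce.
  - by apply/set0Pn; exists v; apply: setU11.
  - by rewrite subUset DI andbT sub1set (inI S x y) vx vy.
  - by rewrite in_setD in_setU1 negb_or av aD (inI S x y) ax ay.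
  - apply/subsetP => w /boundaryP[u [uD euw wS]]; rewrite in_setU1 negb_or => /andP[wv wD].
    move: uD; rewrite in_setU1 => /orP[/eqP uv|uD]; last first.
      have := nD u w uD euw wS wD; rewrite !inE (negbTE wv) orbF.
      by case/orP=> ->; rewrite ?orbT.
    rewrite {u}uv in euw; rewrite !inE; case: eqVneq => //= wx.
    have [//|wy] := eqVneq w y; first by rewrite orbT.
    have wW : w \in W by rewrite inW wx wD.
    have wE : w \notin E.
      apply/negP => wE; have vb : v \in boundary e W E by apply/boundaryP; exists w; rewrite es.
      by rewrite ZE in yZ; rewrite (card1_eq Eb vb yZ) eqxx in vy.
    have wW' : w \in W' by rewrite inW' wE.
    have := W'3 w wW' wv wy; move=> wZ; have := card1_eq Z1 wZ yZ => wy'.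
    by rewrite wy' eqxx in wy.
  - by exists b => //; rewrite in_setD in_setU1 negb_or bv bD' (inI S x y) bx by_.
have NyE w : w \in nbrs e S y -> w \in W' /\ e y w.
  move=> /NyW[wW eyw]; rewrite inW' wW andbT; split=> //; apply: contraNN yZ => wE.
  by rewrite ZE; apply/boundaryP; exists w; rewrite es.
have Nyv w : w \in nbrs e S y -> w != v -> w \in Z.
  by move=> /NyE[wW eyw] wv; apply: W'3 => //; apply: contraTneq eyw => ->; rewrite ei.
have c2 := ce_root_card k2 ce.
have [c [cN cv]] : exists c, c \in nbrs e S y /\ c != v.
  have : 0 < #|nbrs e S y :\ v| by move: c2; rewrite (cardsD1 v (nbrs _ _ _)); case: (v \in _);
    clear; lia.
  by case/card_gt0P=> c; rewrite in_setD1 => /andP[cv cN]; exists c.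
have vN : v \in nbrs e S y.
  apply: contraTT c2 => vN; rewrite -leqNgt; apply: leq_trans Z1; apply: subset_leq_card.
  by apply/subsetP => w wN; apply: Nyv => //; apply: contraNneq vN => <-.
have cZ := Nyv c cN cv; have [cW' eyc] := NyE c cN; have [_ eyv] := NyE v vN.
have cy : c != y by apply: contraTneq eyc => ->; rewrite ei.
(* Besides E only v, y and c are left, so c must see v, and v y and v c y are the two paths. *)
have evc : e v c.
  have cn : [set c] != set0 by apply/set0Pn; exists c; rewrite inE.
  have cs : [set c] \subset W' :\: [set v; y] by rewrite sub1set (inI W' v y) cv cy.
  have := bdW' _ cn cs; apply: contraTT => evc; rewrite -leqNgt -(cards1 y).
  apply: subset_leq_card; apply/subsetP => w /boundaryP[_ [/set1P -> ecw wW]]; rewrite !inE => wc.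
  have [//|wy] := eqVneq w y; have wv : w != v by apply: contraNneq evc => <-; rewrite es.
  by have := card1_eq Z1 (W'3 w wW wv wy) cZ => wc'; rewrite wc' eqxx in wc.
exists 1, 1; split; first by left.
case=> [|[|//]] _; [exists [:: y]|exists [:: c; y]] => //; split=> //=.
- by rewrite es eyv.
- by rewrite inE vy.
- by move=> w; rewrite inE => /eqP->.
- by rewrite evc es eyc.
- by rewrite !inE !negb_or eq_sym cv vy cy.
- by move=> w; rewrite !inE => /orP[/eqP->|/eqP->]; rewrite // (subsetP W'W).
Qed.

(* If every dangling part sees x, then D plus v, with a deleted, still carries
   k - 1 admissible x-v paths, and there are two admissible v-y paths outside
   (or {x, a, y} is a 3-cut when v = y). *)
Lemma dangling_avoiding_root S x y B a :
  counterexample k e S x y -> #|S| <= n.+1 ->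
  x |: (B :|: [set a]) \subset S :\ y -> B \subset nbrs e S x -> a != x -> a \notin B -> 1 < #|B|
    ->
  forall D v, dangling e (reach e (S :\: (x |: (B :|: [set a]))) y) B y D v ->
    exists D' v', dangling e (reach e (S :\: (x |: (B :|: [set a]))) y) B y D' v' /\
      ~~ adj_sets e D' [set x].
Proof.
move=> ce Sn HS BN ax aB B2 D v dD; apply: NNPP => nx.
have R := ce_rooted ce; have es := r_sym R; have ei := r_irr R.
set H := x |: (B :|: [set a]) in HS dD nx *.
have all_x D' v' : dangling e (reach e (S :\: H) y) B y D' v' -> adj_sets e D' [set x].
  by move=> d; apply: contraT => t; case: nx; exists D', v'; split.
have aH : a \in H by rewrite !inE eqxx !orbT.
have rg : region k set0 e S x H (reach e (S :\: H) y) y.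
  by apply: (region_ce ce (setU11 _ _) _ HS); exists a.
have yH : y \notin H by apply/negP => /(subsetP HS); rewrite !inE eqxx.
have yX : y \in S :\: H by rewrite in_setD yH (r_y R).
have CX := reach_sub e yX.
have [C CE] : exists C, reach e (S :\: H) y = C by exists (reach e (S :\: H) y).
rewrite CE in dD all_x rg CX; clear nx.
have [Dn DC vCD tD bv] := dD; have [vC vD] := setDP vCD.
have DCx u : u \in D -> [/\ u \in S, u != y & u \notin H].
  by move=> /(subsetP DC); rewrite in_setD1 => /andP[uy /(subsetP CX)]; rewrite in_setD =>
    /andP[].
have inH u : u \notin H -> [/\ u != x, u != a & u \notin B].
  by rewrite /H !inE !negb_or => /and3P[].
have DI : D \subset S :\: [set x; y].
  by apply/subsetP => u /DCx[uS uy /inH[ux _ _]]; rewrite (inI S x y) ux uy.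
have nD u w : u \in D -> e u w -> w \in S -> w \notin D -> w \in [set x; a; v].
  move=> uD euw wS wD; have : w \in H :|: C.
    by apply: (subsetP (g_closed rg (subsetP DC u uD))); rewrite in_nbrs wS.
  rewrite in_setU => /orP[|wC]; last first.
    by have : w \in boundary e C D by [apply/boundaryP; exists u]; move=> /(subsetP bv); rewrite
      !inE => ->; rewrite !orbT.
  rewrite /H !inE => /or3P[->//|wB|->]; last by rewrite orbT.
  by case/negP: tD; apply/adj_setsP; exists u, w; rewrite es.
have bD : boundary e S D \subset [set x; a; v].
  by apply/subsetP => w /boundaryP[u [uD euw wS wD]]; apply: nD euw wS wD.
have := subsetP CX v vC; rewrite in_setD => /andP[vH vS]; have [vx va vB] := inH v vH.
have := subsetP HS a aH; rewrite in_setD1 => /andP[ay aS].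
have aD : a \notin D by apply/negP => /DCx[_ _]; rewrite aH.
have aI : a \in S :\: [set x; y] :\: D by rewrite in_setD aD (inI S x y) ax ay.
have [b bB] : exists b, b \in B by apply/card_gt0P; apply: ltnW.
have bH : b \in H by rewrite !inE bB !orbT.
have bI : b \in S :\: [set x; y] :\: D.
  rewrite in_setD (subsetP (nbrs_root R)) ?(subsetP BN) // andbT.
  by apply/negP => /DCx[_ _]; rewrite bH.
have ba : b != a by apply: contraNneq aB => <-.
have bv' : b != v by apply: contraNneq vB => <-.
have [vy|vy] := eqVneq v y.
  apply: (ce_noAP ce); apply: (@three_cut_paths _ e n k S x y D a) => //.
  - exact: ce_cutx ce.
  - exact: ce_cuty ce.
  - by rewrite -vy.
  - by exists b.
have vI : v \in S :\: [set x; y] :\: D by rewrite in_setD vD (inI S x y) vx vy.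
have av : a != v by rewrite eq_sym.
have A2 := dangling_tail_paths ce Sn Dn DI bD aI vI av bI ba bv'.
have eD : (v |: D) :\ v = D by rewrite setU1K.
have vDC : v |: D \subset C by rewrite subUset sub1set vC (subset_trans DC (subD1set _ _)).
have Cn : #|C| < n.
  by rewrite -CE; apply: (reach_size ce Sn (setU11 _ _) _ HS); exists a.
have xD : x \notin D by apply/negP => /DCx[_ _]; rewrite /H setU11.
(* Deleting a costs each vertex of D at most one neighbour, hence k - 1. *)
have A1 : path_progression e k.-1 (v |: D) x v.
  apply: (contract1 es ei (@IH k.-1)).
  - exact: leq_ltn_trans (subset_leq_card vDC) Cn.
  - exact: setU11.
  - by rewrite in_setU1 negb_or eq_sym vx.
  - by rewrite eD setD0; apply/set0Pn.
  - move=> D2 D2n; rewrite eD => D2D.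
    have inb w : w \in boundary e C D2 -> w \in boundary e (v |: D) D2.
      move=> /boundaryP[u [uD euw wC wD2]]; apply/boundaryP; exists u; split=> //.
      rewrite in_setU1; have [wD|wD] := boolP (w \in D); first by rewrite orbT.
      have : w \in boundary e C D by apply/boundaryP; exists u; split=> //; apply: (subsetP D2D).
      by move=> /(subsetP bv); rewrite inE => ->.
    have [w wb] := set0Pn _ (g_conn rg D2n (subset_trans D2D DC)).
    split; first by apply/set0Pn; exists w; apply: inb.
    (* A subset with a single boundary vertex dangles itself and therefore sees x by assumption. *)
    have [|b1] := ltnP 1 #|boundary e (v |: D) D2|; [by left|right].
    apply: (all_x D2 w); split=> //.
    - exact: subset_trans D2D DC.
    - by have /boundaryP[_ [_ _ wC wD2]] := wb; rewrite in_setD wD2.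
    - apply: contraNN tD => /adj_setsP[u [t [uD tT etu]]].
      by apply/adj_setsP; exists u, t; rewrite (subsetP D2D).
    - by apply/subsetP => w' wb'; rewrite inE; apply/eqP/(card1_eq b1); apply: inb.
  rewrite eD setD0 => u uD; have [uS uy uH] := DCx u uD; have [ux ua _] := inH u uH.
  have : k < #|nbrs e S u| by apply: (r_deg R); rewrite setD0 (inI S x y) ux uy.
  have h1 : #|nbrs e S u| <= #|nbrs e (S :\ a) u| + adj_to e [set a] u.
    by apply: nbrs_le => // w wS _ wa; rewrite in_setD1 wa.
  have h2 : #|nbrs e (S :\ a) u| <= #|nbrs e (v |: D) u| + adj_to e [set x] u.
    apply: nbrs_le => // w; rewrite in_setD1 => /andP[wa wS] euw wx.
    rewrite in_setU1; have [|wD] := boolP (w \in D); first by rewrite orbT.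
    by have := nD u w uD euw wS wD; rewrite !inE (negbTE wx) (negbTE wa) => /= ->.
  by move: h1 h2 k2; case: (adj_to e [set a] u); clear => /=; lia.
apply: (ce_noAP ce).
have A2' : path_progression e 2 (S :\: D :\ x :\ v) v y.
  by apply: progression_sub (leqnn 2) A2 => c [p /spath_avoid pp sp]; exists p.
have A3 : path_progression e (k.-1 + 2).-1 ((v |: D) :|: (S :\: D :\ x :\ v)) x y.
  apply: (path_progression_join _ _ _ _ A1 A2') => //; first by move: k2; clear; lia.
    by rewrite !inE eqxx !andbF.
  rewrite disjoints_subset; apply/subsetP => w; rewrite !inE.
  by case/orP=> [->//|->]; rewrite !andbF.
apply: path_progression_sub A3; last by move: k2; clear; lia.
rewrite !subUset sub1set vS (subset_trans DI (subsetDl _ _)) /=.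
by apply/subsetP => w; rewrite !inE => /and4P[].
Qed.
End Special.

(** * Bipartite cores *)

Section Bip.
Variables (V : finType) (e : rel V) (n k : nat).
Hypothesis IH : forall j, paths_upto n j (set0 : {set V}).
Hypothesis k2 : 2 < k.
Implicit Types (A B C D E H K S T W X Y Z : {set V}) (a b c t u v w x y z : V) (p q s : seq V).

Definition pair_free S x y := forall b1 b2 a1 a2,
  b1 != b2 -> b1 \in nbrs e S x -> b2 \in nbrs e S x ->
  (forall a, a \in [set a1; a2] -> [/\ a \in S :\: [set x; y], e b1 a & e b2 a]) -> ~~ e a1 a2.

Definition common S y A := [set b in S :\ y | [forall a in A, e a b]].
Definition bicore S x y A := [&& x \in A, A \subset S :\ y & #|A| <= #|common S y A|].

Lemma in_common S y A b :
  reflect [/\ b \in S, b != y & forall a, a \in A -> e a b] (b \in common S y A).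
Proof.
rewrite inE in_setD1; apply: (iffP andP) => [[/andP[by_ bS] /forall_inP h]|[bS by_ h]]; split=>
  //.
  by rewrite by_.
by apply/forall_inP.
Qed.

Section Fixed.
Variables (S : {set V}) (x y : V).
Hypothesis ce : counterexample k e S x y.
Let R := ce_rooted ce.
Let es := r_sym R.
Let ei := r_irr R.
Hypothesis tfx : triangle_free_at e S x.
Hypothesis pfx : pair_free S x y.

Lemma common_nbrs A : x \in A -> common S y A \subset nbrs e S x.
Proof. by move=> xA; apply/subsetP => b /in_common[bS _ h]; rewrite in_nbrs bS h. Qed.

Section Loss.
Variables (A T : {set V}) (u : V).
Hypotheses (xA : x \in A) (AS : A \subset S :\ y) (TN : T \subset nbrs e S x).
Hypothesis AT : forall a t, a \in A -> t \in T -> e a t.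
Hypotheses (uS : u \in S) (uy : u != y) (uA : u \notin A).

Lemma bip_set : x |: (T :|: (A :\ x)) = T :|: A.
Proof. by rewrite setUCA setD1K. Qed.

(** A neighbour a of u in A would be joined to u inside the common neighbourhood of two neighbours
    of x, or would give a triangle at x if a = x. *)
Lemma nbrs_both : 1 < #|nbrs e T u| -> nbrs e A u = set0.
Proof.
case/card_gt1P=> b1 [b2 []]; rewrite !in_nbrs => /andP[b1T ub1] /andP[b2T ub2] b12.
apply: nbrs_notin => a aA; apply/negP => ua.
have inT t : t \in T -> t \in S /\ e x t.
  by move=> /(subsetP TN); rewrite in_nbrs => /andP.
have [b1S xb1] := inT b1 b1T; have [b2S xb2] := inT b2 b2T.
have [ax|ax] := eqVneq a x.
  have xu : e x u by rewrite -ax es.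
  by have := tfx uS b1S xu xb1; rewrite ub1.
have ux : u != x by apply: contraNneq uA => ->.
have := subsetP AS a aA; rewrite in_setD1 => /andP[ay aS].
have hh c : c \in [set u; a] -> [/\ c \in S :\: [set x; y], e b1 c & e b2 c].
  case/set2P=> ->; rewrite (inI S x y) es [e b2 _]es.
    by rewrite ux uy uS ub1 ub2.
  by rewrite ax ay aS !AT.
by have := pfx b12 (subsetP TN b1 b1T) (subsetP TN b2 b2T) hh; rewrite ua.
Qed.

Lemma card_nbrsD1 : #|nbrs e A u| = e u x + #|nbrs e (A :\ x) u|.
Proof.
rewrite (cardsD1 x) in_nbrs xA; congr (_ + _); apply: eq_card => w.
by rewrite !inE andbA.
Qed.

Lemma nbrsA_le : ~~ e u x -> #|nbrs e A u| <= #|A|.-1.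
Proof.
move=> ux; rewrite card_nbrsD1 (negbTE ux) (cardsD1 x A) xA.
by apply: subset_leq_card; apply/subsetP => w; rewrite in_nbrs => /andP[].
Qed.

(** By [nbrs_both], u sees at most one vertex of T or none of A, so the two bounds never add up
    fully. *)
Lemma bip_loss1 (s : nat) : #|A| = s -> #|nbrs e T u| <= s -> #|nbrs e A u| <= s.-1 ->
  #|nbrs e (x |: (T :|: (A :\ x))) u| <= s.-1 + adj_to e T u.
Proof.
move=> As Ts As'; rewrite bip_set; apply: leq_trans (card_nbrsU _ _ _ _) _.
have s0 : 0 < s by rewrite -As; apply/card_gt0P; exists x.
have [c2|c1] := ltnP 1 #|nbrs e T u|.
  rewrite (nbrs_both c2) cards0 addn0 adj_toE // -card_gt0 (ltn_trans _ c2) //.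
  by move: Ts s0; clear => /=; lia.
rewrite addnC leq_add // adj_toE // -card_gt0; by move: #|nbrs e T u| c1 => [|[|m]].
Qed.

(** For s = 2 the second part has one length, so no loss is allowed beyond the contracted vertex and
    the neighbour x is too much; for s >= 3 the margin s - 2 covers it. *)
Lemma bip_loss2 (s : nat) : #|A| = s -> ~~ adj_to e T u -> #|nbrs e A u| <= s.-1 ->
  (s = 2 -> ~~ e u x) ->
  #|nbrs e (x |: (T :|: (A :\ x))) u| <= (maxn 1 s.-1).-1 + adj_to e (A :\ x) u.
Proof.
move=> As tu As' s2; rewrite bip_set; apply: leq_trans (card_nbrsU _ _ _ _) _.
move: tu; rewrite adj_toE // negbK => /eqP ->; rewrite cards0 add0n.
have s0 : 0 < s by rewrite -As; apply/card_gt0P; exists x.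
rewrite adj_toE // -card_gt0; move: As'; rewrite card_nbrsD1.
move: #|nbrs e (A :\ x) u| => m; case: (e u x) s2 => s2; last first.
  by case: m => [|m] /=; clear; lia.
have : s <> 2 by move=> /s2.
by case: m => [|m] /=; move: s0; clear; lia.
Qed.
End Loss.

Lemma bicore1 : bicore S x y [set x].
Proof.
rewrite /bicore set11 sub1set in_setD1 (r_xy R) (r_x R) cards1 /=.
apply: leq_trans (_ : #|nbrs e S x| <= _).
  by have := ce_root_card k2 (counterexample_sym ce); clear; lia.
apply: subset_leq_card; apply/subsetP => b bN; apply/in_common.
have := subsetP (nbrs_root R) b bN; rewrite (inI S x y) => /and3P[_ by_ bS].
by split=> // a /set1P ->; move: bN; rewrite in_nbrs => /andP[].
Qed.

Lemma max_bicore : exists A, bicore S x y A /\ forall A', bicore S x y A' -> #|A'| <= #|A|.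
Proof.
case: (@arg_maxnP _ [set x] (bicore S x y) (fun A => #|A|) bicore1) => A cA Amax.
by exists A; split=> // A' /Amax.
Qed.

Section Max.
Variable A : {set V}.
Hypothesis cA : bicore S x y A.
Hypothesis Amax : forall A', bicore S x y A' -> #|A'| <= #|A|.
Let xA : x \in A. Proof. by have /and3P[] := cA. Qed.
Let AS : A \subset S :\ y. Proof. by have /and3P[] := cA. Qed.
Let AB : #|A| <= #|common S y A|. Proof. by have /and3P[] := cA. Qed.
Let AT a t : a \in A -> t \in common S y A -> e a t.
Proof. by move=> aA /in_common[_ _]; apply. Qed.

(** A vertex seeing more than |A| common neighbours could be added to A. *)
Lemma max_common u : u \in S -> u != y -> u \notin A -> #|nbrs e (common S y A) u| <= #|A|.
Proof.
move=> uS uy uA; rewrite leqNgt; apply/negP => lt.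
suff /Amax : bicore S x y (u |: A) by rewrite cardsU1 uA add1n ltnn.
apply/and3P; split.
- by rewrite in_setU1 xA orbT.
- by rewrite subUset AS sub1set in_setD1 uy uS.
rewrite cardsU1 uA add1n; apply: leq_trans lt (subset_leq_card _).
apply/subsetP => b; rewrite in_nbrs => /andP[/in_common[bS by_ bA] ub]; apply/in_common.
by split=> // a /setU1P[->|/bA].
Qed.

Lemma max_nbrsA u : u \in S -> u != y -> u \notin common S y A -> #|nbrs e A u| <= #|A|.-1.
Proof.
move=> uS uy uB; have A0 : 0 < #|A| by apply/card_gt0P; exists x.
rewrite -ltnS prednK //; apply: proper_card; rewrite properEneq; apply/andP; split; last first.
  by apply/subsetP => w; rewrite in_nbrs => /andP[].
apply: contraNN uB => /eqP eN; apply/in_common; split=> // a.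
by rewrite -eN in_nbrs es => /andP[].
Qed.

Lemma disjoint_common a : a \in A -> a \notin common S y A.
Proof. by move=> aA; apply/negP => aB; have := AT aA aB; rewrite ei. Qed.

Lemma bip_sub : x |: (common S y A :|: A :\ x) \subset S :\ y.
Proof.
rewrite bip_set // subUset AS andbT; apply/subsetP => b /in_common[bS by_ _].
by rewrite in_setD1 by_.
Qed.

Lemma bicore_uniform1 A' T f : x \in A' -> A' \subset A -> T \subset common S y A ->
  f <= #|T| -> f <= #|A'| -> progression (uniform_len e (x |: (T :|: A' :\ x)) x T) f.
Proof.
move=> xA' A'A TB fT fA; apply: uniform_len_bip => //.
- by rewrite !inE eqxx.
- by move=> t /(subsetP TB); apply: AT.
- by move=> a t; rewrite in_setD1 => /andP[_ /(subsetP A'A) aA] /(subsetP TB); apply: AT.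
- by rewrite (cardsD1 x A') xA' in fA.
Qed.

Lemma bicore_uniform2 A' T : x \in A' -> A' \subset A -> T \subset common S y A ->
  #|A'| <= #|T| -> progression (uniform_len e (x |: (T :|: A' :\ x)) x (A' :\ x)) (maxn 1
    #|A'|.-1).
Proof.
move=> xA' A'A TB AT'; have cA' : #|A'|.-1 = #|A' :\ x| by rewrite (cardsD1 x A') xA'.
have [A0|A0] := posnP #|A' :\ x|.
  by move/eqP: A0; rewrite cards_eq0 => /eqP ->; apply: uniform_len_set0.
have -> : maxn 1 #|A'|.-1 = #|A' :\ x| by rewrite cA'; apply/maxn_idPr.
apply: uniform_len_bip2 => //.
- by rewrite !inE eqxx.
- by move=> t /(subsetP TB); apply: AT.
- by move=> a t; rewrite in_setD1 => /andP[_ /(subsetP A'A) aA] /(subsetP TB); apply: AT.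
- by rewrite -cA'; apply: leq_trans (leq_pred _) AT'.
Qed.

Hypothesis Sn : #|S| <= n.+1.

(** The numbers of lengths are |A| to the common neighbours and |A| - 1, but at least 1, to the rest
    of A. *)
Lemma bicore_nbrs : nbrs e S y \subset common S y A :|: A.
Proof.
set B := common S y A; have BN : B \subset nbrs e S x := common_nbrs xA.
have A0 : 0 < #|A| by apply/card_gt0P; exists x.
have xB : x \notin B := disjoint_common xA.
have Bn : B != set0 by rewrite -card_gt0; apply: leq_trans A0 AB.
have fl : progression (uniform_len e (x |: (B :|: A :\ x)) x B) #|A| by apply: bicore_uniform1.
have fl2 : progression (uniform_len e (x |: (B :|: A :\ x)) x (A :\ x)) (maxn 1 #|A|.-1) by
  apply: bicore_uniform2.
have g0 : 0 < maxn 1 #|A|.-1 by rewrite leq_max.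
have outH u : u \notin x |: (B :|: A :\ x) -> u \notin B /\ u \notin A.
  by rewrite bip_set // in_setU negb_or => /andP.
have l1 u : u \in S -> u != y -> u \notin x |: (B :|: A :\ x) ->
    #|nbrs e (x |: (B :|: A :\ x)) u| <= #|A|.-1 + adj_to e B u.
  by move=> uS uy /outH[uB uA]; apply: bip_loss1 => //; [exact: max_common|exact: max_nbrsA].
rewrite -(@bip_set A B xA).
(* For |A| = 2 the second loss bound fails at vertices that see x, so a dangling part avoiding x has
   to be found. *)
have [A2|A2] := eqVneq #|A| 2; last first.
  apply: (core_nbrs IH ce Sn bip_sub xB Bn A0 g0 fl fl2 l1).
  move=> u uS uy /outH[uB uA] tu; apply: bip_loss2 => //; first exact: max_nbrsA.
  by move=> h; rewrite h eqxx in A2.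
have [a Aa] : exists a, A :\ x = [set a].
  by apply/cards1P; move: A2; rewrite (cardsD1 x A) xA => /eqP.
have hH : exists2 h, h \in x |: (B :|: A :\ x) & h != x.
  exists a; first by rewrite Aa !inE eqxx !orbT.
  by have : a \in A :\ x by [rewrite Aa set11]; rewrite in_setD1 => /andP[].
have rg := region_ce ce (setU11 _ _) hH bip_sub.
have [/eqP C0|Cn] := boolP (reach e (S :\: (x |: (B :|: A :\ x))) y :\ y == set0).
  exact: (nbrs_trivial_reach ce bip_sub C0).
case: (ce_noAP ce); apply: path_progression_sub (sub_reach e bip_sub (r_y R)) (leqnn k) _.
have Csz := reach_size ce Sn (setU11 _ _) hH bip_sub.
have yX : y \in S :\: (x |: (B :|: A :\ x)).
  by rewrite in_setD (r_y R) andbT; apply/negP => /(subsetP bip_sub); rewrite in_setD1 eqxx.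
have inX u : u \in reach e (S :\: (x |: (B :|: A :\ x))) y :\ y ->
    [/\ u \in S, u != y & u \notin x |: (B :|: A :\ x)].
  by rewrite in_setD1 => /andP[uy /(subsetP (reach_sub e yX))]; rewrite in_setD => /andP[].
have P j : paths_upto #|reach e (S :\: (x |: (B :|: A :\ x))) y|.+1 j (set0 : {set V}).
  exact: paths_upto_le Csz (@IH j).
have TH : B \subset x |: (B :|: A :\ x) by apply: subset_trans (subsetUl _ _) (subsetUr _ _).
have T2H : A :\ x \subset x |: (B :|: A :\ x) by apply: subset_trans (subsetUr _ _) (subsetUr _
  _).
have [[D [v dD]]|nd] := classic (exists D v, dangling e
    (reach e (S :\: (x |: (B :|: A :\ x))) y) B y D v).
  have [D' [v' [dD' nx]]] : exists D' v',
      dangling e (reach e (S :\: (x |: (B :|: A :\ x))) y) B y D' v' /\ ~~ adj_sets e D' [set x].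
    move: dD hH; rewrite Aa => dD _; apply: (dangling_avoiding_root IH k2 ce Sn _ BN _ _ _ dD).
    - by rewrite -Aa; exact: bip_sub.
    - by have : a \in A :\ x by [rewrite Aa set11]; rewrite in_setD1 => /andP[].
    - apply: disjoint_common; have : a \in A :\ x by rewrite Aa set11.
      by rewrite in_setD1 => /andP[].
    - by rewrite -A2.
  apply: (dangling_paths es ei rg dD' g0 (subxx _) T2H fl2 _ (P _)); last first.
    by rewrite setD0; have [/set0Pn] := dD'.
  move=> u; rewrite setD0 => uD; have [_ DC _ tD _] := dD'.
  have [uS uy /outH[uB uA]] := inX u (subsetP DC u uD).
  apply: bip_loss2 => //.
  - by apply: contraNN tD => tu; apply/exists_inP; exists u.
  - exact: max_nbrsA.
  - move=> _; apply: contraNN nx => ux; apply/adj_setsP; exists u, x.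
    by rewrite set11 es.
apply: (core_paths es ei rg A0 TH fl _ (P _)); rewrite ?setD0.
- by move=> u /inX[uS uy uH]; apply: l1.
- by apply/set0Pn.
- by move=> D v dD; apply: nd; exists D, v.
Qed.
End Max.
End Fixed.

(** A and its common neighbours are completely joined and y lies in no triangle, so the neighbours
    of y lie on one side. The side A is refuted by a maximal core at y. *)
Lemma bip_nbrs S x y A : counterexample k e S x y -> #|S| <= n.+1 ->
  triangle_free_at e S x -> triangle_free_at e S y -> pair_free S x y -> pair_free S y x ->
  bicore S x y A -> (forall A', bicore S x y A' -> #|A'| <= #|A|) ->
  nbrs e S y \subset common S y A.
Proof.
move=> ce Sn tfx tfy pfx pfy cA Amax; have R := ce_rooted ce; have es := r_sym R; have ei :=
  r_irr R.
have ce' := counterexample_sym ce.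
have dich x0 y0 A0 : counterexample k e S x0 y0 -> triangle_free_at e S x0 ->
    triangle_free_at e S y0 -> pair_free S x0 y0 ->
    bicore S x0 y0 A0 -> (forall A', bicore S x0 y0 A' -> #|A'| <= #|A0|) ->
    nbrs e S y0 \subset common S y0 A0 \/ nbrs e S y0 \subset A0 :\ x0.
  move=> ce0 tf0 tf0' pf0 c0 m0; have N0 := bicore_nbrs ce0 tf0 pf0 c0 m0 Sn.
  have [h|/subsetPn[w wN wB]] := boolP (nbrs e S y0 \subset common S y0 A0); [by left|right].
  have R0 := ce_rooted ce0.
  have wA : w \in A0 by have := subsetP N0 w wN; rewrite in_setU (negbTE wB).
  have nx v : v \in nbrs e S y0 -> v != x0.
    by rewrite in_nbrs es => /andP[_]; apply: contraTneq => ->; rewrite (r_nxy R0).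
  apply/subsetP => v vN; rewrite in_setD1 nx //=; have := subsetP N0 v vN.
  rewrite in_setU => /orP[vB|//]; move: vN wN; rewrite !in_nbrs => /andP[vS yv] /andP[wS yw].
  have /in_common[_ _ /(_ w wA) wv] := vB.
  by have := tf0' w v wS vS yw yv; rewrite wv.
have [//|NA] := dich x y A ce tfx tfy pfx cA Amax.
have [A' [cA' A'max]] := max_bicore ce'.
have [xA AS AB] := and3P cA; have [yA' AS' AB'] := and3P cA'.
have A0 : 0 < #|A| by apply/card_gt0P; exists x.
have le1 := subset_leq_card (common_nbrs S x yA'); have le2 := subset_leq_card NA.
have cAx : #|A| = #|A :\ x|.+1 by rewrite (cardsD1 x A) xA.
(* If N(x) lies on the common side of A', it is contained in N(y) and hence in A, so a common
   neighbour of A would see itself. Otherwise |A| <= |N(x)| < |A'| <= |N(y)| < |A|. *)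
have [NB'|NA'] := dich y x A' ce' tfy tfx pfy cA' A'max.
  have [b bB] : exists b, b \in common S y A by apply/card_gt0P; apply: leq_trans A0 AB.
  have bA : b \in A.
    have := subsetP (common_nbrs S y xA) b bB => /(subsetP NB') /(subsetP (common_nbrs S x yA')).
    by move=> /(subsetP NA); rewrite in_setD1 => /andP[].
  by have /in_common[_ _ /(_ b bA)] := bB; rewrite ei.
have le3 := subset_leq_card NA'; have le4 := subset_leq_card (common_nbrs S y xA).
have cAy : #|A'| = #|A' :\ y|.+1 by rewrite (cardsD1 y A') yA'.
by move: AB AB' le1 le2 le3 le4; rewrite cAx cAy; clear; lia.
Qed.
End Bip.

(** * Twin roots *)

Section Endgame.
Variables (V : finType) (e : rel V) (n k : nat).
Hypothesis IH : forall j, paths_upto n j (set0 : {set V}).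
Hypothesis k2 : 2 < k.
Implicit Types (A B C D E H K S T W X Y Z : {set V}) (a b c t u v w x y z : V) (p q s : seq V).

Section Twins.
Variables (S : {set V}) (x y : V) (B : {set V}).
Hypothesis ce : counterexample k e S x y.
Hypothesis Sn : #|S| <= n.+1.
Hypotheses (NxB : nbrs e S x = B) (NyB : nbrs e S y = B).
Let R := ce_rooted ce.
Let es := r_sym R.
Let ei := r_irr R.

Lemma twin_nbr b : b \in B -> [/\ b \in S :\: [set x; y], e x b & e b y].
Proof.
move=> bB; split.
- by rewrite -NxB in bB; apply: (subsetP (nbrs_root R)).
- by move: bB; rewrite -NxB in_nbrs => /andP[].
- by move: bB; rewrite -NyB in_nbrs es => /andP[].
Qed.

Lemma twin_noroot u : u \in S -> u \notin B -> ~~ e u x.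
Proof. by move=> uS; rewrite -NxB in_nbrs uS es. Qed.

End Twins.

(** Dropping w from the clique frees a target. Vertices outside do not see x, so they lose at most
    |K| - 1 neighbours, and the contraction restores one. *)
Lemma clique_twins S x y K : counterexample k e S x y -> #|S| <= n.+1 ->
  nbrs e S x = K -> nbrs e S y = K -> clique e K -> 1 < #|K| -> False.
Proof.
move=> ce Sn Nx Ny cK K2; have R := ce_rooted ce; have es := r_sym R; have ei := r_irr R.
have nb b : b \in K -> [/\ b \in S :\: [set x; y], e x b & e b y] := twin_nbr ce Nx Ny (b:=b).
have xK : x \notin K by apply/negP => /nb[]; rewrite !inE eqxx.
have K0 : 0 < #|K| by apply: ltnW.
have [w wK] : exists w, w \in K by apply/card_gt0P.
have HK : x |: K \subset S :\ y.
  apply/subsetP => a /setU1P[->|/nb[]]; first by rewrite in_setD1 (r_xy R) (r_x R).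
  by rewrite (inI S x y) in_setD1 => /and3P[_ -> ->].
have xKe a : a \in K -> e x a by case/nb.
have Kk : #|K| < k.
  have [_ _ wy] := nb w wK.
  exact: direct_paths ce HK (setU11 _ _) K0 (uniform_len_clique es cK xK xKe) wK wy.
have [wI xw wy] := nb w wK.
(* At most |K| + 1 <= k neighbours of w are among x, y and the rest of K, fewer than its degree. *)
have [u0 uN uo] : exists2 u, u \in nbrs e S w & u \notin x |: (y |: K :\ w).
  apply/subsetPn/negP => /subset_leq_card; rewrite !cardsU1.
  have : k < #|nbrs e S w| by apply: (r_deg R); rewrite setD0.
  move: Kk; rewrite (cardsD1 w K) wK.
  by case: (_ \notin _); case: (_ \notin _); clear => /=; lia.
move: uN uo; rewrite in_nbrs !in_setU1 !negb_or => /andP[u0S ewu] /and3P[u0x u0y u0K].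
have Ksub : x |: (K :\ w :|: set0) \subset S :\ y.
  by rewrite setU0; apply: subset_trans HK; apply: setUS; apply: subD1set.
have cK' : clique e (K :\ w).
  apply/cliqueP => a b; rewrite !in_setD1 => /andP[_ aK] /andP[_ bK].
  exact: (cliqueP _ _ cK).
have xK' : x \notin K :\ w by rewrite in_setD1 (negbTE xK) andbF.
have cKw : #|K| = #|K :\ w|.+1 by rewrite (cardsD1 w K) wK.
have fl : progression (uniform_len e (x |: (K :\ w :|: set0)) x (K :\ w)) #|K :\ w|.
  by rewrite setU0; apply: uniform_len_clique => // a; rewrite in_setD1 => /andP[_ /xKe].
have f0 : 0 < #|K :\ w| by move: K2; rewrite cKw.
have loss u : u \in S -> u != w -> u \notin x |: (K :\ w :|: set0) ->
    #|nbrs e (x |: (K :\ w :|: set0)) u| <= #|nbrs e (K :\ w) u|.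
  move=> uS uw; rewrite setU0 in_setU1 in_setD1 uw negb_or => /andP[ux uK].
  apply: leq_trans (card_nbrsU _ _ _ _) _; rewrite card_nbrs1.
  by rewrite (negbTE (twin_noroot ce Nx uS uK)).
apply: (@core_endgame _ e n k IH k2 S x y w u0 (K :\ w) set0 #|K :\ w| 1 ce Sn Ksub wI) => //.
- by rewrite setU0 in_setU1 in_setD1 eqxx orbF; move: wI; rewrite (inI S x y) => /andP[].
- rewrite Ny setU0; apply/subsetP => a aK; rewrite !inE aK andbT.
  by case: (a == w); rewrite ?orbT.
- by rewrite setU0 in_setU1 negb_or u0x.
- exact: uniform_len_set0.
- move=> u uS uy uw uH; apply: leq_trans (loss u uS uw uH) _; rewrite adj_toE // -card_gt0.
  have : #|nbrs e (K :\ w) u| <= #|K :\ w|.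
    by apply: subset_leq_card; apply/subsetP => a; rewrite in_nbrs => /andP[].
  by move: #|nbrs e (K :\ w) u| #|K :\ w| f0 => [|m] f /=; clear; lia.
- move=> u uS uy uw uH; rewrite adj_toE // negbK => /eqP N0.
  by apply: leq_trans (loss u uS uw uH) _; rewrite N0 cards0.
Qed.

(** The core is the edge from x to b1, with one length. Other vertices see at most b1 of it, which
    becomes the contracted vertex, and k >= 3 gives b2 a further neighbour. *)
Lemma pair_twins S x y b1 b2 : counterexample k e S x y -> #|S| <= n.+1 -> b1 != b2 ->
  nbrs e S x = [set b1; b2] -> nbrs e S y = [set b1; b2] -> False.
Proof.
move=> ce Sn b12 Nx Ny; have R := ce_rooted ce; have es := r_sym R; have ei := r_irr R.
have nb b : b \in [set b1; b2] -> [/\ b \in S :\: [set x; y], e x b & e b y] := twin_nbr ce Nx Ny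
  (b:=b).
have [b1I xb1 b1y] := nb b1 (set21 _ _); have [b2I xb2 b2y] := nb b2 (set22 _ _).
move: (b1I) (b2I); rewrite !(inI S x y) => /and3P[b1x b1ny b1S] /and3P[b2x b2ny b2S].
have [u0 uN uo] : exists2 u, u \in nbrs e S b2 & u \notin [set x; y; b1].
  apply/subsetPn/negP => /subset_leq_card.
  have : k < #|nbrs e S b2| by apply: (r_deg R); rewrite setD0.
  have : #|[set x; y; b1]| <= 3.
    by rewrite -setUA !cardsU1 cards1; case: (_ \notin _); case: (_ \notin _).
  by move: k2; clear; lia.
move: uN uo; rewrite in_nbrs !inE !negb_or => /andP[u0S eu] /andP[/andP[u0x u0y] u0b].
have HS : x |: ([set b1] :|: set0) \subset S :\ y.
  by rewrite setU0 subUset !sub1set !in_setD1 (r_xy R) (r_x R) b1ny b1S.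
have fl : progression (uniform_len e (x |: ([set b1] :|: set0)) x [set b1]) 1.
  apply: uniform_len_bip => //; rewrite ?cards1 ?inE //; first by move=> t /set1P ->.
  by move=> a t; rewrite in_set0.
have loss u : u \in S -> u != b2 -> u \notin x |: ([set b1] :|: set0) ->
    #|nbrs e (x |: ([set b1] :|: set0)) u| <= e u b1.
  move=> uS ub2; rewrite setU0 in_setU1 inE negb_or => /andP[ux ub1].
  apply: leq_trans (card_nbrsU _ _ _ _) _; rewrite !card_nbrs1.
  by rewrite (negbTE (twin_noroot ce Nx uS _)) // !inE negb_or ub1.
apply: (@core_endgame _ e n k IH k2 S x y b2 u0 [set b1] set0 1 1 ce Sn HS b2I) => //.
- by rewrite setU0 !inE negb_or b2x eq_sym.
- by rewrite Ny setU0; apply/subsetP => a /set2P[] ->; rewrite !inE eqxx ?orbT.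
- by rewrite setU0 !inE negb_or u0x.
- exact: uniform_len_set0.
- by move=> u uS uy uw uH; rewrite adj_to1 es; exact: loss.
- move=> u uS uy uw uH; rewrite adj_to1 es => h.
  by apply: leq_trans (loss u uS uw uH) _; rewrite (negbTE h).
Qed.

Lemma bip_twins S x y A : counterexample k e S x y -> #|S| <= n.+1 ->
  triangle_free_at e S x -> pair_free e S x y ->
  bicore e S x y A -> (forall A', bicore e S x y A' -> #|A'| <= #|A|) ->
  nbrs e S x = common e S y A -> nbrs e S y = common e S y A -> False.
Proof.
move=> ce Sn tfx pfx cA Amax Nx Ny; have R := ce_rooted ce; have es := r_sym R; have ei := r_irr
  R.
have [xA AS AB] := and3P cA.
have xB := disjoint_common ce xA.
have AT a t : a \in A -> t \in common e S y A -> e a t by move=> aA /in_common[_ _]; apply.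
have mc := max_common cA Amax.
have subH := bip_sub cA; have fl1 := bicore_uniform1 ce (A := A); have fl2 := bicore_uniform2 ce
  (A := A).
have dA := @disjoint_common _ _ _ _ _ _ ce A.
have B2 : 1 < #|common e S y A| by rewrite -Ny; apply: (ce_root_card k2 ce).
have [B BE] : exists B, common e S y A = B by exists (common e S y A).
rewrite BE in AB AT xB mc subH fl1 fl2 dA B2 Nx Ny.
have nb b : b \in B -> [/\ b \in S :\: [set x; y], e x b & e b y] := twin_nbr ce Nx Ny (b:=b).
have A0 : 0 < #|A| by apply/card_gt0P; exists x.
have [w wB] : exists w, w \in B by apply/card_gt0P; apply: ltnW.
have [wI xw wy] := nb w wB.
move: (wI); rewrite (inI S x y) => /and3P[wx wny wS].
have cB : #|B| = #|B :\ w|.+1 by rewrite (cardsD1 w B) wB.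
(* Without w the common side may have become smaller than A, so A is cut down to the same size if
   necessary. *)
have [A' [xA' A'A A's A'm]] : exists A', [/\ x \in A', A' \subset A, #|A'| <= #|B :\ w| &
    #|A'| = #|B :\ w| \/ A' = A].
  have [le|lt] := leqP #|A| #|B :\ w|; first by exists A; split=> //; right.
  have [s [us sA ss]] : exists s, [/\ uniq s, {subset s <= A :\ x} & size s = #|B :\ w|.-1].
    by apply: exists_seq; move: lt; rewrite (cardsD1 x A) xA; clear; lia.
  have xs : x \notin s by apply/negP => /sA; rewrite !inE eqxx.
  have c : #|x |: [set a in s]| = #|B :\ w|.
    rewrite cardsU1 inE xs /= cardsE; have /card_uniqP -> := us; rewrite ss.
    by move: B2; rewrite cB; clear; lia.
  exists (x |: [set a in s]); split; first exact: setU11.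
  - rewrite subUset sub1set xA; apply/subsetP => a; rewrite inE => /sA.
    by rewrite in_setD1 => /andP[].
  - by rewrite c.
  - by left.
have A'0 : 0 < #|A'| by apply/card_gt0P; exists x.
have TB : B :\ w \subset B by apply: subD1set.
have HS : x |: (B :\ w :|: A' :\ x) \subset S :\ y.
  apply: subset_trans subH; apply: setUS; apply: setUSS => //; exact: setSD.
have ft : progression (uniform_len e (x |: (B :\ w :|: A' :\ x)) x (B :\ w)) #|A'|.
  by apply: fl1.
have ft2 : progression (uniform_len e (x |: (B :\ w :|: A' :\ x)) x (A' :\ x)) (maxn 1 #|A'|.-1).
  by apply: fl2.
have [t tT] : exists t, t \in B :\ w by apply/card_gt0P; move: B2; rewrite cB.
have A'k : #|A'| < k.
  have [_ _ ty] := nb t (subsetP TB t tT).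
  exact: direct_paths ce HS (setU11 _ _) A'0 ft tT ty.
have wA' : w \notin A' by apply/negP => /(subsetP A'A)/dA; rewrite wB.
have [u0 uN uo] : exists2 u, u \in nbrs e S w & u \notin y |: A'.
  apply/subsetPn/negP => /subset_leq_card; rewrite cardsU1.
  have : k < #|nbrs e S w| by apply: (r_deg R); rewrite setD0.
  by move: A'k; case: (_ \notin _); clear => /=; lia.
move: uN uo; rewrite in_nbrs in_setU1 negb_or => /andP[u0S ewu] /andP[u0y u0A].
have u0B : u0 \notin B.
  rewrite -Nx in_nbrs u0S; apply/negP => xu0.
  by have := tfx w u0 wS u0S xw xu0; rewrite ewu.
have outH u : u != w -> u \notin x |: (B :\ w :|: A' :\ x) -> u \notin B /\ u \notin A'.
  by move=> uw; rewrite bip_set // in_setU in_setD1 uw negb_or => /andP.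
have AS' : A' \subset S :\ y by apply: subset_trans A'A AS.
have TN : B :\ w \subset nbrs e S x by rewrite Nx.
have AT' a b : a \in A' -> b \in B :\ w -> e a b.
  by move=> /(subsetP A'A) aA /(subsetP TB); apply: AT.
(* If A was cut down, the size of B :\ w is bound enough; otherwise the maximality of A gives the
   bound. *)
have nbT u : u \in S -> u != y -> u \notin B -> u \notin A' -> #|nbrs e (B :\ w) u| <= #|A'|.
  move=> uS uy uB uA; case: A'm => [->|eA].
    by apply: subset_leq_card; apply/subsetP => a; rewrite in_nbrs => /andP[].
  rewrite eA in uA *; apply: leq_trans (mc u uS uy uA); apply: subset_leq_card.
  by apply/subsetP => a; rewrite !in_nbrs in_setD1 => /andP[/andP[_ ->]].
have nbA u : u \in S -> u \notin B -> #|nbrs e A' u| <= #|A'|.-1.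
  by move=> uS uB; apply: (nbrsA_le xA'); apply: (twin_noroot ce Nx uS uB).
apply: (@core_endgame _ e n k IH k2 S x y w u0 (B :\ w) (A' :\ x) #|A'| (maxn 1 #|A'|.-1) ce Sn
  HS wI) => //.
- by rewrite bip_set // in_setU in_setD1 eqxx.
- rewrite Ny bip_set //; apply/subsetP => a aB; rewrite in_setU1 in_setU in_setD1 aB andbT.
  by case: (a == w).
- by rewrite bip_set // in_setU in_setD1 negb_or u0A (negbTE u0B) andbF.
- by rewrite leq_max.
- move=> u uS uy uw /(outH u uw)[uB uA].
  by apply: (bip_loss1 ce tfx pfx) => //; [exact: nbT|exact: nbA].
- move=> u uS uy uw /(outH u uw)[uB uA] tu.
  by apply: (bip_loss2 ce) => //; [exact: nbA|move=> _; exact: (twin_noroot ce Nx uS uB)].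
Qed.

(** A triangle at x gives y two adjacent neighbours, so [triangle_nbrs] applies at y too. The
    inclusions N(y), K, N(x), K', N(y) close up, which makes x and y twins over a clique. *)
Lemma no_triangle S x y : counterexample k e S x y -> #|S| <= n.+1 -> triangle_free_at e S x.
Proof.
move=> ce Sn u w uS wS xu xw; apply/negP => uw; have R := ce_rooted ce; have es := r_sym R.
have [K [cK K2 KN NK]] := triangle_nbrs IH ce Sn uS wS xu xw uw.
have ce' := counterexample_sym ce.
have /card_gt1P[a [b [aN bN ab]]] := ce_root_card k2 ce.
have eab : e a b by apply: (cliqueP _ _ cK) ab; apply: (subsetP NK).
move: aN bN; rewrite !in_nbrs => /andP[aS ya] /andP[bS yb].
have [K' [cK' K2' KN' NK']] := triangle_nbrs IH ce' Sn aS bS ya yb eab.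
have Ny : nbrs e S y = K.
  by apply/eqP; rewrite eqEsubset NK (subset_trans KN (subset_trans NK' KN')).
have Nx : nbrs e S x = K.
  by apply/eqP; rewrite eqEsubset KN andbT -Ny (subset_trans NK' KN').
exact: clique_twins ce Sn Nx Ny cK K2.
Qed.

(** The pair at x forces N(y) = {b1, b2}; it then serves at y as well and makes x and y twins. *)
Lemma no_pair S x y : counterexample k e S x y -> #|S| <= n.+1 -> pair_free e S x y.
Proof.
move=> ce Sn b1 b2 a1 a2 b12 b1N b2N a12; apply/negP => ea12.
have ce' := counterexample_sym ce.
have tfx := no_triangle ce Sn; have tfy := no_triangle ce' Sn.
have Ny := pair_nbrs IH k2 ce Sn tfx tfy b12 b1N b2N a12 ea12.
have Nx : nbrs e S x = [set b1; b2].
  apply: (pair_nbrs IH k2 ce' Sn tfy tfx b12 _ _ _ ea12); rewrite ?Ny ?set21 ?set22 //.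
  by rewrite [[set y; x]]setUC.
exact: pair_twins ce Sn b12 Nx Ny.
Qed.

Lemma no_counterexample S x y : #|S| <= n.+1 -> ~ counterexample k e S x y.
Proof.
move=> Sn ce; have ce' := counterexample_sym ce.
have tfx := no_triangle ce Sn; have tfy := no_triangle ce' Sn.
have pfx := no_pair ce Sn; have pfy := no_pair ce' Sn.
have [A [cA Amax]] := max_bicore k2 ce; have [A' [cA' Amax']] := max_bicore k2 ce'.
have NA := bip_nbrs IH k2 ce Sn tfx tfy pfx pfy cA Amax.
have NA' := bip_nbrs IH k2 ce' Sn tfy tfx pfy pfx cA' Amax'.
have [xA _ _] := and3P cA; have [yA' _ _] := and3P cA'.
have sub := common_nbrs e S y xA; have sub' := common_nbrs e S x yA'.
have Ny : nbrs e S y = common e S y A.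
  by apply/eqP; rewrite eqEsubset NA (subset_trans sub (subset_trans NA' sub')).
have Nx : nbrs e S x = common e S y A.
  by apply/eqP; rewrite eqEsubset sub andbT -Ny (subset_trans NA' sub').
exact: bip_twins ce Sn tfx pfx cA Amax Nx Ny.
Qed.
End Endgame.

(** * The induction for admissible paths *)

Lemma rooted_path (V : finType) k (Z : {set V}) e S x y : rooted k Z e S x y -> path_progression
  e 1 S x y.
Proof.
move=> R; have es := r_sym R; have ei := r_irr R.
have In : S :\: [set x; y] != set0.
  by have [u] := r_ne R; rewrite in_setD => /andP[_ uI]; apply/set0Pn; exists u.
have xb : x \in boundary e S (S :\: [set x; y]).
  have := r_bd R In (subxx _); apply: contraTT => xb; rewrite -leqNgt -(cards1 y).
  apply: subset_leq_card; apply/subsetP => w wb; have /boundaryP[_ [_ _ wS]] := wb.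
  rewrite in_setD wS andbT negbK !inE => /orP[/eqP wx|//].
  by move: xb; rewrite -{1}wx wb.
have /boundaryP[u [uI eux _ _]] := xb; move: uI; rewrite (inI S x y) => /and3P[ux uy uS].
have bd0 : boundary e S set0 = set0.
  by apply/setP => v; rewrite in_set0; apply/negP => /boundaryP[a []]; rewrite in_set0.
have [p [pp pu ps pl]] : exists p, spath e (S :\ x) u p y.
  rewrite -[S]setD0; apply: (rooted_tail R) => //; rewrite ?sub0set ?bd0 ?setD0 //.
  exact: sub0set.
have xp : x \notin u :: p.
  by rewrite inE negb_or eq_sym ux; apply/negP => /ps; rewrite !inE eqxx.
apply: (@path_progression1 _ _ _ _ (u :: p)); split.
- by rewrite /= es eux.
- by rewrite cons_uniq xp.
- by move=> w; rewrite inE => /orP[/eqP->//|/ps]; rewrite in_setD1 => /andP[].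
- exact: pl.
Qed.

Theorem admissible_paths (V : finType) n k : paths_upto n k (set0 : {set V}).
Proof.
elim: n k => [|n IH] k e S x y Sn R.
  by have := r_x R; move: Sn; rewrite leqn0 cards_eq0 => /eqP ->; rewrite inE.
(* The count 2 (k - 1) - 1 >= k behind [three_cut_paths] needs k > 2. *)
have [k2|k2] := ltnP 2 k; last first.
  case: k k2 R => [|[|[|//]]] _ R.
  - by exists 0, 1; split; [left|].
  - exact: rooted_path R.
  - by apply: (two_paths _ Sn R); rewrite cards0.
have k0 : 0 < k by apply: leq_trans k2.
apply: NNPP => nA; apply: (@no_counterexample _ e n k IH k2 S x y Sn).
have cut x0 y0 (R0 : rooted k set0 e S x0 y0) : ~ path_progression e k S x0 y0 -> nocut e S x0 y0
  x0.
  move=> nA0 D Dn Dp; rewrite ltnNge; apply/negP => b1; apply: nA0.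
  by apply: (two_cut_paths R0 (IH k) Sn k0 Dn Dp _ b1); rewrite setD0; apply/set0Pn.
split=> //; first exact: (cut _ _ R nA).
apply: nocut_sym; apply: (cut _ _ (rooted_sym R)) => A; apply: nA.
exact: path_progression_rev (r_sym R) (r_y R) A.
Qed.

(** * Cycles through a 2-cut *)

Lemma min_degree_le (G : sgraph) (x : G) : min_degree G <= degree x.
Proof.
have : x \in index_enum (vertex G) by exact: mem_index_enum.
rewrite /min_degree; elim: (index_enum _) => // a s IH.
rewrite inE big_cons geq_min => /orP[/eqP->|/IH ->]; by rewrite ?leqnn ?orbT.
Qed.

(** No edge is traversed back, which is why a cycle has as many edges as vertices. *)
Lemma next_next (T : eqType) (c : seq T) x : uniq c -> 2 < size c -> x \in c -> next c (next c x)
  != x.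
Proof.
move=> uc sc xc; have [i s rs] := rot_to xc; rewrite -!(next_rot i uc).
have : uniq (rot i c) by rewrite rot_uniq.
have : 2 < size (rot i c) by rewrite size_rot.
rewrite rs; case: s {rs} => [|a [|b s]] //= _; rewrite !inE !negb_or eqxx.
case/andP=> /and3P[xa xb _] _.
by rewrite [a == x]eq_sym (negbTE xa) eqxx eq_sym xb.
Qed.

Lemma card_cycle_edges (G : sgraph) (c : seq G) : is_cycle c -> #|cycle_edges c| = size c.
Proof.
case/andP=> sc /andP[_ uc]; rewrite /cycle_edges card_in_imset; first exact/card_uniqP.
move=> x y xc yc exy; apply/eqP; apply: contraT => xy.
have : x \in [set y; next c y] by rewrite -exy set21.
rewrite in_set2 (negbTE xy) => /eqP xny.
have : y \in [set x; next c x] by rewrite exy set21.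
rewrite in_set2 eq_sym (negbTE xy) => /eqP ynx.
by have := next_next uc sc xc; rewrite -ynx -xny eqxx.
Qed.

Section Sides.
Variables (G : sgraph) (k : nat).
Hypothesis G_2conn : nconnected 2 G.
Hypothesis G_mindeg : k < min_degree G.
Let es : symmetric (@adj G) := @adj_sym G.
Let ei : irreflexive (@adj G) := @adj_irr G.

(** Removing the boundary separates d from w, so it cannot consist of fewer than two vertices. *)
Lemma boundary_gt1 (D : {set G}) d w : d \in D -> w \notin D -> w \notin boundary (@adj G) setT D
  ->
  1 < #|boundary (@adj G) setT D|.
Proof.
move=> dD wD wb; rewrite ltnNge; apply/negP => b1.
have /andP[_ /forallP/(_ (boundary (@adj G) setT D))] := G_2conn.
rewrite ltnS b1 /= => /forall_inP/(_ d) h.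
have dC : d \in ~: boundary (@adj G) setT D.
  by rewrite in_setC; apply/negP => /boundaryP[_ [_ _ _]]; rewrite dD.
have wC : w \in ~: boundary (@adj G) setT D by rewrite in_setC.
have /forall_inP/(_ w wC) cn := h dC.
have cl : closed (induced_adj (~: boundary (@adj G) setT D)) (mem D).
  have half a b : induced_adj (~: boundary (@adj G) setT D) a b -> a \in D -> b \in D.
    case/and3P=> _ bC eab aD; apply: contraT => bD; move: bC; rewrite in_setC => /negP[].
    by apply/boundaryP; exists a.
  move=> a b h'; apply/idP/idP; first exact: half.
  by apply: half; move: h'; rewrite /induced_adj /= es andbCA.
by have := closed_connect cl cn; rewrite /= [d \in _]dD [w \in _](negbTE wD).
Qed.

(** Contracting x alone deletes a possible edge xy and so makes all lengths exceed 1. The vertex w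
    on another side lets [boundary_gt1] apply to every set inside this one. *)
Lemma side_paths (x y u w : G) : x != y -> u \notin [set x; y] -> w \notin [set x; y] ->
  w \notin reach (@adj G) (~: [set x; y]) u ->
  progression (fun a => 1 < a /\ linked_len (@adj G) (y |: reach (@adj G) (~: [set x; y]) u) [set
    x] y a) k.
Proof.
move=> xy uxy wxy wD.
have uX : u \in ~: [set x; y] by rewrite in_setC.
have DX := reach_sub (@adj G) uX.
have step a b : a \in reach (@adj G) (~: [set x; y]) u -> b \notin [set x; y] -> adj a b ->
    b \in reach (@adj G) (~: [set x; y]) u.
  by move=> aD bxy; apply: reach_step uX aD _; rewrite in_setC.
have uD := reach_refl (@adj G) (~: [set x; y]) u.
have [D DE] : exists D, reach (@adj G) (~: [set x; y]) u = D by exists (reach (@adj G) (~: [set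
  x; y]) u).
rewrite DE in wD DX step uD *.
have xD : x \notin D by apply/negP => /(subsetP DX); rewrite in_setC set21.
have yD : y \notin D by apply/negP => /(subsetP DX); rewrite in_setC set22.
have eD : (y |: D) :\ y = D by rewrite setU1K.
apply: (@contract G _ es ei (y |: D) [set x] y k set0 (@admissible_paths G _ k)).
- exact: setU11.
- by rewrite disjoint_sym disjoints1 in_setU1 negb_or xy.
- by exists u; rewrite eD setD0.
- move=> D2 D2n; rewrite eD => D2D.
  apply: (@sep_of_cut _ _ setT _ _ (boundary (@adj G) setT D2)) => //.
    have [d dD2] := set0Pn _ D2n.
    apply: (boundary_gt1 dD2 (w := w)); first by apply: contraNN wD; apply: (subsetP D2D).
    apply/negP => /boundaryP[a [aD2 eaw _ _]]; case/negP: wD.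
    exact: step (subsetP D2D a aD2) wxy eaw.
  move=> b /boundaryP[a [aD2 eab _ _]] bx; rewrite in_setU1.
  have [//|by_] := eqVneq b y; apply: (step a b (subsetP D2D a aD2) _ eab).
  by rewrite in_set2 negb_or bx by_.
rewrite eD setD0 => a aD; apply: leq_trans (nbrs_le (S := setT) es _).
  apply: leq_trans G_mindeg _; apply: leq_trans (min_degree_le a) _.
  by apply: subset_leq_card; apply/subsetP => b; rewrite !inE.
move=> b _ eab bx; rewrite in_setU1.
have [//|by_] := eqVneq b y; apply: (step a b aD _ eab).
by rewrite in_set2 negb_or bx by_.
Qed.

Lemma cycle_of_paths (x y : G) (D1 D2 : {set G}) a b :
  x \notin D1 -> y \notin D1 -> x \notin D2 -> y \notin D2 -> x != y -> [disjoint D1 & D2] ->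
  1 < a -> 1 < b -> linked_len (@adj G) (y |: D1) [set x] y a -> linked_len (@adj G) (y |: D2)
    [set x] y b ->
  exists c : seq G, is_cycle c /\ size c = a + b.
Proof.
move=> xD1 yD1 xD2 yD2 xy dD a1 b1 /linked_len1[p [pp pu ps pl] spa] /linked_len1[q [qp qu qs ql]
  sqb].
rewrite -spa -sqb in a1 b1 *.
have [q' [q'p q'u q's q'l] sq] : exists2 q', spath (@adj G) (x |: D2) y q' x & size q' = size q.
  have [q' hq' sq'] : exists2 q', spath (@adj G) (x |: (y |: D2)) y q' x & size q' = size q.
    apply: spath_rev es (setU11 _ _) _; split=> // w /qs; rewrite in_setU1 => wD.
    by rewrite in_setU1 in_setU1 wD orbT.
  exists q' => //; have /spath_avoid := hq'; apply: spath_sub.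
  apply/subsetP => w; rewrite in_setD1 !in_setU1 => /andP[/negbTE ->] /=.
  by case: (w == x).
exists (p ++ q'); split; last by rewrite size_cat sq.
have sz : 2 < size (p ++ q').
  by rewrite size_cat sq; move: a1 b1; clear; lia.
apply/and3P; split=> //.
  by rewrite (cycle_path x) last_cat pl q'l cat_path pp pl.
have [xp up] : x \notin p /\ uniq p by apply/andP.
have [yq uq] : y \notin q' /\ uniq q' by apply/andP.
rewrite cat_uniq up uq andbT; apply/hasPn => w wq; apply/negP => wp.
have := ps w wp; have := q's w wq; rewrite !in_setU1.
have -> : (w == x) = false by apply: contraNF xp => /eqP <-.
have -> : (w == y) = false by apply: contraNF yq => /eqP <-.
by move=> /= w2 w1; rewrite (disjointFr dD w1) in w2.
Qed.
End Sides.

(** If both differences are 1, advancing both progressions together adds 2; otherwise one of them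
    has difference 2 and is advanced alone. *)
Lemma progression_step2 (L1 L2 : nat -> Prop) k : progression L1 k -> progression L2 k -> 0 < k ->
  exists l, forall i, i < k -> exists a b, [/\ L1 a, L2 b & a + b = l + 2 * i].
Proof.
move=> [l [d [hd H1]]] [m [c [hc H2]]] k0; exists (l + m) => i ik.
case: hd H1 => -> H1.
  case: hc H2 => -> H2.
    by exists (l + 1 * i), (m + 1 * i); split; auto; clear; lia.
  by exists (l + 1 * 0), (m + 2 * i); split; auto; clear; lia.
by exists (l + 2 * i), (m + c * 0); split; auto; rewrite muln0; clear; lia.
Qed.

Lemma cycles_of_sizes (G : sgraph) k l :
  (forall i, i < k -> exists c : seq G, is_cycle c /\ size c = l + 2 * i) -> 0 < k ->
  exists H : seq (seq G), [/\ size H = k, all (@is_cycle G) H & length_condition H].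
Proof.
move=> h k0.
have [H [sH cH lH]] : exists H : seq (seq G), [/\ size H = k, all (@is_cycle G) H &
    forall i, i < k -> size (nth [::] H i) = l + 2 * i].
  elim: k h {k0} => [|k IH] h; first by exists [::].
  have [|H [sH cH lH]] := IH; first by move=> i ik; apply: h; apply: ltnW.
  have [c [cc sc]] := h k (leqnn _).
  exists (rcons H c); rewrite size_rcons sH all_rcons cc cH; split=> // i.
  rewrite ltnS leq_eqVlt nth_rcons sH => /orP[/eqP ->|ik].
    by rewrite ltnn eqxx.
  by rewrite ik; apply: lH.
have ce i : i < k -> #|cycle_edges (nth [::] H i)| = l + 2 * i.
  by move=> ik; rewrite card_cycle_edges ?lH // (all_nthP [::] cH) // sH.
exists H; split=> //; split.
  rewrite ce // muln0 addn0 -[l]addn0 -(muln0 2) -(lH 0 k0).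
  by have /andP[] := all_nthP [::] cH 0 (eq_ind_r (fun m => 0 < m) k0 sH); clear; lia.
move=> i; rewrite sH => ik; rewrite !ce //; last exact: ltnW.
by clear; lia.
Qed.

Lemma triangle_of_order3 (G : sgraph) : #|G| = 3 -> 1 < min_degree G ->
  exists c : seq G, is_cycle c /\ size c = 3.
Proof.
move=> G3 md; have deg (x : G) : 1 < degree x := leq_trans md (min_degree_le x).
have [x _] : exists x : G, true.
  by have /card_gt0P[x _] : 0 < #|G| by [rewrite G3]; exists x.
have /card_gt1P[y [z []]] := deg x; rewrite !inE => xy xz yz.
exists [:: x; y; z]; split=> //.
have ei := @adj_irr G; have es := @adj_sym G.
have ny : x != y by apply: contraTneq xy => ->; rewrite ei.
have nz : x != z by apply: contraTneq xz => ->; rewrite ei.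
have all3 w : w \in [set x; y; z].
  have /eqP -> : [set x; y; z] == setT; last by rewrite inE.
  by rewrite eqEcard subsetT cardsT G3 -setUA !cardsU1 cards1 !inE negb_or ny nz yz.
have eyz : adj y z.
  have : degree y <= #|[set x] :|: (if adj y z then [set z] else set0)|.
    apply: subset_leq_card; apply/subsetP => w; rewrite inE => eyw.
    have := all3 w; rewrite !inE => /orP[/orP[->//|/eqP wy]|/eqP wz].
      by rewrite wy ei in eyw.
    by rewrite wz in eyw *; rewrite eyw inE eqxx orbT.
  by case: (adj y z) => //; rewrite setU0 cards1 leqNgt deg.
by rewrite /is_cycle /ucycleb /= xy eyz [adj z x]es xz !inE negb_or ny nz yz.
Qed.

Theorem theorem4 (k : nat) (G : sgraph) (k_gt0 : 0 < k)
    (G_2conn : nconnected 2 G) (G_not_3conn : ~~ nconnected 3 G)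
    (G_mindeg : k + 1 <= min_degree G) :
  exists H : seq (seq G),
    [/\ size H = k, all (@is_cycle G) H & length_condition H].
Proof.
rewrite addn1 in G_mindeg.
(* On three vertices [nconnected 3] fails because of the order and there need not be a 2-cut; then G
   is a triangle and k = 1. *)
have [G3|G3] := leqP #|G| 3.
  have eG : #|G| = 3 by apply/eqP; rewrite eqn_leq G3; have /andP[] := G_2conn.
  have [c [cc sc]] : exists c : seq G, is_cycle c /\ size c = 3.
    by apply: triangle_of_order3 eG _; apply: leq_trans G_mindeg.
  have k1 : k = 1.
    have [x _] : exists x : G, true.
      by have /card_gt0P[x _] : 0 < #|G| by [rewrite eG]; exists x.
    have := leq_trans G_mindeg (min_degree_le x).
    have : degree x <= #|[set~ x]|.
      apply: subset_leq_card; apply/subsetP => w; rewrite !inE.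
      by apply: contraTneq => ->; rewrite adj_irr.
    by rewrite cardsC1 eG; move: k_gt0; clear; lia.
  by apply: (@cycles_of_sizes G k 3) => // i; rewrite k1 ltnS leqn0 => /eqP ->; exists c.
move: G_not_3conn; rewrite /nconnected G3 /= => /forallPn[S]; rewrite negb_imply => /andP[S3 nc].
have S2 : #|S| = 2.
  apply/eqP; rewrite eqn_leq -ltnS S3 /= ltnNge; apply: contra nc => S1.
  by have /andP[_ /forallP/(_ S)] := G_2conn; rewrite ltnS S1.
have /eqP/cards2P[x [y [xy eS]]] := S2.
move: nc; rewrite {}eS in S3 S2 * => /forall_inPn[u uS] /forall_inPn[w wS] nuw.
have wu : w \notin reach (@adj G) (~: [set x; y]) u by rewrite inE.
have sym : connect_sym (induced_adj (~: [set x; y])).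
  by apply: sym_connect_sym => a b; rewrite /induced_adj /= (@adj_sym G) andbCA.
have uw : u \notin reach (@adj G) (~: [set x; y]) w by rewrite inE; rewrite sym in nuw.
have uS' : u \notin [set x; y] by rewrite -in_setC.
have wS' : w \notin [set x; y] by rewrite -in_setC.
have A1 := side_paths G_2conn G_mindeg xy uS' wS' wu.
have A2 := side_paths G_2conn G_mindeg xy wS' uS' uw.
have [l hl] := progression_step2 A1 A2 k_gt0.
apply: (cycles_of_sizes (l := l)) => // i ik.
have [a [b [[a1 La] [b1 Lb] <-]]] := hl i ik.
have sub v : v \in ~: [set x; y] -> forall c, c \in [set x; y] ->
    c \notin reach (@adj G) (~: [set x; y]) v.
  by move=> vS c cS; apply/negP => /(subsetP (reach_sub _ vS)); rewrite in_setC cS.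
apply: (cycle_of_paths _ _ _ _ xy _ a1 b1 La Lb); rewrite ?sub ?set21 ?set22 //.
rewrite disjoints_subset; apply/subsetP => v; rewrite in_setC => uv; apply: contraNN wu => wv.
move: uv wv; rewrite !inE => uv wv; apply: connect_trans uv _.
by have := wv; rewrite -/(connect (induced_adj (~: [set x; y])) w v) sym.
Qed.
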